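(* There is a (strongly) flat connection à la Knizhnik–Zamolodchikov/Reshetikhin, defined on the vector bundle of genus-zero vacua/covacua for affine generalised singularity modules, extending the irregular Knizhnik–Zamolodchikov connection of Felder–Rembado from the generic case. Precisely, let $\boldsymbol\psi_1,\dots,\boldsymbol\psi_n$ be parabolic filtrations of $\Phi$ of depths at most $r_1,\dots,r_n\ge1$, with formal types $\boldsymbol\lambda_i\in\mathfrak Z_{\boldsymbol\phi_i}^\vee$ for their Levi factors $\boldsymbol\phi_i$, and let $\kappa\in\mathbb C$ be a noncritical level, $\kappa\neq-h^\vee$. Let $\widehat{\mathbb M}=\bigotimes_{i=1}^n\widehat M_i$ be the tensor product of the affine generalised singularity modules $\widehat M_i=\widehat M^{\boldsymbol\psi_i}_{\boldsymbol\lambda_i,\kappa}$. Then the (strongly) flat connection $$\widehat\nabla=\mathrm d-\widehat\varpi,\qquad \widehat\varpi=\sum_{i=1}^nL_{-1}^{(i)}\,\mathrm dt_i,$$ defined on the trivial vector bundle $\widehat{\mathbb M}\times\boldsymbol B_n\to\boldsymbol B_n$, is compatible with the $\mathfrak g(\ast D)$-action, i.e., $$\bigl[f,\widehat\nabla_{\partial_{t_i}}\bigr]\widehat\psi=(\partial_{t_i}f)\,\widehat\psi$$ for all $i\in\{1,\dots,n\}$, all local sections $\widehat\psi$ of the vector bundle, and all local sections $f$ of (the sheaf-theoretic version of) $\mathfrak g(\ast D)$. Therefore it descends to a (strongly) flat connection on the vector bundle of covacua, with fibres $\widehat{\mathbb M}/\mathfrak g(\ast D)\widehat{\mathbb M}$;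 and an analogous construction works for the dual bundle of vacua, with fibres $\operatorname{Hom}_{\mathfrak g(\ast D)}(\widehat{\mathbb M},\mathbb C)$.
   Context: $\mathfrak g$ is a complex reductive Lie algebra with nondegenerate invariant symmetric bilinear form $(\cdot\mid\cdot)$, Cartan subalgebra $\mathfrak t$, root system $\Phi$ and root spaces $\mathfrak g_\alpha$. The affine Lie algebra is $\widehat{\mathfrak g}=\mathfrak g((z))\oplus\mathbb CK$, with $K$ central and $[Xf,Yf']=[X,Y]ff'+(X\mid Y)\operatorname{Res}_{z=0}(f'\mathrm df)K$. A subset $\psi\subseteq\Phi$ is parabolic if it is closed under sums within $\Phi$ and $\psi\cup(-\psi)=\Phi$; its Levi factor is $\phi=\psi\cap(-\psi)$; $\mathfrak p_\psi=\mathfrak t\oplus\bigoplus_{\alpha\in\psi}\mathfrak g_\alpha$, $\mathfrak l_\phi=\mathfrak t\oplus\bigoplus_{\alpha\in\phi}\mathfrak g_\alpha$, and $\mathfrak Z_\phi=\bigcap_{\alpha\in\phi}\ker\alpha\subseteq\mathfrak t$ is the centre of $\mathfrak l_\phi$. A parabolic filtration of depth at most $r$ is a sequence $\boldsymbol\psi=(\psi_i)_{i\ge0}$ of parabolic subsets with $\psi_i\subseteq\psi_{i+1}$ and $\psi_i=\Phi$ for $i\ge r$; its Levi factor is $\boldsymbol\phi=(\phi_i)_i$, $\phi_i=\psi_i\cap(-\psi_i)$. The generic case is the one where $\psi_0=\dots=\psi_{r-1}$ is a system of positive roots. Set $\widehat{\mathfrak p}_{\boldsymbol\psi}=\{\sum_{i\ge0}X_iz^i: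 X_i\in\mathfrak p_{\psi_i}\}\oplus\mathbb CK\subseteq\widehat{\mathfrak g}$. A formal type is $\boldsymbol\lambda=(\lambda_0,\dots,\lambda_{r-1})\in\mathfrak Z_{\boldsymbol\phi}^\vee=\bigoplus_{i=0}^{r-1}\mathfrak Z_{\phi_i}^\vee$. With a level $\kappa$ it determines a character $\boldsymbol\chi$ of $\widehat{\mathfrak p}_{\boldsymbol\psi}$ by $\boldsymbol\chi(K)=\kappa$, $\boldsymbol\chi(Xz^i)=\lambda_i(X)$ for $X\in\mathfrak Z_{\phi_i}$ and $i<r$, $\boldsymbol\chi=0$ on $[\mathfrak p_{\psi_i},\mathfrak p_{\psi_i}]z^i$ for $i<r$, and $\boldsymbol\chi=0$ on $z^r\mathfrak g[[z]]$. The affine generalised singularity module is $\widehat M^{\boldsymbol\psi}_{\boldsymbol\lambda,\kappa}=U\widehat{\mathfrak g}\otimes_{U\widehat{\mathfrak p}_{\boldsymbol\psi}}\mathbb C_{\boldsymbol\chi}$. It is smooth: every vector is annihilated by $z^N\mathfrak g[[z]]$ for $N\gg0$. The Virasoro generators $L_m$ act on such modules at noncritical level $\kappa\neq-h^\vee$ by the Segal–Sugawara representation, $2(\kappa+h^\vee)L_m=\sum_{j\in\mathbb Z}\sum_k:X_kz^{-j}\cdot X^kz^{m+j}:$, where $h^\vee$ is the dual Coxeter number of the quadratic Lie algebra $(\mathfrak g,(\cdot\mid\cdot))$, $(X_k)_k$ and $(X^k)_k$ are $(\cdot\mid\cdot)$-dual bases of $\mathfrak g$, and $:\ :$ is the normal-ordered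 product (the factor with the higher power of $z$ is put on the right). $L_{-1}^{(i)}$ denotes the action of $L_{-1}$ on the $i$-th tensor slot of $\widehat{\mathbb M}$. $\boldsymbol B_n=\{(t_1,\dots,t_n)\in\mathbb C^n: t_i\neq t_j\text{ if }i\neq j\}$. For $t\in\boldsymbol B_n$, regarded as $n$ distinct points of $\mathbb C\subseteq\mathbb CP^1$ with affine coordinate $z$, $\mathfrak g(\ast D)$ is the Lie algebra of $\mathfrak g$-valued meromorphic functions on $\mathbb CP^1$ with poles at most at $t_1,\dots,t_n$ (where $D=\sum_ir_i[t_i]$); it acts on $\widehat{\mathbb M}$ by $f\mapsto\sum_{j=1}^n\mathcal L_j(f)^{(j)}$, with $\mathcal L_j(f)\in\mathfrak g((z_j))$ the Laurent expansion at $t_j$ in the local coordinate $z_j=z-t_j$, acting on the $j$-th slot. Letting the points move in $\boldsymbol B_n$ yields the sheaf-theoretic version of $\mathfrak g(\ast D)$, whose local sections are families of such functions depending on $t=(t_1,\dots,t_n)$.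
   Formalization: With the stated conventions L_{-1} acts as -d/dz, so the printed formula fails; proved: d + ϖ satisfies [∇_i, f]ψ = (∂_i f)ψ and descends to covacua, its dual to vacua; d ± ϖ are both flat. h^∨ is half the adjoint Casimir eigenvalue, assumed to exist. *)

(* Defs.v *)
From HB Require Import structures.
From mathcomp Require Import all_boot all_order all_algebra finmap complex.
From mathcomp Require Import all_classical all_reals all_analysis.

Set Implicit Arguments.
Unset Strict Implicit.
Unset Printing Implicit Defensive.

Import Order.TTheory GRing.Theory Num.Theory numFieldNormedType.Exports.
Local Open Scope classical_set_scope.
Local Open Scope ring_scope.

(* A numClosedFieldType carries the norm topology; R[i] itself does not. *)
Definition cplx (R : realType) : numClosedFieldType := R[i].

Section Span.
Variables (C : numClosedFieldType) (V : lmodType C).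

Inductive lspan (A : set V) : set V :=
| lspan_in x : A x -> lspan A x
| lspan_0 : lspan A 0
| lspan_lin a x y : lspan A x -> lspan A y -> lspan A (a *: x + y).

Definition linear_on (W : lmodType C) (S : set V) (f : V -> W) :=
  forall a x y, S x -> S y -> f (a *: x + y) = a *: f x + f y.

Definition bilinear_map (W : lmodType C) (f : V -> V -> W) :=
  (forall z, linear_on setT (f^~ z)) /\ (forall z, linear_on setT (f z)).

End Span.

Section Quotient.
Variables (C : numClosedFieldType) (V : lmodType C) (S : set V).

Definition lquot_rel : rel V := fun x y => `[< lspan S (x - y) >].

Lemma lspanN x : lspan S x -> lspan S (- x).
Proof.
by move=> Sx; rewrite -[- x]addr0 -scaleN1r; apply: lspan_lin (lspan_0 _).
Qed.

Lemma lspanD x y : lspan S x -> lspan S y -> lspan S (x + y).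
Proof. by move=> Sx Sy; rewrite -[x]scale1r; apply: lspan_lin. Qed.

Lemma lquot_rel_equiv : equiv_class_of lquot_rel.
Proof.
apply: EquivClass.
- by move=> x; apply/asboolP; rewrite subrr; apply: lspan_0.
- by move=> x y; apply/asboolP/asboolP => /lspanN; rewrite opprB.
- move=> y x z /asboolP xy /asboolP yz; apply/asboolP.
  by rewrite -(subrK y x) -addrA; apply: lspanD.
Qed.

Canonical lquot_equiv := EquivRelPack lquot_rel_equiv.

Definition lquot : Type := {eq_quot lquot_rel}%qT.
HB.instance Definition _ := Choice.on lquot.
HB.instance Definition _ := Quotient.on lquot.

Definition qpi (x : V) : lquot := (\pi_lquot x)%qT.
Definition qrepr (x : lquot) : V := repr x.

Lemma qreprK x : qpi (qrepr x) = x.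
Proof. by rewrite /qpi /qrepr reprK. Qed.

Lemma qpiP x y : qpi x = qpi y <-> lspan S (x - y).
Proof.
split=> [/eqP|xy]; first by rewrite eqmodE => /asboolP.
by apply/eqP; rewrite eqmodE; apply/asboolP.
Qed.

Lemma qrepr_pi x : lspan S (qrepr (qpi x) - x).
Proof. by apply/qpiP; rewrite qreprK. Qed.

Definition lquot_add (x y : lquot) := qpi (qrepr x + qrepr y).
Definition lquot_opp (x : lquot) := qpi (- qrepr x).
Definition lquot_scale (a : C) (x : lquot) := qpi (a *: qrepr x).

Lemma lquot_addE x y : lquot_add (qpi x) (qpi y) = qpi (x + y).
Proof. by apply/qpiP; rewrite opprD addrACA; apply: lspanD; apply: qrepr_pi. Qed.

Lemma lquot_oppE x : lquot_opp (qpi x) = qpi (- x).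
Proof. by apply/qpiP; rewrite -opprD; apply: lspanN; apply: qrepr_pi. Qed.

Lemma lquot_scaleE a x : lquot_scale a (qpi x) = qpi (a *: x).
Proof.
apply/qpiP; rewrite -scalerBr -[_ *: _]addr0.
by apply: lspan_lin (lspan_0 _); apply: qrepr_pi.
Qed.

Lemma lquot_addA : associative lquot_add.
Proof.
move=> x y z; rewrite -(qreprK x) -(qreprK y) -(qreprK z).
by rewrite !lquot_addE addrA.
Qed.

Lemma lquot_addC : commutative lquot_add.
Proof.
by move=> x y; rewrite -(qreprK x) -(qreprK y) !lquot_addE addrC.
Qed.

Lemma lquot_add0 : left_id (qpi 0) lquot_add.
Proof. by move=> x; rewrite -(qreprK x) lquot_addE add0r. Qed.

Lemma lquot_addN : left_inverse (qpi 0) lquot_opp lquot_add.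
Proof.
by move=> x; rewrite -(qreprK x) lquot_oppE lquot_addE addNr.
Qed.

HB.instance Definition _ := GRing.isZmodule.Build lquot
  lquot_addA lquot_addC lquot_add0 lquot_addN.

Lemma lquot_scaleA a b x :
  lquot_scale a (lquot_scale b x) = lquot_scale (a * b) x.
Proof. by rewrite -(qreprK x) !lquot_scaleE scalerA. Qed.

Lemma lquot_scale1 : left_id 1 lquot_scale.
Proof. by move=> x; rewrite -(qreprK x) !lquot_scaleE scale1r. Qed.

Lemma lquot_scaleDr : right_distributive lquot_scale +%R.
Proof.
move=> a x y; rewrite -(qreprK x) -(qreprK y) /GRing.add /=.
by rewrite !(lquot_scaleE, lquot_addE) scalerDr.
Qed.

Lemma lquot_scaleDl x : {morph lquot_scale^~ x : a b / a + b}.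
Proof.
move=> a b; rewrite -(qreprK x) [in RHS]/GRing.add /=.
by rewrite !(lquot_scaleE, lquot_addE) scalerDl.
Qed.

HB.instance Definition _ := GRing.Zmodule_isLmodule.Build C lquot
  lquot_scaleA lquot_scale1 lquot_scaleDr lquot_scaleDl.

(* The map induced on the quotient; only meaningful when F is linear and       *)
(* vanishes on S, see qliftE.                                                  *)
Definition qlift (W : lmodType C) (F : V -> W) (x : lquot) : W := F (qrepr x).

Lemma qpi_linear : linear_on setT qpi.
Proof.
move=> a x y _ _.
by rewrite -[RHS]/(lquot_add (lquot_scale _ _) _) lquot_scaleE lquot_addE.
Qed.

Lemma linear_on_lspan0 (W : lmodType C) (F : V -> W) :
  linear_on setT F -> (forall x, S x -> F x = 0) ->
  forall x, lspan S x -> F x = 0.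
Proof.
move=> Flin FS x; elim=> [y /FS //| |a y z _ Fy _ Fz]; last first.
  by rewrite Flin // Fy Fz scaler0 addr0.
by have := Flin 1 0 0 I I; rewrite !scale1r addr0 -{1}[F 0]addr0 => /addrI.
Qed.

Lemma qliftE (W : lmodType C) (F : V -> W) :
  linear_on setT F -> (forall x, S x -> F x = 0) ->
  forall x, qlift F (qpi x) = F x.
Proof.
move=> Flin FS x; have := linear_on_lspan0 Flin FS (qrepr_pi x).
rewrite -scaleN1r addrC Flin // scaleN1r addrC => /eqP.
by rewrite subr_eq0 => /eqP.
Qed.

End Quotient.

Section FreeModule.
Variables (C : numClosedFieldType) (T : choiceType).

Definition fin_supp : {pred T -> C^o} :=
  fun f => `[< finite_set [set t | f t != 0] >].

Lemma fin_supp_submod : GRing.submod_closed fin_supp.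
Proof.
split=> [|a f g /asboolP ff /asboolP fg]; apply/asboolP.
  by rewrite (_ : [set _ | _] = set0) // -subset0 => t /= /eqP[].
apply: (@sub_finite_set _ _ ([set t | f t != 0] `|` [set t | g t != 0])).
  move=> t /= nz; case: (eqVneq (f t) 0) => [ft0|]; last by left.
  case: (eqVneq (g t) 0) => [gt0|]; last by right.
  by move: nz; rewrite -[_ t]/(a *: f t + g t) ft0 gt0 scaler0 addr0 eqxx.
by rewrite finite_setU.
Qed.

HB.instance Definition _ := GRing.isSubmodClosed.Build C (T -> C^o) fin_supp
  (GRing.submod_closed_semi fin_supp_submod).

Record fmod := FMod { fmod_val :> T -> C^o; _ : fmod_val \in fin_supp }.
HB.instance Definition _ := [isSub for fmod_val].
HB.instance Definition _ := [Choice of fmod by <:].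
HB.instance Definition _ := [SubChoice_isSubLmodule of fmod by <:].

Lemma fbase_subproof (t : T) : (fun s => (s == t)%:R : C^o) \in fin_supp.
Proof.
apply/asboolP; apply: (@sub_finite_set _ _ [set t]) => [s /=|]; last first.
  exact: finite_set1.
by case: (s =P t) => // _ /eqP[].
Qed.

Definition fbase (t : T) : fmod := FMod (fbase_subproof t).

Definition fext (W : lmodType C) (F : T -> W) (f : fmod) : W :=
  \sum_(t \in [set: T]) f t *: F t.

Lemma fext_supp (W : lmodType C) (F : T -> W) (f : fmod) (A : set T) :
  finite_set A -> [set t | f t != 0] `<=` A ->
  fext F f = \sum_(t <- fset_set A) f t *: F t.
Proof.
move=> finA sA; rewrite /fext -(fsbig_widen A setT) //; last first.
  move=> t [_ /= At]; have [->|nz] := eqVneq (f t) 0; first by rewrite scale0r.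
  by case: At; apply: sA.
by rewrite (fsbig_finite _ _ finA).
Qed.

Lemma fext_linear (W : lmodType C) (F : T -> W) : linear_on setT (fext F).
Proof.
move=> a f g _ _.
have fin_f : finite_set [set t | f t != 0] by case: f => f /= /asboolP.
have fin_g : finite_set [set t | g t != 0] by case: g => g /= /asboolP.
have finA : finite_set ([set t | f t != 0] `|` [set t | g t != 0]).
  by rewrite finite_setU.
have sf : [set t | f t != 0] `<=` [set t | f t != 0] `|` [set t | g t != 0].
  by move=> t; left.
have sg : [set t | g t != 0] `<=` [set t | f t != 0] `|` [set t | g t != 0].
  by move=> t; right.
have sfg : [set t | (a *: f + g) t != 0] `<=`
    [set t | f t != 0] `|` [set t | g t != 0].
  move=> t /= nz; case: (eqVneq (f t) 0) => [ft0|]; last by left.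
  right; apply: contraNneq nz => gt0.
  by rewrite -[_ t]/(a *: f t + g t) ft0 gt0 scaler0 addr0.
rewrite (fext_supp F finA sf) (fext_supp F finA sg) (fext_supp F finA sfg).
rewrite scaler_sumr -big_split /=; apply: eq_bigr => t _.
by rewrite scalerA -scalerDl.
Qed.

Lemma fext_base (W : lmodType C) (F : T -> W) t : fext F (fbase t) = F t.
Proof.
rewrite (fext_supp F (finite_set1 t)) => [|s /= /eqP]; last first.
  by case: (s =P t) => // _ [].
by rewrite fset_set1 big_seq_fset1 /= eqxx scale1r.
Qed.

End FreeModule.

Section Tensor.
Variables (C : numClosedFieldType) (n : nat) (M : 'I_n -> lmodType C).

Local Notation fam := {classic (forall i, M i)}.

Definition tens_rel : set (fmod C fam) := [set z |
  exists i (m : forall i, M i) a (u v : M i),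
  z = fbase C (dfwith m i (a *: u + v) : fam)
      - (a *: fbase C (dfwith m i u : fam) + fbase C (dfwith m i v : fam))].

Definition tensor : lmodType C := lquot tens_rel.

Definition tpure (m : forall i, M i) : tensor := qpi _ (fbase C (m : fam)).

(* The i-th slot action T^(i) of a linear operator T, see slot_pure. *)
Definition slot (i : 'I_n) (T : M i -> M i) : tensor -> tensor :=
  qlift (fext (fun m : fam => tpure (dfwith m i (T (m i))))).

Lemma tpure_linear i (m : forall i, M i) :
  linear_on setT (fun u => tpure (dfwith m i u)).
Proof.
move=> a u v _ _; rewrite /tpure -qpi_linear //; apply/qpiP.
by apply: lspan_in; exists i, m, a, u, v.
Qed.

Lemma slot_pure i (T : M i -> M i) (m : forall i, M i) :
  linear_on setT T -> slot T (tpure m) = tpure (dfwith m i (T (m i))).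
Proof.
move=> Tlin; rewrite /slot qliftE ?fext_base //; first exact: fext_linear.
move=> _ [j [{}m [a [u [v ->]]]]].
set F := (F in fext F _).
rewrite addrC -scaleN1r fext_linear // fext_linear // !fext_base scaleN1r.
apply/eqP; rewrite addrC subr_eq0; apply/eqP.
rewrite {}/F /=; case: (eqVneq j i) => [ji|ji].
  subst j; have E w z : dfwith (dfwith m i w) i z = dfwith m i z.
    apply: functional_extensionality_dep => k.
    case: (eqVneq i k) => [ik|ik]; last by rewrite !dfwithout.
    by subst k; rewrite !dfwithin.
  by rewrite !E !dfwithin Tlin // tpure_linear.
have E w z : dfwith (dfwith m j w) i z = dfwith (dfwith m i z) j w.
  apply: functional_extensionality_dep => k.
  case: (eqVneq i k) => [ik|ik].
    by subst k; rewrite dfwithin dfwithout ?dfwithin.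
  rewrite dfwithout //; case: (eqVneq j k) => [jk|jk].
    by subst k; rewrite !dfwithin.
  by rewrite !dfwithout.
by rewrite !(dfwithout _ _ ji) !E tpure_linear.
Qed.

End Tensor.

Section LieAxioms.
Variables (C : numClosedFieldType) (g : vectType C) (br : g -> g -> g).

Definition is_lie_bracket :=
  [/\ bilinear_map br, forall x, br x x = 0 &
      forall x y z, br x (br y z) + br y (br z x) + br z (br x y) = 0].

Definition is_ideal (I : {vspace g}) := forall x y, y \in I -> br x y \in I.

(* Reductive: the adjoint representation is semisimple. *)
Definition is_reductive := forall I : {vspace g}, is_ideal I ->
  exists J : {vspace g},
    [/\ is_ideal J, (I + J = fullv)%VS & (I :&: J = 0)%VS].

Definition vbracket (U W : {vspace g}) : {vspace g} :=
  <<[seq br u w | u <- vbasis U, w <- vbasis W]>>%VS.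

Definition is_cartan (t : {vspace g}) :=
  [/\ (vbracket t t <= t)%VS,
      exists k, iter k (vbracket t) t = 0%VS &
      forall x, (forall y, y \in t -> br x y \in t) -> x \in t].

Definition is_quadratic_form (frm : g -> g -> C^o) :=
  [/\ bilinear_map frm, forall x y, frm x y = frm y x,
      forall x y z, frm (br x y) z = frm x (br y z) &
      forall x, (forall y, frm x y = 0) -> x = 0].

End LieAxioms.

Record quad_lie (C : numClosedFieldType) := QuadLie {
  ql_sort :> vectType C;
  lbr : ql_sort -> ql_sort -> ql_sort;
  lfrm : ql_sort -> ql_sort -> C^o;
  cartan : {vspace ql_sort};
  lbr_lie : is_lie_bracket lbr;
  ql_reductive : is_reductive lbr;
  lfrm_quad : is_quadratic_form lbr lfrm;
  cartanP : is_cartan lbr cartan }.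

Section Roots.
Variables (C : numClosedFieldType) (g : quad_lie C).

Definition cartan_dual : vectType C := 'Hom(subvs_of (cartan g), C^o).

Implicit Types (psi phi : set cartan_dual) (a b : cartan_dual).

Definition rootspace a : set g :=
  [set X | forall H : subvs_of (cartan g), lbr (vsval H) X = a H *: X].

Definition roots : set cartan_dual :=
  [set a | a != 0 /\ exists2 X, X != 0 & rootspace a X].

Definition opp_roots psi : set cartan_dual := [set a | psi (- a)].

Definition parabolic psi :=
  [/\ psi `<=` roots,
      forall a b, psi a -> psi b -> roots (a + b) -> psi (a + b) &
      psi `|` opp_roots psi = roots].

Definition levi psi := psi `&` opp_roots psi.

Definition psub psi : set g :=
  lspan ([set H | H \in cartan g] `|`
         [set X | exists2 a, psi a & rootspace a X]).

(* The centre Z_phi of the Levi subalgebra of a Levi subsystem. *)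
Definition levi_centre phi : set g :=
  [set X | exists2 H : subvs_of (cartan g),
     X = vsval H & forall a, phi a -> a H = 0].

Definition parabolic_filtration (r : nat) (psi : nat -> set cartan_dual) :=
  [/\ forall i, parabolic (psi i), forall i, psi i `<=` psi i.+1 &
      forall i, (r <= i)%N -> psi i = roots].

(* An element of the dual of Z_(phi_i) is given by a function on g which is    *)
(* linear on Z_(phi_i); its other values are never used.                       *)
Definition formal_type (r : nat) (psi : nat -> set cartan_dual)
    (lam : 'I_r -> g -> C^o) :=
  forall i : 'I_r, linear_on (levi_centre (levi (psi i))) (lam i).

Definition dual_bases (X Y : 'I_(\dim {: g}) -> g) :=
  forall k l, lfrm (X k) (Y l) = (k == l)%:R.

(* h is half the eigenvalue of the Casimir element on the adjoint             *)
(* representation.                                                             *)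
Definition is_dual_coxeter (h : C) := exists X Y, dual_bases X Y /\
  forall Z, \sum_k lbr (X k) (lbr (Y k) Z) = (2 * h) *: Z.

End Roots.

Section Laurent.
Variables (C : numClosedFieldType) (g : quad_lie C).

Definition below : {pred int -> g} :=
  fun f => `[< exists N : int, forall k, k < N -> f k = 0 >].

Lemma below_submod : GRing.submod_closed below.
Proof.
split=> [|a f h /asboolP[N fN] /asboolP[M hM]]; apply/asboolP.
  by exists 0.
exists (Order.min N M) => k; rewrite lt_min => /andP[kN kM].
by rewrite -[LHS]/(a *: f k + h k) fN // hM // scaler0 addr0.
Qed.

HB.instance Definition _ := GRing.isSubmodClosed.Build C (int -> g) below
  (GRing.submod_closed_semi below_submod).

(* g((z)): f k is the coefficient of z^k. *)
Record laurent := Laurent { lcoef :> int -> g; _ : lcoef \in below }.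
HB.instance Definition _ := [isSub for lcoef].
HB.instance Definition _ := [Choice of laurent by <:].
HB.instance Definition _ := [SubChoice_isSubLmodule of laurent by <:].

Lemma laurent_br_subproof (f h : laurent) :
  (fun k => \sum_(i \in [set: int]) lbr (f i) (h (k - i))) \in below.
Proof.
have [N fN] : exists N, forall k, k < N -> f k = 0 by case: f => ? p; apply/asboolP.
have [M hM] : exists M, forall k, k < M -> h k = 0 by case: h => ? p; apply/asboolP.
apply/asboolP.
have [[brl brr] _ _] := lbr_lie g.
have br0 x : lbr (0 : g) x = 0.
  have := brl x 1 0 0 I I; rewrite !scale1r addr0 -{1}[lbr _ _]addr0.
  by move=> /addrI.
have br0r x : lbr x (0 : g) = 0.
  have := brr x 1 0 0 I I; rewrite !scale1r addr0 -{1}[lbr _ _]addr0.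
  by move=> /addrI.
exists (N + M) => k kNM; apply: fsbig1 => i _ /=.
have [iN|Ni] := ltP i N; first by rewrite fN.
by rewrite hM // ltrBlDr (lt_le_trans kNM) // addrC lerD2l.
Qed.

Definition laurent_br (f h : laurent) : laurent :=
  Laurent (laurent_br_subproof f h).

Lemma monomial_subproof (X : g) (k : int) :
  (fun l => if l == k then X else 0) \in below.
Proof.
by apply/asboolP; exists k => l lk; case: eqP lk => // ->; rewrite ltxx.
Qed.

Definition monomial (X : g) (k : int) : laurent :=
  Laurent (monomial_subproof X k).

(* (f, c) stands for f + c K. *)
Definition affine : lmodType C := (laurent * C^o)%type.

Definition aK : affine := (0, 1).
Definition aX (X : g) (k : int) : affine := (monomial X k, 0).

(* Res (f' df) is the sum over k of k f_k f'_(-k). *)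
Definition affine_br (x y : affine) : affine :=
  (laurent_br x.1 y.1,
   \sum_(k \in [set: int]) k%:~R * lfrm (x.1 k) (y.1 (- k))).

Definition phat (psi : nat -> set (cartan_dual g)) : set affine :=
  [set x : affine | (forall k : int, k < 0 -> x.1 k = 0) /\
           (forall i : nat, psub (psi i) (x.1 i%:Z))].

(* The character chi of phat determined by a formal type and a level; only its *)
(* values on phat are used.                                                    *)
Definition is_singular_char (r : nat) (psi : nat -> set (cartan_dual g))
    (lam : 'I_r -> g -> C^o) (kappa : C) (chi : affine -> C^o) :=
  [/\ linear_on (phat psi) chi,
      chi aK = kappa,
      forall (i : 'I_r) X,
        levi_centre (levi (psi i)) X -> chi (aX X i%:Z) = lam i X,
      forall (i : 'I_r) X Y,
        psub (psi i) X -> psub (psi i) Y -> chi (aX (lbr X Y) i%:Z) = 0 &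
      forall f : laurent, (forall k, k < r%:Z -> f k = 0) ->
        chi (f, 0) = 0].

End Laurent.

Section Induced.
Variables (C : numClosedFieldType) (L : lmodType C) (brL : L -> L -> L).
Variables (P : set L) (chi : L -> C^o).

Local Notation word := (fbase C (T := seq L)).

(* The relations of the enveloping algebra U(L) on the free module on words   *)
(* in L, a word standing for the product of its letters.                       *)
Definition env_rel : set (fmod C (seq L)) := [set z |
  (exists u v a x y, z = word (u ++ (a *: x + y) :: v)
     - (a *: word (u ++ x :: v) + word (u ++ y :: v))) \/
  (exists u v x y, z = word (u ++ [:: x, y & v])
     - (word (u ++ [:: y, x & v]) + word (u ++ brL x y :: v)))].

(* U(L) (x)_(U(P)) C_chi: since U(P) is generated by P, balancing the tensor   *)
(* product amounts to u x (x) 1 = u (x) chi(x) for x in P and u in U(L).       *)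
Definition balance_rel : set (fmod C (seq L)) := [set z |
  exists2 x, P x & exists u, z = word (rcons u x) - chi x *: word u].

Definition induced : lmodType C := lquot (env_rel `|` balance_rel).

Definition ind_word (u : seq L) : induced := qpi _ (word u).

Definition ind_act (x : L) : induced -> induced :=
  qlift (fext (fun u => ind_word (x :: u))).

Lemma ind_act_word x u : ind_act x (ind_word u) = ind_word (x :: u).
Proof.
rewrite /ind_act qliftE ?fext_base //; first exact: fext_linear.
pose F u := ind_word (x :: u).
have FB z w : fext F (z - w) = fext F z - fext F w.
  by rewrite (addrC z) -[- w]scaleN1r fext_linear // scaleN1r addrC.
have pi0 z (zR : (env_rel `|` balance_rel) z) : qpi (env_rel `|` balance_rel) z = 0.
  by apply/qpiP; rewrite subr0; apply: lspan_in.
have qlin := @qpi_linear _ _ (env_rel `|` balance_rel).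
have qB z w : qpi (env_rel `|` balance_rel) (z - w) = qpi _ z - qpi _ w.
  by rewrite (addrC z) -[- w]scaleN1r qlin // scaleN1r addrC.
move=> z [[[u' [v [a [y1 [y2 ->]]]]]|[u' [v [y1 [y2 ->]]]]]|[y Py [u' ->]]].
- rewrite FB fext_linear // !fext_base /F /ind_word -qlin // -qB.
  by apply: pi0; left; left; exists (x :: u'), v, a, y1, y2.
- rewrite FB -[word (u' ++ [:: y2, y1 & v])]scale1r fext_linear // !fext_base.
  rewrite /F /ind_word -qlin // -qB scale1r.
  by apply: pi0; left; right; exists (x :: u'), v, y1, y2.
- have FZ a z0 : fext F (a *: z0) = a *: fext F z0.
    have F0 : fext F 0 = 0 by rewrite -{1}(subrr 0) FB subrr.
    by rewrite -[a *: z0]addr0 fext_linear // F0 addr0.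
  have qZ a z0 : qpi (env_rel `|` balance_rel) (a *: z0) = a *: qpi _ z0.
    have q0 : qpi (env_rel `|` balance_rel) 0 = 0.
      by rewrite -{1}(subrr 0) qB subrr.
    by rewrite -[a *: z0]addr0 qlin // q0 addr0.
  rewrite FB FZ !fext_base /F /ind_word -qZ -qB.
  by apply: pi0; right; exists y => //; exists (x :: u').
Qed.

End Induced.

Definition sing_module (C : numClosedFieldType) (g : quad_lie C)
    (psi : nat -> set (cartan_dual g)) (chi : affine g -> C^o) : lmodType C :=
  induced (@affine_br C g) (phat psi) chi.

Definition sing_act (C : numClosedFieldType) (g : quad_lie C)
    (psi : nat -> set (cartan_dual g)) (chi : affine g -> C^o)
    (x : affine g) : sing_module psi chi -> sing_module psi chi :=
  ind_act x.

(* The operator L_m on a module V, for dual bases X, Y.  On smooth modules all *)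
(* but finitely many j contribute 0 to the sum.                                *)
Definition sugawara (C : numClosedFieldType) (g : quad_lie C)
    (X Y : 'I_(\dim {: g}) -> g) (h kappa : C)
    (V : lmodType C) (act : affine g -> V -> V) (m : int) (v : V) : V :=
  (2 * (kappa + h))^-1 *: \sum_(j \in [set: int]) \sum_k
    (if - j <= m + j then act (aX (X k) (- j)) (act (aX (Y k) (m + j)) v)
     else act (aX (Y k) (m + j)) (act (aX (X k) (- j)) v)).

Section Sections.
Variables (C : numClosedFieldType) (n : nat).
Local Notation pt := 'rV[C]_n.

Definition pderiv (i : 'I_n) (c : pt -> C^o) (t : pt) : C^o :=
  'D_(delta_mx ord0 i) c t.

Fixpoint holo_upto (k : nat) (U : set pt) (c : pt -> C^o) : Prop :=
  (forall t, U t -> {for t, continuous c}) /\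
  if k is k'.+1 then forall i : 'I_n,
    (forall t, U t -> derivable c t (delta_mx ord0 i)) /\
    holo_upto k' U (pderiv i c)
  else True.

(* Holomorphic on the open set U, in the form of complex differentiability of *)
(* all orders (equivalent, by Osgood and Cauchy, to that of order one).        *)
Definition holo (U : set pt) (c : pt -> C^o) := forall k, holo_upto k U c.

Definition config : set pt :=
  [set t | forall i j, i != j -> t ord0 i != t ord0 j].

Section Trivial.
Variable V : lmodType C.
Implicit Types (U W : set pt) (s : pt -> V).

Definition decomp W (k : nat) (c : 'I_k -> pt -> C^o) (e : 'I_k -> V) s :=
  (forall a, holo W (c a)) /\
  forall t, W t -> s t = \sum_a c a t *: e a.

(* Sections over U of the trivial bundle with (possibly infinite-dimensional) *)
(* fibre V, that is, of the sheaf O (x) V.                                     *)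
Definition lsec U s := forall t, U t ->
  exists W, [/\ open W, W t & exists k c e, @decomp W k c e s].

(* The partial derivative in t_i of a section of O (x) V: it sends c (x) e to *)
(* (d c / d t_i) (x) e.                                                        *)
Definition vpderiv (i : 'I_n) s (t : pt) : V :=
  xget 0 [set v | exists W, [/\ open W, W t &
    exists k c e, @decomp W k c e s /\ v = \sum_a pderiv i (c a) t *: e a]].

(* The connection d - w, for w the End(V)-valued one-form sum_i w_i dt_i *)
Definition nabla (w : 'I_n -> pt -> V -> V) (i : 'I_n) s (t : pt) : V :=
  vpderiv i s t - w i t (s t).

Definition strongly_flat (w : 'I_n -> pt -> V -> V) :=
  forall i j t, config t ->
    (forall v, vpderiv i (fun u => w j u v) t = vpderiv j (fun u => w i u v) t)
    /\ forall v, w i t (w j t v) = w j t (w i t v).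

End Trivial.

(* Connections on a sheaf of O-modules over config: a family of spaces E t,   *)
(* the sections over each open set, given as families of elements of the E t, *)
(* and the multiplication of such families by functions.                       *)
Section Connection.
Variables (E : pt -> lmodType C).
Variables (mulE : (pt -> C^o) -> (forall t, E t) -> forall t, E t).
Variables (sec : set pt -> set (forall t, E t)).

Definition is_connection (D : 'I_n -> (forall t, E t) -> forall t, E t) :=
  forall U i, open U -> U `<=` config ->
  [/\ forall s, sec U s -> sec U (D i s),
      forall s s', sec U s -> sec U s' -> (forall t, U t -> s t = s' t) ->
        forall t, U t -> D i s t = D i s' t,
      forall s s', sec U s -> sec U s' -> forall t, U t ->
        D i (fun u => s u + s' u) t = D i s t + D i s' t &
      forall c s, holo U c -> sec U s -> forall t, U t ->
        D i (mulE c s) t = mulE (pderiv i c) s t + mulE c (D i s) t].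

Definition is_flat (D : 'I_n -> (forall t, E t) -> forall t, E t) :=
  forall U i j s, open U -> U `<=` config -> sec U s ->
  forall t, U t -> D i (D j s) t = D j (D i s) t.

Definition flat_connection D := is_connection D /\ is_flat D.

End Connection.

Definition pmul (V : lmodType C) (c : pt -> C^o) (s : pt -> V) (t : pt) : V :=
  c t *: s t.

End Sections.
Arguments config {C n}.
Arguments lsec {C n V}.

Section Meromorphic.
Variables (C : numClosedFieldType) (g : quad_lie C) (n : nat).
Local Notation pt := 'rV[C]_n.

Definition off (t : pt) (z : C) := forall j, z != t ord0 j.

Definition pfrac (t : pt) (N : nat) (X0 : g) (X : 'I_n -> nat -> g) (z : C) :=
  X0 + \sum_j \sum_(m < N) (z - t ord0 j) ^- m.+1 *: X j m.

(* g( * D) at t: the meromorphic functions on CP^1, that is, the rational     *)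
(* functions, with poles at most at the t_j, written in partial fractions.     *)
(* Values at the t_j are irrelevant.                                           *)
Definition gD (t : pt) : set (C -> g) :=
  [set f | exists N X0 X, forall z, off t z -> f z = pfrac t N X0 X z].

Definition gDsec (U : set pt) : set (pt -> C -> g) := [set f |
  forall t, U t -> exists W, [/\ open W, W t & exists N X0 X,
    [/\ lsec W X0, forall j m, lsec W (X j m) &
        forall u, W u -> forall z, off u z ->
          f u z = pfrac u N (X0 u) (fun j m => X j m u) z]]].

Definition gDpderiv (i : 'I_n) (f : pt -> C -> g) (t : pt) (z : C) : g :=
  vpderiv i (fun u => f u z) t.

Definition is_laurent (f : C -> g) (t : C) (a : laurent g) :=
  exists N : nat, (forall k : int, k < - N%:Z -> a k = 0) /\
    \forall w \near (0 : C)^', forall l : 'Hom(g, C^o),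
      series (fun k : nat => w ^ (k%:Z - N%:Z) * l (a (k%:Z - N%:Z)))
        @ \oo --> (l (f (t + w)) : C^o).

Definition laurent_at (f : C -> g) (t : C) : laurent g :=
  xget 0 (is_laurent f t).

End Meromorphic.

Section Vacua.
Variables (C : numClosedFieldType) (g : quad_lie C) (n : nat).
Variables (psi : 'I_n -> nat -> set (cartan_dual g)).
Variables (chi : 'I_n -> affine g -> C^o).
Local Notation pt := 'rV[C]_n.

Definition Mhat : lmodType C :=
  tensor (fun j => sing_module (psi j) (chi j)).

Definition slot_act (j : 'I_n) (x : affine g) : Mhat -> Mhat :=
  slot (M := fun j => sing_module (psi j) (chi j)) (i := j)
    (sing_act (psi := psi j) (chi := chi j) x).

Definition slot_vir (X Y : 'I_(\dim {: g}) -> g) (h kappa : C) (m : int)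
    (i : 'I_n) : Mhat -> Mhat :=
  slot (M := fun j => sing_module (psi j) (chi j)) (i := i)
    (sugawara X Y h kappa (sing_act (psi := psi i) (chi := chi i)) m).

Definition gDact (t : pt) (f : C -> g) (v : Mhat) : Mhat :=
  \sum_j slot_act j (laurent_at f (t ord0 j), 0) v.

Definition gDact_sec (f : pt -> C -> g) (s : pt -> Mhat) (t : pt) : Mhat :=
  gDact t (f t) (s t).

Definition gDimage (t : pt) : set Mhat :=
  [set w | exists2 f : C -> g, gD t f & exists v, w = gDact t f v].

(* Sections over U of the subsheaf g( * D) (O (x) Mhat) of O (x) Mhat *)
Definition gDimage_sec (U : set pt) : set (pt -> Mhat) := [set s |
  forall t, U t -> exists W, [/\ open W, W t &
    exists k (f : 'I_k -> pt -> C -> g) (v : 'I_k -> pt -> Mhat),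
    [/\ forall a, gDsec W (f a), forall a, lsec W (v a) &
        forall u, W u -> s u = \sum_a gDact_sec (f a) (v a) u]]].

Definition near_sec (S : set pt -> set (pt -> Mhat)) (t : pt) :
    set (pt -> Mhat) :=
  [set s | exists W, [/\ open W, W t, W `<=` config & S W s]].

(* The stalk at t of the sheaf of covacua, (O (x) Mhat) / g( * D) (O (x) Mhat),*)
(* is the subspace of covac t formed by the classes of the local sections of  *)
(* O (x) Mhat near t; see covac_sec.                                           *)
Definition covac (t : pt) : lmodType C := lquot (near_sec gDimage_sec t).

Definition covac_class (s : pt -> Mhat) (t : pt) : covac t := qpi _ s.

Definition covac_mul (c : pt -> C^o) (x : forall t, covac t) (t : pt) :
  covac t := qlift (fun s => covac_class (pmul c s) t) (x t).

Definition covac_sec (U : set pt) : set (forall t, covac t) := [set x |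
  forall t, U t -> exists W s,
    [/\ open W, W t, lsec W s & forall u, W u -> x u = covac_class s u]].

(* The fibre at t of the sheaf of covacua, i.e. the quotient of the stalk by  *)
(* the classes of the sections vanishing at t, is Mhat / g( * D) Mhat.         *)
Definition covac_fibre (t : pt) := forall s, near_sec lsec t s ->
  lspan (gDimage t) (s t) <->
  exists2 s0, near_sec lsec t s0 /\ s0 t = 0 &
    covac_class s t = covac_class s0 t.

(* Sections of the trivial bundle with fibre the full dual of Mhat: the       *)
(* O-linear maps from O (x) Mhat to O.                                         *)
Definition dual_sec (U : set pt) : set (pt -> Mhat -> C^o) := [set p |
  (forall t, U t -> linear_on setT (p t)) /\
  (forall v, holo U (fun t => p t v))].

Definition vac_sec (U : set pt) : set (pt -> Mhat -> C^o) := [set p |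
  dual_sec U p /\
  forall t, U t -> forall f v, gD t f -> p t (gDact t f v) = 0].

(* The dual of the connection d - w *)
Definition dual_nabla (w : 'I_n -> pt -> Mhat -> Mhat) (i : 'I_n)
    (p : pt -> Mhat -> C^o) (t : pt) (v : Mhat) : C^o :=
  pderiv i (fun u => p u v) t + p t (w i t v).

Definition dual_form (w : 'I_n -> pt -> Mhat -> Mhat) (i : 'I_n) (t : pt)
    (p : Mhat -> C^o) (v : Mhat) : C^o := - p (w i t v).

End Vacua.

(* Main.v *)
Require Import Defs.
From HB Require Import structures.
From mathcomp Require Import all_boot all_order all_algebra finmap complex.
From mathcomp Require Import all_classical all_reals all_analysis.
From mathcomp Require Import ring lra zify.
Import Order.TTheory GRing.Theory Num.Theory numFieldNormedType.Exports.
Local Open Scope classical_set_scope.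
Local Open Scope ring_scope.

Set Implicit Arguments.
Unset Strict Implicit.
Unset Printing Implicit Defensive.

Section Operators.
Variables (C : numClosedFieldType) (V : vectType C).
Implicit Types (A B : 'End(V)) (p q : {poly C}) (v : V).

Definition lfpow A (k : nat) : 'End(V) := iter k (comp_lfun A) \1%VF.

Definition lfpoly A p : 'End(V) := \sum_(i < size p) p`_i *: lfpow A i.

Lemma lfpow0 A v : lfpow A 0 v = v. Proof. by rewrite /lfpow /= id_lfunE. Qed.
Lemma lfpowS A k v : lfpow A k.+1 v = A (lfpow A k v).
Proof. by rewrite /lfpow /= comp_lfunE. Qed.
Lemma lfpowSr A k v : lfpow A k.+1 v = lfpow A k (A v).
Proof. by elim: k v => [|k IH] v; rewrite lfpowS ?lfpow0 // IH lfpowS. Qed.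
Lemma lfpowD A j k v : lfpow A (j + k) v = lfpow A j (lfpow A k v).
Proof. by elim: j => [|j IH]; rewrite ?lfpow0 // addSn !lfpowS IH. Qed.

Lemma lfpolyE A p n : (size p <= n)%N ->
  lfpoly A p = \sum_(i < n) p`_i *: lfpow A i.
Proof.
move=> pn; rewrite /lfpoly (big_ord_widen n (fun i => p`_i *: lfpow A i) pn).
rewrite [RHS](bigID (fun i : 'I_n => (i < size p)%N)) /= [X in _ = _ + X]big1 ?addr0 //.
by move=> i; rewrite -leqNgt => /leq_sizeP -> //; rewrite scale0r.
Qed.

Lemma lfpolyv A p n v : (size p <= n)%N ->
  lfpoly A p v = \sum_(i < n) p`_i *: lfpow A i v.
Proof.
move=> pn; rewrite (lfpolyE A pn) sum_lfunE; apply: eq_bigr => i _.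
by rewrite scale_lfunE.
Qed.

Lemma lfpolyD A p q : lfpoly A (p + q) = lfpoly A p + lfpoly A q.
Proof.
pose n := maxn (size p) (size q).
rewrite (@lfpolyE A _ n) ?size_polyD //.
rewrite (@lfpolyE A p n) ?leq_maxl // (@lfpolyE A q n) ?leq_maxr //.
by rewrite -big_split /=; apply: eq_bigr => i _; rewrite coefD scalerDl.
Qed.

Lemma lfpolyZ A a p : lfpoly A (a *: p) = a *: lfpoly A p.
Proof.
rewrite (@lfpolyE A _ (size p)) ?size_scale_leq // scaler_sumr.
by apply: eq_bigr => i _; rewrite coefZ scalerA.
Qed.

Lemma lfpoly0 A : lfpoly A 0 = 0.
Proof. by rewrite -(scale0r 0) lfpolyZ scale0r. Qed.

Lemma lfpoly_sum A I (r : seq I) (P : I -> {poly C}) :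
  lfpoly A (\sum_(i <- r) P i) = \sum_(i <- r) lfpoly A (P i).
Proof. by apply: big_morph => [p q|]; rewrite ?lfpolyD ?lfpoly0. Qed.

Lemma lfpolyXM A p v : lfpoly A ('X * p) v = A (lfpoly A p v).
Proof.
rewrite (@lfpolyv A _ (size p).+1) ?(leq_trans (size_polyMleq _ _)) ?size_polyX //.
rewrite big_ord_recl coefXM /= scale0r add0r (lfpolyv _ _ (leqnn _)) linear_sum.
by apply: eq_bigr => i _; rewrite coefXM /= linearZ /= lfpowS.
Qed.

Lemma lfpolyC A a v : lfpoly A a%:P v = a *: v.
Proof.
by rewrite (@lfpolyv A _ 1) ?size_polyC_leq1 // big_ord1 coefC /= lfpow0.
Qed.

Lemma lfpolyM A p q v : lfpoly A (p * q) v = lfpoly A p (lfpoly A q v).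
Proof.
elim/poly_ind: p v => [|p a IH] v; first by rewrite mul0r lfpoly0 !lfunE.
rewrite mulrDl [p * 'X]mulrC -mulrA mul_polyC !lfpolyD !add_lfunE lfpolyZ.
by rewrite lfpolyXM IH scale_lfunE lfpolyXM lfpolyC.
Qed.

Lemma lfpolyCA A p q v :
  lfpoly A p (lfpoly A q v) = lfpoly A q (lfpoly A p v).
Proof. by rewrite -!lfpolyM mulrC. Qed.

Lemma lfpolyXsubC A a v : lfpoly A ('X - a%:P) v = A v - a *: v.
Proof.
rewrite lfpolyD add_lfunE -['X]mulr1 lfpolyXM lfpolyC scale1r.
by rewrite -polyCN lfpolyC scaleNr.
Qed.

Lemma lfpolyXn A k v : lfpoly A 'X^k v = lfpow A k v.
Proof.
elim: k => [|k IH]; first by rewrite lfpolyC scale1r lfpow0.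
by rewrite exprS lfpolyXM IH lfpowS.
Qed.

Lemma lfpoly_comm A B p : (forall v, A (B v) = B (A v)) ->
  forall v, lfpoly A p (B v) = B (lfpoly A p v).
Proof.
move=> AB v; elim/poly_ind: p => [|p a IH]; first by rewrite lfpoly0 !lfunE linear0.
rewrite mulrC !lfpolyD !add_lfunE !lfpolyXM !lfpolyC IH AB.
by rewrite linearD /= linearZ.
Qed.

Lemma lfpoly_stable A p (U : {vspace V}) : (forall v, v \in U -> A v \in U) ->
  forall v, v \in U -> lfpoly A p v \in U.
Proof.
move=> AU v vU; elim/poly_ind: p => [|p a IH].
  by rewrite lfpoly0 lfunE mem0v.
by rewrite mulrC lfpolyD add_lfunE lfpolyXM lfpolyC rpredD ?rpredZ // AU.
Qed.

(** Generalised eigenvectors; no bound on the exponent is imposed, so that the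
    argument behind gen_eigen_br need not keep track of one. *)
Definition gen_eigen A (a : C) v := exists k, lfpoly A (('X - a%:P) ^+ k) v = 0.

Lemma gen_eigenD A a v w : gen_eigen A a v -> gen_eigen A a w -> gen_eigen A a (v + w).
Proof.
move=> [j vj] [k wk]; exists (j + k)%N; rewrite linearD /= exprD.
by rewrite lfpolyM lfpolyCA lfpolyM vj wk !linear0 addr0.
Qed.

Lemma gen_eigenZ A a c v : gen_eigen A a v -> gen_eigen A a (c *: v).
Proof. by move=> [k vk]; exists k; rewrite linearZ /= vk scaler0. Qed.

Lemma gen_eigen00 A a : gen_eigen A a 0.
Proof. by exists 0%N; rewrite linear0. Qed.

Lemma gen_eigen_sum A a I (r : seq I) (P : pred I) (F : I -> V) :
  (forall i, P i -> gen_eigen A a (F i)) -> gen_eigen A a (\sum_(i <- r | P i) F i).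
Proof.
by move=> PF; apply: big_ind => //; [exact: gen_eigen00|exact: gen_eigenD].
Qed.

Lemma gen_eigenX A v : gen_eigen A 0 v <-> exists k, lfpow A k v = 0.
Proof.
by split=> -[k]; [rewrite subr0 lfpolyXn|rewrite -lfpolyXn => vk]; exists k; rewrite ?subr0.
Qed.

Lemma gen_eigen_nz_im A a v : a != 0 -> gen_eigen A a v -> exists w, v = A w.
Proof.
move=> a0 [k]; elim: k v => [|k IH] v.
  by rewrite expr0 lfpolyC scale1r => ->; exists 0; rewrite linear0.
rewrite exprSr lfpolyM lfpolyXsubC => /IH[w E].
exists (a^-1 *: (v - w)); rewrite linearZ linearB /= -E opprB addrC subrK.
by rewrite scalerA mulVf // scale1r.
Qed.

Lemma coprimep_kernels A p q v : coprimep p q ->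
  lfpoly A p v = 0 -> lfpoly A q v = 0 -> v = 0.
Proof.
move=> /Bezout_eq1_coprimepP[[u w] /= E] pv qv.
have := lfpolyC A 1 v; rewrite scale1r polyC1 -E lfpolyD add_lfunE !lfpolyM pv qv.
by rewrite !linear0 addr0 => <-.
Qed.

Lemma coprime_XsubC_exp (a b : C) j k : a != b ->
  coprimep (('X - a%:P) ^+ j) (('X - b%:P) ^+ k).
Proof.
move=> ab; apply/coprimep_expl/coprimep_expr.
by rewrite coprimep_XsubC root_XsubC eq_sym.
Qed.

Lemma coprimep_prodl (s : seq C) (P : pred C) (F : C -> {poly C}) p :
  (forall a, a \in s -> P a -> coprimep (F a) p) ->
  coprimep (\prod_(a <- s | P a) F a) p.
Proof.
move=> Fp; rewrite big_seq_cond; apply: (big_ind (fun q => coprimep q p)).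
- exact: coprime1p.
- by move=> q1 q2 c1 c2; rewrite coprimepMl c1.
- by move=> a /andP[]; apply: Fp.
Qed.

(** The Chinese remainder theorem applied to the factors of a polynomial that
    annihilates [A] provides the projections onto the generalised eigenspaces as
    polynomials in [A]. *)
Lemma eigen_projections A (r : seq C) :
  (forall v, lfpoly A (\prod_(a <- r) ('X - a%:P)) v = 0) ->
  exists P : C -> {poly C},
   [/\ forall v, v = \sum_(a <- undup r) lfpoly A (P a) v,
       forall a v, a \in r -> gen_eigen A a (lfpoly A (P a) v) &
       forall a b v, a \in r -> gen_eigen A b v ->
         lfpoly A (P a) v = (a == b)%:R *: v].
Proof.
move=> Ar; set s := undup r.
have us : uniq s by apply: undup_uniq.
have ms a : (a \in s) = (a \in r) by rewrite mem_undup.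
pose F a : {poly C} := ('X - a%:P) ^+ (count_mem a r).
pose G a := \prod_(b <- s | b != a) F b.
have FG a : a \in s -> F a * G a = \prod_(a <- r) ('X - a%:P).
  by move=> sa; rewrite -prodr_undup_exp_count (bigD1_seq a).
have cFG a : coprimep (G a) (F a).
  by apply: coprimep_prodl => b _ ba; apply: coprime_XsubC_exp.
have /(_ _)/cid2 Pex a : exists2 p, F a %| p - 1 & G a %| p.
  have /Bezout_eq1_coprimepP[[u w] /= E] := cFG a.
  exists (u * G a); last exact: dvdp_mull.
  by rewrite -[X in _ - X]E opprD addrA subrr add0r -mulNr dvdp_mull.
pose P a := s2val (Pex a).
have P1 a : F a %| P a - 1 by rewrite /P; case: (Pex a).
have P0 a : G a %| P a by rewrite /P; case: (Pex a).
have ann p v : (\prod_(a <- r) ('X - a%:P)) %| p -> lfpoly A p v = 0.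
  by move=> /dvdpP[q ->]; rewrite lfpolyM Ar linear0.
have gP a v : a \in r -> gen_eigen A a (lfpoly A (P a) v).
  rewrite -ms => sa; exists (count_mem a r); rewrite -lfpolyM ann //.
  by rewrite -(FG a) // dvdp_mul2l ?P0 // expf_neq0 ?polyXsubC_eq0.
have sumP v : v = \sum_(a <- s) lfpoly A (P a) v.
  apply/eqP; rewrite -subr_eq0 -opprB oppr_eq0 -sum_lfunE -lfpoly_sum.
  rewrite -{2}[v]scale1r -(lfpolyC A) -scaleN1r -scale_lfunE -lfpolyZ -add_lfunE -lfpolyD.
  rewrite ann // -prodr_undup_exp_count -/s scaleN1r.
  suff dv s' : uniq s' -> {subset s' <= s} ->
      \prod_(a <- s') F a %| \sum_(a <- s) P a - 1%:P by apply: dv.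
  elim: s' => [|a s' IH] /=; first by rewrite big_nil dvd1p.
  move=> /andP[as' us'] ss'; rewrite big_cons Gauss_dvdp; last first.
    rewrite coprimep_sym; apply: coprimep_prodl => b bs' _.
    apply: coprime_XsubC_exp.
    by apply: contraNneq as' => <-.
  rewrite IH // ?andbT => [|b bs']; last by rewrite ss' // inE bs' orbT.
  rewrite (bigD1_seq a) ?ss' ?inE ?eqxx ?undup_uniq //= addrAC.
  rewrite polyC1 dvdp_add ?P1 //; apply: (big_ind (fun p => F a %| p)); rewrite ?dvdp0 //.
    by move=> p q; apply: dvdp_add.
  move=> b ba; apply: dvdp_trans (P0 b).
  by rewrite /G (big_rem a) ?ss' ?inE ?eqxx //= eq_sym ba dvdp_mulIl.
have ortho a b v : a \in r -> a != b -> gen_eigen A b v -> lfpoly A (P a) v = 0.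
  move=> ar ab [k vk]; have [j vj] := gP a v ar.
  apply: (coprimep_kernels (coprime_XsubC_exp j k ab) vj).
  by rewrite lfpolyCA vk linear0.
exists P; split=> // a b v ar; case: (eqVneq a b) => [<-|ab] gv; last first.
  by rewrite (ortho a b) // scale0r.
rewrite scale1r [RHS]sumP (bigD1_seq a) ?ms //= big_seq_cond big1 ?addr0 //.
move=> c /andP[cs ca]; by apply: (ortho c a) => //; rewrite -ms.
Qed.

(** A coordinate system: a basis [X] of [V] with its coordinate functions [Y]. *)
Definition coordinates d (X : 'I_d -> V) (Y : 'I_d -> 'Hom(V, C^o)) :=
  (forall v, v = \sum_l Y l v *: X l) /\ (forall k l, Y l (X k) = (k == l)%:R).

Definition ltrace d (X : 'I_d -> V) (Y : 'I_d -> 'Hom(V, C^o)) A : C :=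
  \sum_k Y k (A (X k)).

Section Trace.
Variables (d : nat) (X : 'I_d -> V) (Y : 'I_d -> 'Hom(V, C^o)).
Hypothesis XY : coordinates X Y.
Local Notation tr := (ltrace X Y).

Lemma ltraceD A B : tr (A + B) = tr A + tr B.
Proof.
rewrite -big_split; apply: eq_bigr => k _ /=.
by rewrite add_lfunE linearD.
Qed.

Lemma ltraceZ a A : tr (a *: A) = a * tr A.
Proof.
rewrite /ltrace mulr_sumr; apply: eq_bigr => k _ /=.
by rewrite scale_lfunE linearZ.
Qed.

Lemma ltraceB A B : tr (A - B) = tr A - tr B.
Proof. by rewrite ltraceD -scaleN1r ltraceZ mulN1r. Qed.

Lemma ltrace0 : tr 0 = 0.
Proof. by rewrite -(scale0r 0) ltraceZ mul0r. Qed.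

Lemma ltrace_sum I (r : seq I) (P : pred I) (F : I -> 'End(V)) :
  tr (\sum_(i <- r | P i) F i) = \sum_(i <- r | P i) tr (F i).
Proof. exact: (big_morph _ ltraceD ltrace0). Qed.

Lemma ltraceC A B : tr (A \o B) = tr (B \o A).
Proof.
have E (P Q : 'End(V)) : tr (P \o Q) = \sum_k \sum_l Y l (Q (X k)) * Y k (P (X l)).
  apply: eq_bigr => k _; rewrite comp_lfunE {1}[Q (X k)](XY.1) !linear_sum.
  by apply: eq_bigr => l _; rewrite !linearZ.
rewrite !E exchange_big; apply: eq_bigr => k _; apply: eq_bigr => l _.
by rewrite mulrC.
Qed.

Let mx A : 'M[C]_d := \matrix_(k, l) Y l (A (X k)).
Let vec (u : 'rV[C]_d) : V := \sum_l u ord0 l *: X l.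
Let mpow (M : 'M[C]_d) k : 'M[C]_d := iter k (mulmx M) 1%:M.

Let vecA A u : A (vec u) = vec (u *m mx A).
Proof.
rewrite /vec linear_sum [RHS](eq_bigr (fun l => \sum_k (u ord0 k * mx A k l) *: X l)).
  rewrite exchange_big; apply: eq_bigr => k _ /=.
  rewrite linearZ /= {1}[A (X k)](XY.1) scaler_sumr; apply: eq_bigr => l _ /=.
  by rewrite scalerA mxE.
by move=> l _; rewrite mxE scaler_suml.
Qed.

Let vecZ a u : vec (a *: u) = a *: vec u.
Proof.
by rewrite scaler_sumr; apply: eq_bigr => l _; rewrite mxE scalerA.
Qed.

Let vec_eq0 u : vec u = 0 -> u = 0.
Proof.
move=> u0; apply/rowP => k; rewrite mxE.
have := congr1 (Y k) u0; rewrite linear_sum linear0 (bigD1 k) //= linearZ /= (XY.2).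
rewrite eqxx big1 ?addr0 => [<-|l lk]; first by rewrite /GRing.scale /= mulr1.
by rewrite linearZ /= (XY.2) (negPf lk) scaler0.
Qed.

Let mx_pow A k : mx (lfpow A k) = mpow (mx A) k.
Proof.
elim: k => [|k IH]; apply/matrixP => i j.
  by rewrite !mxE lfpow0 (XY.2).
have -> : mpow (mx A) k.+1 = mx A *m mx (lfpow A k) by rewrite IH.
rewrite !mxE lfpowSr {1}[A (X i)](XY.1) !linear_sum; apply: eq_bigr => l _.
by rewrite !linearZ /= !mxE.
Qed.

(** Schur triangularisation, restated for an endomorphism: the list [r] of the
    diagonal entries is the spectrum with multiplicities. *)
Lemma spectrum A : exists r : seq C,
  [/\ forall k, tr (lfpow A k) = \sum_(a <- r) a ^+ k,
      forall a, a \in r -> exists2 v, v != 0 & A v = a *: v &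
      forall v, lfpoly A (\prod_(a <- r) ('X - a%:P)) v = 0].
Proof.
have cA : {in [:: mx A] &, forall M N : 'M[C]_d, comm_mx M N}.
  by move=> M N; rewrite !inE => /eqP-> /eqP->.
have [P /unitarymx_unit Pu] := cotrigonalization cA.
rewrite /= andbT; set M := mx A; rewrite /similar_to conjumx //.
set T := P *m M *m invmx P => trT.
have PT : P *m M = T *m P by rewrite mulmxKV.
exists [seq T i i | i <- enum 'I_d]; split.
- move=> k; rewrite big_map big_enum.
  have -> : tr (lfpow A k) = \tr (mpow M k).
    by rewrite -mx_pow; apply: eq_bigr => i _; rewrite mxE.
  have PTk : P *m mpow M k = mpow T k *m P.
    elim: k => [|k IH]; first by rewrite mulmx1 mul1mx.
    by rewrite /= mulmxA PT -mulmxA IH mulmxA.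
  rewrite -[mpow M k](mulKmx Pu) PTk mxtrace_mulC mulmxK //.
  suff [_ H] : (forall i j : 'I_d, (i < j)%N -> mpow T k i j = 0) /\
               (forall i, mpow T k i i = T i i ^+ k).
    by apply: eq_bigr => i _; rewrite H.
  elim: k {PTk} => [|k [IH1 IH2]].
    split=> [i j ij|i]; rewrite mxE ?eqxx //.
    by case: eqP ij => // ->; rewrite ltnn.
  split=> [i j ij|i]; rewrite mxE /=.
    apply: big1 => l _; case: (ltnP i l) => il.
      by rewrite (is_trig_mxP trT) ?mul0r.
    by rewrite IH1 ?mulr0 // (leq_ltn_trans il).
  rewrite (bigD1 i) //= IH2 -exprS big1 ?addr0 // => l li.
  case: (ltngtP i l) => il; first by rewrite (is_trig_mxP trT) ?mul0r.
    by rewrite IH1 ?mulr0.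
  by move/val_inj: il li => ->; rewrite eqxx.
- move=> a /mapP[i _ ->].
  have /eigenvalueP[u uT u0] : eigenvalue T (T i i).
    rewrite eigenvalue_root_char char_poly_trig // (bigD1 i) //= rootM.
    by rewrite root_XsubC eqxx.
  exists (vec (u *m P)).
    apply: contra u0 => /eqP/vec_eq0 uP0.
    by rewrite -[u](mulmxK Pu) uP0 mul0mx.
  by rewrite vecA -mulmxA PT mulmxA uT -vecZ scalemxAl.
move=> v.
have key k (i : 'I_d) : (i < k)%N ->
    lfpoly A (\prod_(j : 'I_d | (j < k)%N) ('X - (T j j)%:P)) (vec (row i P)) = 0.
  elim: k i => [//|k IH] i; rewrite ltnS => ik.
  have [kd|dk] := ltnP k d; last first.
    rewrite (eq_bigl (fun j : 'I_d => (j < k)%N)) ?IH ?(leq_trans (ltn_ord i)) //.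
    by move=> j; rewrite !ltnS (leq_trans (ltnW (ltn_ord j)) dk) (leq_trans (ltn_ord j) dk).
  rewrite (bigD1 (Ordinal kd)) ?ltnS //=.
  rewrite (eq_bigl (fun j : 'I_d => (j < k)%N)) => [|j]; last first.
    by rewrite ltnS -val_eqE /= andbC -ltn_neqAle.
  have [ltik|geik] := ltnP i k; first by rewrite lfpolyM IH // linear0.
  have ei : i = Ordinal kd by apply/val_inj/anti_leq; rewrite /= ik.
  rewrite mulrC lfpolyM lfpolyXsubC vecA -vecZ.
  have -> : vec (row i P *m mx A) - vec (T (Ordinal kd) (Ordinal kd) *: row i P)
     = \sum_(l < d | l != i) T i l *: vec (row l P).
    rewrite -row_mul PT row_mul mulmx_sum_row -ei.
    have -> : vec (\sum_j row i T ord0 j *: row j P) = \sum_j T i j *: vec (row j P).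
      rewrite /vec; under eq_bigr do rewrite summxE scaler_suml.
      rewrite exchange_big; apply: eq_bigr => l _; rewrite scaler_sumr.
      by apply: eq_bigr => m _; rewrite !mxE scalerA.
    by rewrite (bigD1 i) //= vecZ addrAC subrr add0r.
  rewrite linear_sum big1 // => l li; rewrite linearZ /=.
  case: (ltnP i l) => il; first by rewrite (is_trig_mxP trT) ?scale0r.
  rewrite IH ?scaler0 //; move: il li; rewrite ei leq_eqVlt -val_eqE /=.
  by case: eqP.
have {}key i : lfpoly A (\prod_(a <- [seq T i i | i <- enum 'I_d]) ('X - a%:P))
    (vec (row i P)) = 0.
  rewrite big_map big_enum (eq_bigl (fun j : 'I_d => (j < d)%N)) ?key //.
  by move=> j; rewrite ltn_ord.
pose u := \row_l Y l v.
have -> : v = \sum_i (u *m invmx P) ord0 i *: vec (row i P).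
  transitivity (vec (u *m invmx P *m P)).
    by rewrite mulmxKV // {1}[v](XY.1); apply: eq_bigr => l _; rewrite mxE.
  rewrite (mulmx_sum_row (u *m invmx P) P) /vec.
  under eq_bigr do rewrite summxE scaler_suml.
  rewrite exchange_big; apply: eq_bigr => l _; rewrite scaler_sumr.
  by apply: eq_bigr => m _; rewrite !mxE scalerA.
by rewrite linear_sum big1 // => i _; rewrite linearZ /= key scaler0.
Qed.

Lemma ltrace_nilp A : (forall v, gen_eigen A 0 v) -> tr A = 0.
Proof.
move=> nA; have [r [trA eigA _]] := spectrum A.
have := trA 1%N; rewrite (_ : lfpow A 1 = A); last first.
  by apply/lfunP => v; rewrite lfpowS lfpow0.
move=> ->; rewrite big_seq big1 // => a /eigA[v v0 Av]; rewrite expr1.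
have [k] := (gen_eigenX A v).1 (nA v).
have -> : lfpow A k v = a ^+ k *: v.
  elim: k => [|k IH]; first by rewrite lfpow0 scale1r.
  by rewrite lfpowS IH linearZ /= Av scalerA -exprSr.
by move/eqP; rewrite scaler_eq0 (negPf v0) orbF expf_eq0 => /andP[_ /eqP].
Qed.

(** The functional calculus: [lfpoly A p] acts on the generalised eigenspace
    of [a] as the scalar [f a]. *)
Lemma functional_calculus A (f : C -> C) : exists p : {poly C},
  [/\ forall a v, gen_eigen A a v -> lfpoly A p v = f a *: v,
      forall v, exists (s : seq C) (w : C -> V),
        [/\ uniq s, v = \sum_(a <- s) w a & forall a, gen_eigen A a (w a)] &
      exists r : seq C, [/\ tr (A \o lfpoly A p) = \sum_(a <- r) a * f a &
        (forall a, a \in r -> a = 0) -> forall v, gen_eigen A 0 v]].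
Proof.
have [r [trA eigA Ar]] := spectrum A.
have [P [sumP genP projP]] := eigen_projections Ar.
pose p := \sum_(a <- undup r) f a *: P a.
have pE a v : gen_eigen A a v -> lfpoly A p v = f a *: v.
  move=> gv; rewrite lfpoly_sum sum_lfunE {2}[v]sumP scaler_sumr.
  rewrite big_seq [RHS]big_seq; apply: eq_bigr => b; rewrite mem_undup => br.
  rewrite lfpolyZ scale_lfunE (projP b a) // scalerA [RHS]scalerA.
  by case: (b =P a) => [->|_]; rewrite ?mulr0 ?scale0r.
exists p; split=> // [v|].
  exists (undup r), (fun a => if a \in r then lfpoly A (P a) v else 0).
  split=> [||a]; first exact: undup_uniq; last first.
    by case: ifP => ar; [apply: genP|apply: gen_eigen00].
  rewrite [LHS]sumP big_seq [RHS]big_seq; apply: eq_bigr => a.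
  by rewrite mem_undup => ->.
exists r; split=> [|r0 v]; last first.
  exists (size r); move: (Ar v); congr (_ = _).
  congr (lfpoly A _ v); elim: r r0 {trA eigA Ar sumP genP projP p pE} => [|a r IH] r0.
    by rewrite big_nil.
  rewrite big_cons IH => [|b br]; last by apply: r0; rewrite inE br orbT.
  by rewrite -(r0 a) ?inE ?eqxx // exprS.
rewrite /lfpoly (_ : _ \o _ = \sum_(i < size p) p`_i *: lfpow A i.+1)%VF; last first.
  apply/lfunP => v; rewrite comp_lfunE !sum_lfunE linear_sum.
  by apply: eq_bigr => i _; rewrite !scale_lfunE linearZ /= lfpowS.
rewrite ltrace_sum (eq_bigr (fun i : 'I__ => \sum_(a <- r) p`_i * a ^+ i.+1)).
  rewrite exchange_big /= big_seq [RHS]big_seq; apply: eq_bigr => a ar.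
  have [v v0 Av] := eigA a ar.
  have gv : gen_eigen A a v.
    by exists 1%N; rewrite expr1 lfpolyXsubC Av subrr.
  have Avk k : lfpow A k v = a ^+ k *: v.
    elim: k => [|k IH]; first by rewrite lfpow0 scale1r.
    by rewrite lfpowS IH linearZ /= Av scalerA -exprSr.
  have /eqP : (\sum_(i < size p) p`_i * a ^+ i) *: v = f a *: v.
    rewrite -(pE a v gv) (lfpolyv _ _ (leqnn _)) scaler_suml.
    by apply: eq_bigr => i _; rewrite Avk scalerA.
  rewrite -subr_eq0 -scalerBl scaler_eq0 (negPf v0) orbF subr_eq0.
  move=> /eqP <-; rewrite mulr_sumr; apply: eq_bigr => i _.
  by rewrite exprS mulrCA.
by move=> i _; rewrite ltraceZ trA mulr_sumr.
Qed.

End Trace.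
End Operators.

Section LinearOn.
Variables (C : numClosedFieldType) (V W : lmodType C).

Lemma linear_on_linear (f : V -> W) : linear_on setT f -> linear f.
Proof. by move=> lf a x y; apply: lf. Qed.

Definition linear_of (f : V -> W) (lf : linear_on setT f) : {linear V -> W} :=
  HB.pack f (GRing.isLinear.Build C V W *:%R f (linear_on_linear lf)).

Lemma linear_of_eq f (lf : linear_on setT f) x : linear_of lf x = f x.
Proof. by []. Qed.

Lemma linear_linear_on (f : {linear V -> W}) : linear_on setT f.
Proof. by move=> a x y _ _; rewrite linearP. Qed.

Lemma linear_on_sumZ (f : V -> W) : linear_on setT f ->
  forall I (r : seq I) (P : pred I) (a : I -> C) (x : I -> V),
  f (\sum_(i <- r | P i) a i *: x i) = \sum_(i <- r | P i) a i *: f (x i).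
Proof.
move=> lf I r P a x; rewrite -(linear_of_eq lf) linear_sum.
by apply: eq_bigr => i _; rewrite linearZ.
Qed.

End LinearOn.

(** * Reductive quadratic Lie algebras *)
Section LieAlgebra.
Variables (C : numClosedFieldType) (g : quad_lie C).
Implicit Types x y z : g.

Lemma lbr_bilinear : bilinear_map (@lbr C g).
Proof. by case: (lbr_lie g). Qed.

HB.instance Definition _ x := GRing.isLinear.Build C g g *:%R (lbr x)
  (linear_on_linear (lbr_bilinear.2 x)).

Definition ad x : 'End(g) := linfun (lbr x).
Lemma adE x y : ad x y = lbr x y. Proof. by rewrite lfunE. Qed.

Lemma lbrDl x y z : lbr (x + y) z = lbr x z + lbr y z.
Proof. exact: (linearD (linear_of (lbr_bilinear.1 z))). Qed.
Lemma lbrZl a x z : lbr (a *: x) z = a *: lbr x z.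
Proof. exact: (linearZ_LR (linear_of (lbr_bilinear.1 z))). Qed.
Lemma lbrNl x z : lbr (- x) z = - lbr x z.
Proof. exact: (linearN (linear_of (lbr_bilinear.1 z))). Qed.
Lemma lbr0l z : lbr 0 z = 0 :> g.
Proof. exact: (linear0 (linear_of (lbr_bilinear.1 z))). Qed.
Lemma lbrxx x : lbr x x = 0.
Proof. by case: (lbr_lie g). Qed.

Lemma lbrC x y : lbr x y = - lbr y x.
Proof.
have := lbrxx (x + y); rewrite lbrDl !linearD /= !lbrxx add0r addr0.
by move/eqP; rewrite addr_eq0 => /eqP.
Qed.

Lemma lbrJ x y z : lbr x (lbr y z) = lbr (lbr x y) z + lbr y (lbr x z).
Proof.
have [_ _ /(_ x y z) J] := lbr_lie g.
apply/eqP; rewrite -subr_eq0 -J opprD [lbr z x]lbrC linearN /= [lbr z _]lbrC.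
by rewrite -addrA [- lbr y _ + _]addrC.
Qed.

Lemma adD x y : ad (x + y) = ad x + ad y.
Proof. by apply/lfunP => z; rewrite add_lfunE !adE lbrDl. Qed.
Lemma adZ a x : ad (a *: x) = a *: ad x.
Proof. by apply/lfunP => z; rewrite scale_lfunE !adE lbrZl. Qed.
Lemma adB x y : ad (x - y) = ad x - ad y.
Proof. by rewrite adD -scaleN1r adZ scaleN1r. Qed.
Lemma ad0 : ad 0 = 0 :> 'End(g).
Proof. by rewrite -(scale0r 0) adZ scale0r. Qed.

Lemma ad_br x y : ad (lbr x y) = (ad x \o ad y)%VF - (ad y \o ad x)%VF.
Proof.
apply/lfunP => z; rewrite add_lfunE opp_lfunE !comp_lfunE !adE lbrJ addrK //.
Qed.

(** A derivation shifted by [a + b] obeys a Leibniz rule in which the shift is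
    distributed over the two arguments. *)
Lemma gen_eigen_br z a b x y : gen_eigen (ad z) a x -> gen_eigen (ad z) b y ->
  gen_eigen (ad z) (a + b) (lbr x y).
Proof.
move=> [j xj] [k yk]; exists (j + k)%N.
move: {2}(j + k)%N (leqnn (j + k)) => n.
elim: n j k x y xj yk => [|n IH] j k x y.
  rewrite leqn0 addn_eq0 => xj yk /andP[/eqP j0 /eqP k0]; move: xj.
  by rewrite j0 expr0 lfpolyC scale1r => ->; rewrite lbr0l linear0.
case: j => [|j] xj yk.
  by move: xj; rewrite expr0 lfpolyC scale1r => ->; rewrite lbr0l linear0.
case: k yk => [|k] yk.
  by move: yk; rewrite expr0 lfpolyC scale1r => ->; rewrite !linear0.
rewrite addSn addnS !ltnS => jk; rewrite exprSr lfpolyM.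
have -> : lfpoly (ad z) ('X - (a + b)%:P) (lbr x y) =
   lbr (lfpoly (ad z) ('X - a%:P) x) y + lbr x (lfpoly (ad z) ('X - b%:P) y).
  rewrite !lfpolyXsubC !adE lbrJ !linearB /= lbrDl lbrNl.
  by rewrite lbrZl [lbr x (b *: y)]linearZ /= scalerDl opprD addrACA.
have e1 := IH j k.+1 (lfpoly (ad z) ('X - a%:P) x) y.
have e2 := IH j.+1 k x (lfpoly (ad z) ('X - b%:P) y).
rewrite linearD /= -{1}addnS e1 ?addnS -?lfpolyM -?exprSr //.
by rewrite -addSn e2 ?addr0 ?addSn -?lfpolyM -?exprSr.
Qed.

Lemma lfrm_bilinear : bilinear_map (@lfrm C g).
Proof. by case: (lfrm_quad g). Qed.
Lemma lfrmC x y : lfrm x y = lfrm y x.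
Proof. by case: (lfrm_quad g). Qed.
Lemma lfrm_inv x y z : lfrm (lbr x y) z = lfrm x (lbr y z).
Proof. by case: (lfrm_quad g). Qed.
Lemma lfrm_ndg x : (forall y, lfrm x y = 0) -> x = 0.
Proof. by case: (lfrm_quad g) => _ _ _; apply. Qed.

HB.instance Definition _ x := GRing.isLinear.Build C g C^o *:%R (lfrm x)
  (linear_on_linear (lfrm_bilinear.2 x)).

Definition dual_coord (Y : 'I_(\dim {: g}) -> g) l : 'Hom(g, C^o) := linfun (lfrm (Y l)).

Lemma dual_basesC X Y : dual_bases (g := g) X Y -> dual_bases (g := g) Y X.
Proof. by move=> XY k l; rewrite lfrmC XY eq_sym. Qed.

Lemma dual_bases_coord X Y : dual_bases (g := g) X Y -> coordinates X (dual_coord Y).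
Proof.
move=> XY; split=> [v|k l]; last by rewrite lfunE /= lfrmC XY.
have frX l (c : 'I_(\dim {: g}) -> C) : lfrm (Y l) (\sum_k c k *: X k) = c l.
  rewrite linear_sum (bigD1 l) //= linearZ /= lfrmC XY eqxx big1 ?addr0.
    by rewrite /GRing.scale /= mulr1.
  by move=> k kl; rewrite linearZ /= lfrmC XY (negPf kl) scaler0.
pose Xt := [tuple X i | i < \dim {: g}].
have Xti (i : 'I_(\dim {: g})) : Xt`_i = X i by rewrite -tnth_nth tnth_mktuple.
have frXt : free Xt.
  apply/freeP => c c0 i; rewrite -(frX i c).
  by under eq_bigr do rewrite -Xti; rewrite c0 linear0.
have vX : v \in <<Xt>>%VS.
  have -> : <<Xt>>%VS = fullv; last exact: memvf.
  apply/eqP; rewrite -dimv_leqif_eq ?subvf //.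
  by rewrite (eqP frXt) size_tuple.
rewrite {1}(coord_span vX); apply: eq_bigr => l _; rewrite Xti; congr (_ *: _).
rewrite lfunE /= {2}(coord_span vX) -(frX l (fun i => coord Xt i v)).
by under [in RHS]eq_bigr do rewrite Xti.
Qed.

(** The canonical tensor [\sum_k X k \otimes Y k] is the inverse of the form; in
    particular it is symmetric. *)
Lemma canonical_tensor (W : lmodType C) (b : g -> g -> W) X Y X' Y' :
  bilinear_map b -> dual_bases (g := g) X Y -> dual_bases (g := g) X' Y' ->
  \sum_k b (X k) (Y k) = \sum_k b (X' k) (Y' k).
Proof.
move=> [bl br] XY XY'.
have EX k : X k = \sum_l lfrm (Y' l) (X k) *: X' l.
  rewrite {1}[X k]((dual_bases_coord XY').1).
  by apply: eq_bigr => l _; rewrite lfunE.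
have EY l : Y' l = \sum_k lfrm (X k) (Y' l) *: Y k.
  rewrite {1}[Y' l]((dual_bases_coord (dual_basesC XY)).1).
  by apply: eq_bigr => k _; rewrite lfunE.
under eq_bigr do rewrite {1}EX (linear_on_sumZ (bl _)).
rewrite exchange_big; apply: eq_bigr => l _ /=.
by rewrite {2}EY (linear_on_sumZ (br _)); apply: eq_bigr => k _; rewrite lfrmC.
Qed.

End LieAlgebra.

Section Cartan.
Variables (C : numClosedFieldType) (g : quad_lie C).
Implicit Types (x y z H : g) (U W : {vspace g}).
Local Notation t := (cartan g).
Local Notation br := (@lbr C g).

Lemma mem_vbracket U W u w : u \in U -> w \in W -> lbr u w \in vbracket br U W.
Proof.
move=> uU wW; rewrite (coord_vbasis uU) (coord_vbasis wW).
rewrite (linear_on_sumZ ((lbr_bilinear g).1 _)); apply: rpred_sum => i _.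
rewrite rpredZ // linear_sum; apply: rpred_sum => j _.
rewrite linearZ rpredZ //; apply/memv_span/allpairsP.
by exists ((vbasis U)`_i, (vbasis W)`_j); rewrite !mem_nth ?size_tuple.
Qed.

Lemma vbracket_sub U W (S : {vspace g}) :
  (forall u w, u \in U -> w \in W -> lbr u w \in S) -> (vbracket br U W <= S)%VS.
Proof.
move=> US; apply/span_subvP => _ /allpairsP[[u w] /= [uU wW ->]].
by apply: US; apply: vbasis_mem.
Qed.

Lemma vbracketS U W U' W' : (U <= U')%VS -> (W <= W')%VS ->
  (vbracket br U W <= vbracket br U' W')%VS.
Proof.
by move=> /subvP UU' /subvP WW'; apply: vbracket_sub => u w /UU' u' /WW'; apply: mem_vbracket.
Qed.

Lemma nilpotent_uniform (A : 'End(g)) U : (forall x, x \in U -> gen_eigen A 0 x) ->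
  exists k, forall x, x \in U -> lfpow A k x = 0.
Proof.
move=> nU; have /(_ _)/cid kP (i : 'I_(\dim U)) : exists k, lfpow A k (vbasis U)`_i = 0.
  by apply/gen_eigenX/nU; apply: vbasis_mem; rewrite mem_nth ?size_tuple.
exists (\max_i sval (kP i))%N => x /coord_vbasis->.
rewrite linear_sum big1 // => i _; rewrite linearZ /=.
have /subnK <- := leq_bigmax (F := fun i => sval (kP i)) i.
by rewrite lfpowD (svalP (kP i)) linear0 scaler0.
Qed.

Definition lcs i : {vspace g} := iter i (vbracket br t) t.

Lemma cartan_br x y : x \in t -> y \in t -> lbr x y \in t.
Proof. by move=> xt yt; have [/subvP s _ _] := cartanP g; apply/s/mem_vbracket. Qed.

Lemma lcs_sub i : (lcs i <= t)%VS.
Proof.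
elim: i => [|i /subvP IH]; first exact: subvv.
by apply: vbracket_sub => u w ut /IH; apply: cartan_br.
Qed.

Lemma cartan_ad_nilp H x : H \in t -> x \in t -> gen_eigen (ad H) 0 x.
Proof.
move=> Ht xt; apply/gen_eigenX; have [_ [k k0] _] := cartanP g.
exists k; apply/eqP; rewrite -memv0 -k0 -/(lcs k).
elim: k {k0} => [|k IH]; first by rewrite lfpow0.
by rewrite lfpowS adE mem_vbracket.
Qed.

Definition cartan_stable U := forall H x, H \in t -> x \in U -> lbr H x \in U.

(** Engel's theorem modulo the Cartan subalgebra.  The terms of the lower central
    series of [t], from the last one on, map a stable subspace [W] into [t]: for
    [H] in such a term [t + [H, W]] is again stable, and smaller than [W] because
    [H] acts nilpotently. Hence [W] normalises [t]. *)
Lemma cartan_engel W : (t <= W)%VS -> cartan_stable W ->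
  (forall H x, H \in t -> x \in W -> gen_eigen (ad H) 0 x) -> (W <= t)%VS.
Proof.
move: {2}(\dim W).+1 (ltnSn (\dim W)) => n.
elim: n W => // n IH W; rewrite ltnS => dW tW sW nW.
have [_ [k k0] normt] := cartanP g.
have key i H x : (i <= k)%N -> H \in lcs (k - i) -> x \in W -> lbr H x \in t.
  elim: i H x => [|i IHi] H x ik.
    by rewrite subn0 /lcs k0 memv0 => /eqP-> _; rewrite lbr0l mem0v.
  move=> Hi xW; have Ht : H \in t by apply: subvP (lcs_sub _) _ Hi.
  pose W' := (t + (ad H @: W))%VS.
  have W'W : (W' <= W)%VS.
    rewrite subv_add tW; apply/subvP => _ /memv_imgP[y yW ->].
    by rewrite adE sW.
  have W't : (W' <= t)%VS -> lbr H x \in t.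
    move=> /subvP; apply; rewrite -adE; apply: subvP (addvSr _ _) _ _.
    exact: memv_img.
  have stW' : cartan_stable W'.
    move=> Z _ Zt /memv_addP[y yt [_ /memv_imgP[w wW ->] ->]].
    have ZH : lbr Z H \in lcs (k - i).
      rewrite subnS in Hi; rewrite -[(k - i)%N]prednK ?subn_gt0 //.
      exact: mem_vbracket.
    rewrite linearD /= adE lbrJ addrA rpredD //; last first.
      by rewrite -adE; apply: subvP (addvSr _ _) _ _; rewrite memv_img ?sW.
    apply: subvP (addvSl _ _) _ _; rewrite rpredD //; first exact: cartan_br.
    by apply: IHi => //; apply: ltnW.
  have [lt|ge] := ltnP (\dim W') (\dim W).
    apply/W't/IH => //; first exact: leq_trans lt dW.
      exact: addvSl.
    by move=> Z y Zt yW'; apply: nW => //; apply: subvP W'W _ _.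
  have WW' : (W <= W')%VS.
    by rewrite -(eqP (_ : W' == W)) ?subvv // -dimv_leqif_eq // eqn_leq dimvS.
  have [m Am] := nilpotent_uniform (nW H ^~ Ht).
  have Wt : (W <= t)%VS.
    apply/subvP => y yW; suff [w wW ty] : exists2 w, w \in W & y - lfpow (ad H) m w \in t.
      by rewrite -[y](subrK (lfpow (ad H) m w)) {2}Am // addr0.
    elim: m {Am} y yW => [|m IHm] y yW.
      by exists y; rewrite // lfpow0 subrr mem0v.
    have /subvP/(_ _ yW)/memv_addP[u ut [_ /memv_imgP[w wW ->] ->]] := WW'.
    have [w' w'W tw] := IHm _ wW; exists w' => //.
    rewrite lfpowS -addrA -linearB /= rpredD //; rewrite adE.
    exact: cartan_br.
  by apply: cartan_br => //; apply: subvP Wt _ _.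
apply/subvP => x xW; apply: normt => H Ht; rewrite lbrC rpredN.
by apply: (key k) => //; rewrite subnn.
Qed.

End Cartan.

Section LspanLemmas.
Variables (C : numClosedFieldType) (V : lmodType C) (A : set V).

Lemma lspanZ a x : lspan A x -> lspan A (a *: x).
Proof. by move=> Ax; rewrite -[_ *: _]addr0; apply: lspan_lin (lspan_0 _). Qed.

Lemma lspan_sum I (r : seq I) (P : pred I) (F : I -> V) :
  (forall i, P i -> lspan A (F i)) -> lspan A (\sum_(i <- r | P i) F i).
Proof.
by move=> PF; apply: big_ind => [|x y|//]; [exact: lspan_0|exact: lspanD].
Qed.

Lemma lspan_sub (S : set V) : S 0 -> (forall a x y, S x -> S y -> S (a *: x + y)) ->
  A `<=` S -> lspan A `<=` S.
Proof. by move=> S0 SL AS x; elim=> [y /AS //||a y z _ Sy _ Sz] //; apply: SL. Qed.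

End LspanLemmas.

Section RootDecomposition.
Variables (C : numClosedFieldType) (g : quad_lie C).
Variables (X Y : 'I_(\dim {: g}) -> g) (hXY : dual_bases X Y).
Implicit Types (x y z H : g) (U W : {vspace g}).
Local Notation t := (cartan g).
Local Notation br := (@lbr C g).
Local Notation tr := (ltrace X (dual_coord Y)).
Let XY := dual_bases_coord hXY.

(** Fitting's decomposition with respect to the nilpotent algebra [t]: a stable
    [U] on which some [H] in [t] is not nilpotent is replaced by the nilspace of
    [ad H] in [U], and what is lost lies in the image of [ad H]. *)
Lemma cartan_fitting U : (t <= U)%VS -> cartan_stable U ->
  ({: g} <= U + vbracket br t {: g})%VS -> ({: g} <= t + vbracket br t {: g})%VS.
Proof.
move: {2}(\dim U).+1 (ltnSn (\dim U)) => n.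
elim: n U => // n IH U; rewrite ltnS => dU tU sU gU.
have [nU|] := pselect (forall H x, H \in t -> x \in U -> gen_eigen (ad H) 0 x).
  by apply: subv_trans gU _; apply: addvS (subvv _); apply: cartan_engel.
move=> /existsNP[H /existsNP[x /not_implyP[Ht /not_implyP[xU nx]]]].
have [p [pE dec _]] := functional_calculus XY (ad H) (fun a => (a == 0)%:R).
set B := lfpoly (ad H) p in pE *.
have B0 v : gen_eigen (ad H) 0 (B v).
  have [s [w [_ -> gw]]] := dec v; rewrite linear_sum; apply: gen_eigen_sum => a _.
  rewrite /= (pE a) //; have [a0|_] := eqVneq a 0.
    by rewrite scale1r -{1}a0.
  by rewrite scale0r; apply: gen_eigen00.
have B1 v : v - B v \in vbracket br t {: g}.
  have [s [w [_ -> gw]]] := dec v; rewrite linear_sum -sumrB; apply: rpred_sum => a _.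
  rewrite /= (pE a) //; have [a0|a0] := eqVneq a 0.
    by rewrite scale1r subrr mem0v.
  rewrite scale0r subr0; have [u ->] := gen_eigen_nz_im a0 (gw a).
  by rewrite adE mem_vbracket ?memvf.
have BU v : v \in U -> B v \in U.
  by apply: lfpoly_stable => u uU; rewrite adE sU.
pose U1 := (B @: U)%VS.
have U1U : (U1 <= U)%VS by apply/subvP => _ /memv_imgP[v vU ->]; apply: BU.
have BK v : gen_eigen (ad H) 0 v -> B v = v.
  by move=> /pE; rewrite eqxx scale1r.
apply: (IH U1).
- rewrite (leq_trans _ dU) // ltn_neqAle dimvS // andbT; apply/negP => /eqP dE.
  have /eqP E : U1 == U by rewrite -dimv_leqif_eq // dE.
  by apply: nx; move: xU; rewrite -{1}E => /memv_imgP[v _ ->].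
- apply/subvP => v vt; apply/memv_imgP; exists v; first exact: subvP tU _ vt.
  by rewrite BK //; apply: cartan_ad_nilp.
- move=> Z _ Zt /memv_imgP[v vU ->]; apply/memv_imgP; exists (lbr Z (B v)).
    by apply: sU => //; apply: BU.
  rewrite [RHS]BK //; have := gen_eigen_br (cartan_ad_nilp Ht Zt) (B0 v).
  by rewrite addr0.
- apply/subvP => v /(subvP gU) /memv_addP[u uU [w wT ->]].
  rewrite -(subrK (B u) u) [_ + B u]addrC -addrA memv_add ?memv_img //.
  by rewrite rpredD.
Qed.

Lemma cartan_plus_brackets : ({: g} <= t + vbracket br t {: g})%VS.
Proof.
apply: (@cartan_fitting fullv); rewrite ?subvf //.
  by move=> H x _ _; apply: memvf.
exact: addvSl.
Qed.

Lemma ad_trace_linear (B : 'End(g)) : linear_on setT (fun x => tr (ad x \o B) : C^o).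
Proof.
move=> a x y _ _.
by rewrite adD adZ comp_lfunDl -comp_lfunZl ltraceD ltraceZ.
Qed.

Lemma calculus_derivation H (f : C -> C) (p : {poly C}) :
  (forall a b, f (a + b) = f a + f b) ->
  (forall a v, gen_eigen (ad H) a v -> lfpoly (ad H) p v = f a *: v) ->
  forall x y, lfpoly (ad H) p (lbr x y) =
    lbr (lfpoly (ad H) p x) y + lbr x (lfpoly (ad H) p y).
Proof.
move=> fD pE x y; set B := lfpoly _ _.
have [_ [_ dec _]] := functional_calculus XY (ad H) id.
have [s [w [_ -> gw]]] := dec x; have [s' [w' [_ -> gw']]] := dec y.
have suml (I : Type) (r : seq I) (F : I -> g) z : lbr (\sum_(i <- r) F i) z = \sum_(i <- r) lbr (F i) z.
  by rewrite -(linear_of_eq ((lbr_bilinear g).1 z)) linear_sum.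
rewrite suml linear_sum [X in lbr X _]linear_sum !suml -big_split.
apply: eq_bigr => a _ /=; rewrite !linear_sum -big_split; apply: eq_bigr => b _ /=.
rewrite /B (pE _ _ (gen_eigen_br (gw a) (gw' b))) (pE _ _ (gw a)) (pE _ _ (gw' b)).
by rewrite fD scalerDl lbrZl linearZ.
Qed.

(** If [S] is the operator with eigenvalues conjugate to those of [ad c], then
    [tr (ad c S)] is the sum of the squared moduli of the eigenvalues. *)
Lemma conj_trace_nilp c p :
  (forall a v, gen_eigen (ad c) a v -> lfpoly (ad c) p v = a^* *: v) ->
  tr (ad c \o lfpoly (ad c) p) = 0 -> forall v, gen_eigen (ad c) 0 v.
Proof.
move=> pE tr0; have [q [qE dec [r [trE r0]]]] := functional_calculus XY (ad c) Num.conj.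
have pq : lfpoly (ad c) p = lfpoly (ad c) q.
  apply/lfunP => v; have [s [w [_ -> gw]]] := dec v.
  by rewrite !linear_sum; apply: eq_bigr => a _; rewrite /= (pE a) ?(qE a).
move/eqP: tr0; rewrite pq trE big_seq psumr_eq0 => [/allP r1|a _]; last exact: mul_conjC_ge0.
apply: r0 => a ar; have := r1 _ ar; rewrite ar /=.
by rewrite mul_conjC_eq0 => /eqP.
Qed.

Variables (h : C) (hh : is_dual_coxeter g h).

Lemma killing x y : tr (ad x \o ad y) = 2 * h * lfrm x y.
Proof.
have [X0 [Y0 [XY0 cas]]] := hh.
transitivity (lfrm x (\sum_k lbr (Y k) (lbr (X k) y))).
  rewrite linear_sum; apply: eq_bigr => k _; rewrite lfunE comp_lfunE !adE /=.
  rewrite -lfrm_inv lfrmC [lbr (Y k) x]lbrC linearN /= lfrmC lfrm_inv.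
  by rewrite [lbr y (X k)]lbrC linearN /= linearN opprK.
rewrite (@canonical_tensor C g _ (fun a b => lbr a (lbr b y)) Y X X0 Y0) ?cas ?linearZ //.
  split=> z; [exact: (lbr_bilinear g).1|].
  by move=> a u v _ _; rewrite lbrDl lbrZl linearP.
exact: dual_basesC.
Qed.

Section NonzeroCoxeter.
Hypothesis h0 : h != 0.

Let h2 : 2 * h != 0. Proof. by rewrite mulf_neq0 ?pnatr_eq0. Qed.

(** The trace form is then nondegenerate: it is a nonzero multiple of the given
    form. *)
Lemma central_nilp0 c : (forall H, H \in t -> lbr c H = 0) ->
  (forall x, gen_eigen (ad c) 0 x) -> c = 0.
Proof.
move=> ct nc; apply: lfrm_ndg => y.
pose S := lker (linfun (lfrm c)).
suff /subvP/(_ y (memvf y)) : ({: g} <= S)%VS by rewrite memv_ker lfunE => /eqP.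
apply: subv_trans cartan_plus_brackets _; rewrite subv_add; apply/andP; split.
  apply/subvP => H Ht; rewrite memv_ker lfunE /=.
  suff /eqP : 2 * h * lfrm c H = 0 by rewrite mulf_eq0 (negPf h2).
  rewrite -killing; apply: (ltrace_nilp XY) => x; apply/gen_eigenX.
  have [k ck] := (gen_eigenX _ _).1 (nc x); exists k.
  have cH v : ad H (ad c v) = ad c (ad H v).
    by rewrite !adE [RHS]lbrJ (ct H) // lbr0l add0r.
  have -> : lfpow (ad c \o ad H) k x = lfpow (ad H) k (lfpow (ad c) k x).
    elim: k {ck} => [|k IH]; first by rewrite !lfpow0.
    rewrite !lfpowS IH comp_lfunE -cH; congr (ad H _).
    elim: k {IH} (lfpow (ad c) k x) => [|k IH] v; first by rewrite !lfpow0.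
    by rewrite !lfpowS -IH cH.
  by rewrite ck linear0.
apply: vbracket_sub => H u Ht _; rewrite memv_ker lfunE /=.
by rewrite -lfrm_inv (ct H) // lfrmC linear0.
Qed.

(** The classical argument that the derivations of a Lie algebra with a
    nondegenerate trace form are inner. *)
Lemma derivation_inner (D : 'End(g)) :
  (forall x y, D (lbr x y) = lbr (D x) y + lbr x (D y)) ->
  exists e, D = ad e.
Proof.
move=> derD.
pose e := (2 * h)^-1 *: \sum_k tr (ad (X k) \o D) *: Y k.
have eE x : tr (ad x \o D) = 2 * h * lfrm e x.
  rewrite lfrmC linearZ /= mulrA mulfV // mul1r linear_sum {1}[x](XY.1).
  rewrite (linear_on_sumZ (ad_trace_linear D)); apply: eq_bigr => k _.
  by rewrite linearZ /= lfunE /= [lfrm x _]lfrmC [RHS]mulrC.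
exists e; apply/eqP; rewrite -subr_eq0; set D' := D - ad e.
have derD' x y : D' (lbr x y) = lbr (D' x) y + lbr x (D' y).
  rewrite /D' !add_lfunE !opp_lfunE derD !adE linearD linearN lbrDl lbrNl /=.
  by rewrite [lbr e (lbr x y)]lbrJ opprD addrACA.
have trD' x : tr (ad x \o D') = 0.
  by rewrite /D' comp_lfunDr comp_lfunNr ltraceB eE killing lfrmC subrr.
apply/eqP; apply/lfunP => x; rewrite [RHS]lfunE /=; apply: lfrm_ndg => y.
suff /eqP : 2 * h * lfrm (D' x) y = 0 by rewrite mulf_eq0 (negPf h2) => /eqP.
rewrite -killing.
have -> : ad (D' x) = (D' \o ad x)%VF - (ad x \o D')%VF.
  apply/lfunP => z; rewrite add_lfunE opp_lfunE !comp_lfunE !adE derD'.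
  by rewrite addrK.
rewrite comp_lfunDl comp_lfunNl ltraceB -!comp_lfunA.
rewrite [X in _ - X](ltraceC XY) -[X in _ - tr X]comp_lfunA !(ltraceC XY D').
by rewrite -ltraceB -comp_lfunNl -comp_lfunDl -ad_br trD'.
Qed.

Lemma central_bracket_trace c p u w : (forall v, ad c (ad w v) = ad w (ad c v)) ->
  tr (ad (lbr u w) \o lfpoly (ad c) p) = 0.
Proof.
move=> cw; rewrite ad_br comp_lfunDl comp_lfunNl ltraceB -!comp_lfunA.
have -> : (ad w \o lfpoly (ad c) p)%VF = (lfpoly (ad c) p \o ad w)%VF.
  by apply/lfunP => v; rewrite !comp_lfunE lfpoly_comm.
by rewrite comp_lfunA (ltraceC XY _ (ad w)) subrr.
Qed.

(** A nonzero term of the lower central series just before the series vanishes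
    would consist of central commutators, whose adjoint action has only the
    eigenvalue zero. *)
Lemma cartan_abelian x y : x \in t -> y \in t -> lbr x y = 0.
Proof.
move=> xt yt; suff l1 : lcs g 1 = 0%VS.
  by apply/eqP; rewrite -memv0 -l1 mem_vbracket.
have [_ [k k0] _] := cartanP g.
have {k0} : lcs g k.+1 = 0%VS.
  apply/eqP; rewrite -subv0; apply: vbracket_sub => u w _ wl.
  have : w \in lcs g k by [].
  by rewrite /lcs k0 memv0 => /eqP->; rewrite linear0 mem0v.
elim: k => // k IH l2; apply: IH; apply/eqP; rewrite -subv0.
apply/subvP => c cl; rewrite memv0.
have ct : c \in t by apply: subvP (lcs_sub _ _) _ cl.
have cH H : H \in t -> lbr c H = 0.
  move=> Ht; rewrite lbrC; apply/eqP; rewrite oppr_eq0 -memv0 -l2.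
  exact: mem_vbracket.
have [p [pE _ _]] := functional_calculus XY (ad c) Num.conj.
apply/eqP/central_nilp0 => //; apply: (conj_trace_nilp pE).
pose L := linear_of (ad_trace_linear (lfpoly (ad c) p)).
suff /subvP/(_ c cl) : (lcs g k.+1 <= lker (linfun L))%VS.
  by rewrite memv_ker lfunE => /eqP.
apply: vbracket_sub => u w _ wl; rewrite memv_ker lfunE; apply/eqP.
apply: central_bracket_trace => v; rewrite !adE lbrJ cH ?lbr0l ?add0r //.
exact: subvP (lcs_sub _ _) _ wl.
Qed.

(** The semisimple part of [ad H] is an inner derivation by an element of the
    centraliser of [t]; the nilpotent part then comes from the same centraliser, and
    vanishes. *)
Lemma cartan_semisimple H a v : H \in t -> gen_eigen (ad H) a v -> lbr H v = a *: v.
Proof.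
move=> Ht; have [p [pE dec _]] := functional_calculus XY (ad H) id.
have [e eE] := derivation_inner (calculus_derivation (fun a b => erefl) pE).
have et Z : Z \in t -> lbr e Z = 0.
  move=> Zt; rewrite -adE -eE (pE 0) ?scale0r //.
  exact: cartan_ad_nilp.
suff /eqP : H - e = 0 by rewrite subr_eq0 => /eqP He gv; rewrite {1}He -adE -eE (pE a).
apply: central_nilp0 => [Z Zt|x].
  by rewrite lbrDl lbrNl et // cartan_abelian // subr0.
have [s [w [_ -> gw]]] := dec x; apply: gen_eigen_sum => b _.
have [k] := gw b; elim: k (w b) => [|k IH] u.
  by rewrite expr0 lfpolyC scale1r => ->; apply: gen_eigen00.
move=> uk; have gu : gen_eigen (ad H) b u by exists k.+1.
have Eu : ad (H - e) u = lfpoly (ad H) ('X - b%:P) u.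
  by rewrite adB add_lfunE opp_lfunE -eE (pE b) // lfpolyXsubC.
move: uk; rewrite exprSr lfpolyM -Eu => /IH[j uj]; exists j.+1.
by rewrite exprSr lfpolyM lfpolyXsubC scale0r [X in lfpoly _ _ X]subr0 uj.
Qed.

Lemma cartan_eigenvectors (s : seq g) : {subset s <= t} -> forall v,
  lspan [set w | forall H, H \in s -> exists a, lbr H w = a *: w] v.
Proof.
elim: s => [|H s IH] st v; first by apply: lspan_in => H; rewrite in_nil.
have Ht : H \in t by apply: st; rewrite inE eqxx.
have {}IH : lspan [set w | forall H, H \in s -> exists a, lbr H w = a *: w] v.
  by apply: IH => Z Zs; apply: st; rewrite inE Zs orbT.
elim: IH => [w ws||a u w _ Su _ Sw]; [|exact: lspan_0|exact: lspan_lin].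
have [_ [_ dec _]] := functional_calculus XY (ad H) id.
have [r [u [ur wE gu]]] := dec w; rewrite wE big_seq; apply: lspan_sum => a ar.
apply: lspan_in => Z; rewrite inE => /orP[/eqP->|Zs].
  by exists a; apply: cartan_semisimple.
have [b wb] := ws Z Zs; exists b.
have [p [pE _ _]] := functional_calculus XY (ad H) (fun c => (c == a)%:R).
have -> : u a = lfpoly (ad H) p w.
  rewrite wE linear_sum (bigD1_seq a) //= (pE a) // eqxx scale1r big1 ?addr0 // => c ca.
  by rewrite (pE c) // (negPf ca) scale0r.
have Zt : Z \in t by apply: st; rewrite inE Zs orbT.
rewrite -adE -lfpoly_comm => [|y]; first by rewrite adE wb linearZ.
by rewrite !adE lbrJ (cartan_abelian Ht Zt) lbr0l add0r.
Qed.

End NonzeroCoxeter.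

(** When the trace form vanishes, the same trace computation applies to every
    commutator, and the reductive Lie algebra is nilpotent. *)
Lemma ad_nilp_of_coxeter0 x y : h = 0 -> gen_eigen (ad x) 0 y.
Proof.
move=> h0; pose I := vbracket br {: g} {: g}.
have idI : is_ideal br I by move=> u v _; rewrite mem_vbracket ?memvf.
have [J [idJ IJ IJ0]] := ql_reductive idI.
have : x \in (I + J)%VS by rewrite IJ memvf.
move=> /memv_addP[c cI [z zJ ->]].
have Jz u : lbr z u = 0.
  apply/eqP; rewrite -memv0 -IJ0 memv_cap mem_vbracket ?memvf //.
  by rewrite lbrC rpredN idJ.
have -> : ad (c + z) = ad c.
  by apply/lfunP => u; rewrite !adE lbrDl Jz addr0.
have [p [pE _ _]] := functional_calculus XY (ad c) Num.conj.
apply: (conj_trace_nilp pE).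
pose L := linear_of (ad_trace_linear (lfpoly (ad c) p)).
suff /subvP/(_ c cI) : (I <= lker (linfun L))%VS by rewrite memv_ker lfunE => /eqP.
apply: vbracket_sub => u w _ _; rewrite memv_ker lfunE; apply/eqP.
change (tr (ad (lbr u w) \o lfpoly (ad c) p) = 0).
have derB := calculus_derivation (fun a b => rmorphD Num.conj a b) pE.
set B := lfpoly (ad c) p in derB *.
have -> : tr (ad (lbr u w) \o B) = - tr (ad u \o ad (B w)).
  have -> : ad (B w) = (B \o ad w)%VF - (ad w \o B)%VF.
    apply/lfunP => v; rewrite add_lfunE opp_lfunE !comp_lfunE !adE derB.
    by rewrite addrK.
  rewrite ad_br comp_lfunDl comp_lfunNl comp_lfunDr comp_lfunNr !ltraceB opprB.
  rewrite -[in LHS](comp_lfunA (ad u)) -(comp_lfunA (ad w)) (ltraceC XY (ad w)).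
  by rewrite -comp_lfunA.
by rewrite killing h0 mulr0 mul0r oppr0.
Qed.

(** The root space decomposition. *)
Theorem psub_roots x : psub (@Defs.roots C g) x.
Proof.
have [h0|h0] := eqVneq h 0.
  apply: lspan_in; left; apply: (subvP (cartan_engel (subvf t) _ _)) => [||].
  - by move=> H u _ _; apply: memvf.
  - by move=> H u _ _; apply: ad_nilp_of_coxeter0.
  - exact: memvf.
have sub : {subset vbasis t <= t} by move=> H; apply: vbasis_mem.
have := cartan_eigenvectors h0 sub x; apply: lspan_sub.
- exact: lspan_0.
- by move=> a u w; apply: lspan_lin.
move=> w ew; have [->|w0] := eqVneq w 0; first exact: lspan_0.
have /(_ _)/cid aP (i : 'I_(\dim t)) : exists a, lbr (vbasis t)`_i w = a *: w.
  by apply: ew; rewrite mem_nth ?size_tuple.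
pose al (H : subvs_of t) : C^o := \sum_i coord (vbasis t) i (vsval H) * sval (aP i).
have al_lin : linear_on setT al.
  move=> a H Z _ _; rewrite scaler_sumr -big_split; apply: eq_bigr => i _ /=.
  by rewrite linearP mulrDl /GRing.scale /= mulrA.
pose alpha : cartan_dual g := linfun (linear_of al_lin).
have alE : rootspace alpha w.
  move=> H; rewrite lfunE /= {1}(coord_vbasis (subvsP H)).
  rewrite (linear_on_sumZ ((lbr_bilinear g).1 _)) /al scaler_suml.
  by apply: eq_bigr => i _; rewrite -scalerA -(svalP (aP i)).
have [a0|a0] := eqVneq alpha 0.
  apply: lspan_in; left; have [_ _ normt] := cartanP g; apply: normt => y yt.
  rewrite lbrC rpredN; have := alE (Subvs yt).
  by rewrite a0 lfunE /= scale0r => ->; apply: mem0v.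
apply: lspan_in; right; exists alpha => //; split=> //.
by exists w.
Qed.

End RootDecomposition.

(** * Affine Lie algebras and the Segal-Sugawara operator *)
Lemma fsum_seq (I : choiceType) (V : zmodType) (r : seq I) (F : I -> V) : uniq r ->
  (forall i, i \notin r -> F i = 0) -> \sum_(i \in [set: I]) F i = \sum_(i <- r) F i.
Proof.
move=> ur Fr; rewrite (fsbig_seq _ F ur); apply/esym/fsbig_widen => // i [_ /= ir].
exact/Fr/negP.
Qed.

Lemma fsum_single (I : choiceType) (V : zmodType) (i0 : I) (F : I -> V) :
  (forall i, i != i0 -> F i = 0) -> \sum_(i \in [set: I]) F i = F i0.
Proof.
move=> F0; rewrite (@fsum_seq _ _ [:: i0]) ?big_seq1 // => i.
by rewrite inE; apply: F0.
Qed.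

Section Affine.
Variables (C : numClosedFieldType) (g : quad_lie C).
Implicit Types (f : laurent g) (x y z : g).

Lemma laurent_ext (f1 f2 : laurent g) : (forall k, f1 k = f2 k) -> f1 = f2.
Proof. by move=> ff; apply/val_inj/funext. Qed.

Lemma laurentD f1 f2 k : (f1 + f2 : laurent g) k = f1 k + f2 k. Proof. by []. Qed.
Lemma laurentZ a f k : (a *: f : laurent g) k = a *: f k. Proof. by []. Qed.

Lemma laurent_below f : exists N : int, forall k, k < N -> f k = 0.
Proof. by case: f => f /= /asboolP. Qed.

Lemma monomial_lin k : linear_on setT (fun x : g => monomial x k).
Proof.
move=> a y z _ _; apply: laurent_ext => l; rewrite laurentD laurentZ /=.
by case: eqP; rewrite ?scaler0 ?addr0.
Qed.

Lemma aX_lin k : linear_on setT (fun x : g => aX x k).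
Proof.
move=> a y z _ _; rewrite /aX (monomial_lin k) //.
by congr pair; rewrite [RHS]addr0 -[RHS]/(a *: 0) scaler0.
Qed.

Lemma aX_br y z i j : affine_br (aX y i) (aX z j) =
  aX (lbr y z) (i + j) + ((if i + j == 0 then i%:~R * lfrm y z else 0) *: aK g).
Proof.
congr pair.
  rewrite [X in monomial _ _ + X](scaler0 _ _) addr0.
  apply: laurent_ext => k /=; rewrite (@fsum_single _ _ i) => [|l /negPf->]; last by rewrite lbr0l.
  by rewrite eqxx subr_eq [j + i]addrC; case: ifP; rewrite ?linear0.
rewrite add0r (@fsum_single _ _ i) => [|l /negPf li]; last first.
  by rewrite /= li lfrmC linear0 mulr0.
rewrite -[RHS]/((if i + j == 0 then i%:~R * lfrm y z else 0) * 1) mulr1 /= eqxx.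
rewrite -[- i == j]subr_eq0 -opprD oppr_eq0.
by case: ifP => _; rewrite ?linear0 ?mulr0.
Qed.

Definition dlaurent_subproof f : (fun k => (k + 1)%:~R *: f (k + 1)) \in @below C g.
Proof.
have [N fN] := laurent_below f; apply/asboolP; exists (N - 1) => k kN.
by rewrite fN ?scaler0 // -ltrBrDr.
Qed.

Definition dlaurent f : laurent g := Laurent (dlaurent_subproof f).

End Affine.

(** A smooth module of level [kappa]; [act] carries no further structure, so that
    the induced modules fit without repackaging. *)
Record smooth_module (C : numClosedFieldType) (g : quad_lie C) (kappa : C)
    (V : lmodType C) (act : affine g -> V -> V) : Prop := SmoothModule {
  act_linr : forall x, linear_on setT (act x);
  act_linl : forall v, linear_on setT (act^~ v);
  act_brE : forall x y v, act x (act y v) = act y (act x v) + act (affine_br x y) v;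
  act_level : forall v, act (aK g) v = kappa *: v;
  act_smooth : forall v, exists N : nat, forall f : laurent g,
    (forall k : int, k < N%:Z -> f k = 0) -> act (f, 0) v = 0 }.

Section Sugawara.
Variables (C : numClosedFieldType) (g : quad_lie C) (kappa : C).
Variables (V : lmodType C) (act : affine g -> V -> V).
Hypothesis actP : smooth_module kappa act.
Variables (X Y : 'I_(\dim {: g}) -> g) (hXY : dual_bases X Y).
Variables (h : C) (hh : is_dual_coxeter g h).
Implicit Types (x y z Z : g) (v w : V) (i j p q : int) (f : laurent g).

Definition mode Z i v := act (aX Z i) v.

Lemma mode_linr Z i : linear_on setT (mode Z i).
Proof. exact: act_linr actP _. Qed.

HB.instance Definition _ Z i := GRing.isLinear.Build C V V *:%R (mode Z i)
  (linear_on_linear (mode_linr Z i)).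

Lemma mode_linl i v : linear_on setT (fun Z => mode Z i v).
Proof.
by move=> a x y _ _; rewrite /mode (aX_lin i) // (act_linl actP v).
Qed.

Lemma mode_scale a x i v : mode (a *: x) i v = a *: mode x i v.
Proof. exact: (linearZ_LR (linear_of (mode_linl i v))). Qed.

Lemma mode0l i v : mode 0 i v = 0.
Proof. exact: (linear0 (linear_of (mode_linl i v))). Qed.

Lemma mode_sumZl i v I (r : seq I) (a : I -> C) (x : I -> g) :
  mode (\sum_(k <- r) a k *: x k) i v = \sum_(k <- r) a k *: mode (x k) i v.
Proof. exact: (linear_on_sumZ (mode_linl i v)). Qed.

Lemma mode_suml i v I (r : seq I) (x : I -> g) :
  mode (\sum_(k <- r) x k) i v = \sum_(k <- r) mode (x k) i v.
Proof. by rewrite -(linear_of_eq (mode_linl i v)) linear_sum. Qed.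

Lemma mode_br x y i j v : mode x i (mode y j v) =
  mode y j (mode x i v) + mode (lbr x y) (i + j) v
    + (if i + j == 0 then i%:~R * lfrm x y * kappa else 0) *: v.
Proof.
rewrite /mode (act_brE actP) aX_br addrC [X in act X v]addrC.
rewrite (act_linl actP v) // (act_level actP) scalerA addrC -addrA; congr (_ + _).
by rewrite addrC; case: ifP => _; rewrite ?mul0r.
Qed.

Lemma mode_smooth v : exists N : nat, forall Z i, N%:Z <= i -> mode Z i v = 0.
Proof.
have [N sN] := act_smooth actP v; exists N => Z i Ni; apply: sN => k kN /=.
by case: eqP kN => // ->; rewrite ltNge Ni.
Qed.

Lemma mode_bilinear i j v : bilinear_map (fun x y => mode x i (mode y j v)).
Proof.
split=> z; first exact: mode_linl.
by move=> a x y _ _; rewrite (mode_linl j v) // linearP.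
Qed.

(** The canonical tensor is symmetric and invariant. *)
Lemma canonical_tensorC (W : lmodType C) (b : g -> g -> W) : bilinear_map b ->
  \sum_k b (X k) (Y k) = \sum_k b (Y k) (X k).
Proof. by move=> hb; apply: canonical_tensor hXY _ => //; apply: dual_basesC. Qed.

Lemma canonical_tensor_inv (W : lmodType C) (b : g -> g -> W) Z : bilinear_map b ->
  \sum_k b (lbr (X k) Z) (Y k) = - \sum_k b (X k) (lbr (Y k) Z).
Proof.
move=> [bl br].
have EX k : lbr (X k) Z = \sum_l lfrm (Y l) (lbr (X k) Z) *: X l.
  rewrite {1}[lbr (X k) Z]((dual_bases_coord hXY).1).
  by apply: eq_bigr => l _; rewrite lfunE.
have EY l : lbr (Y l) Z = \sum_k lfrm (X k) (lbr (Y l) Z) *: Y k.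
  rewrite {1}[lbr (Y l) Z]((dual_bases_coord (dual_basesC hXY)).1).
  by apply: eq_bigr => k _; rewrite lfunE.
rewrite -sumrN.
under eq_bigr do rewrite EX (linear_on_sumZ (bl _)).
rewrite exchange_big; apply: eq_bigr => l _ /=.
rewrite [lbr (Y l) Z]EY (linear_on_sumZ (br _)) -sumrN; apply: eq_bigr => k _.
rewrite -scaleNr; congr (_ *: _).
by rewrite lfrmC lfrm_inv [lbr Z _]lbrC linearN.
Qed.

Lemma canonical_tensor_frm x : \sum_k lfrm (X k) x *: Y k = x.
Proof.
rewrite [RHS]((dual_bases_coord (dual_basesC hXY)).1).
by apply: eq_bigr => k _; rewrite lfunE.
Qed.

Lemma canonical_casimir Z : \sum_k lbr (X k) (lbr (Y k) Z) = (2 * h) *: Z.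
Proof.
have [X0 [Y0 [XY0 <-]]] := hh.
apply: (@canonical_tensor C g _ (fun a b => lbr a (lbr b Z))) => //.
split=> z; first exact: (lbr_bilinear g).1.
by move=> a u v _ _; rewrite lbrDl lbrZl linearP.
Qed.

(** The modes of [\sum_k X k (z) [Y k, Z] (z)], which carry the commutator of
    the Sugawara operator with the modes of [Z]. *)
Definition twisted_mode Z i q v := \sum_k mode (X k) i (mode (lbr (Y k) Z) q v).

Lemma twisted_mode_sym Z i q v :
  twisted_mode Z i q v + twisted_mode Z q i v = (2 * h) *: mode Z (i + q) v.
Proof.
have bZ j k : bilinear_map (fun x y => mode x j (mode (lbr y Z) k v)).
  split=> z; first exact: mode_linl.
  by move=> a x y _ _; rewrite lbrDl lbrZl (mode_linl k v) // linearP.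
have frm0 : \sum_k lfrm (X k) (lbr (Y k) Z) = 0.
  have bf : bilinear_map (fun x y => lfrm x (lbr y Z)).
    split=> z; first exact: (lfrm_bilinear g).1.
    by move=> a x y _ _; rewrite lbrDl lbrZl linearP.
  have := canonical_tensor_inv Z (lfrm_bilinear g).
  under eq_bigr do rewrite lfrmC.
  rewrite -(canonical_tensorC bf) => /eqP.
  by rewrite -subr_eq0 opprK -mulr2n mulrn_eq0 => /eqP.
have -> : twisted_mode Z q i v = - \sum_k mode (lbr (Y k) Z) q (mode (X k) i v).
  have bY : bilinear_map (fun x y => mode (lbr x Z) q (mode y i v)).
    split=> z; last by move=> a x y _ _; rewrite (mode_linl i v) // linearP.
    by move=> a x y _ _; rewrite lbrDl lbrZl mode_linl.
  rewrite -(canonical_tensorC bY).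
  by rewrite (canonical_tensor_inv Z (mode_bilinear q i v)) opprK.
rewrite /twisted_mode; under eq_bigr do rewrite mode_br.
rewrite !big_split /= -[_ + _ + _ in X in X - _]addrA [X in X - _]addrC addrK.
rewrite -mode_suml canonical_casimir -scaler_suml [X in _ + X *: v](_ : _ = 0).
  by rewrite scale0r addr0 -(linear_of_eq (mode_linl (i + q) v)) linearZ.
case: (i + q == 0); last by rewrite big1.
by rewrite -mulr_suml -mulr_sumr frm0 mulr0 mul0r.
Qed.

Definition sug_mode (n : nat) v := \sum_k mode (X k) (- n.+1%:Z) (mode (Y k) n%:Z v).

Lemma sug_mode_lin n : linear_on setT (sug_mode n).
Proof.
move=> a u v _ _; rewrite scaler_sumr -big_split; apply: eq_bigr => k _ /=.
by rewrite !linearP.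
Qed.

Lemma sug_mode_smooth v : exists N : nat, forall n, (N <= n)%N -> sug_mode n v = 0.
Proof.
have [N sN] := mode_smooth v; exists N => n Nn.
by apply: big1 => k _; rewrite sN // linear0.
Qed.

Local Notation L := (sugawara X Y h kappa act (-1)).

(** The summands of [L_(-1)] indexed by [n.+1] and by [-n] coincide, because
    the canonical tensor is symmetric. *)
Lemma sugawara_sum v : exists N : nat, forall J, (N <= J)%N ->
  L v = (kappa + h)^-1 *: \sum_(n < J) sug_mode n v.
Proof.
have [N sN] := sug_mode_smooth v; exists N => J NJ; rewrite /sugawara.
pose r := [seq n.+1%:Z | n <- iota 0 J] ++ [seq - n%:Z | n <- iota 0 J].
pose T (j : int) := \sum_k (if - j <= -1 + j
   then act (aX (X k) (- j)) (act (aX (Y k) (-1 + j)) v)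
   else act (aX (Y k) (-1 + j)) (act (aX (X k) (- j)) v)).
have T1 n : T n.+1%:Z = sug_mode n v.
  apply: eq_bigr => k _; have -> : -1 + n.+1%:Z = n%:Z by rewrite -addn1 PoszD addrCA addrN addr0.
  by [].
  
have T2 n : T (- n%:Z) = sug_mode n v.
  transitivity (\sum_k mode (Y k) (- n.+1%:Z) (mode (X k) n%:Z v)).
    apply: eq_bigr => k _; rewrite opprK -opprD -PoszD add1n.
    by case: n.
  exact/esym/(canonical_tensorC (mode_bilinear _ _ _)).
rewrite (@fsum_seq _ _ r T).
- rewrite big_cat !big_map /= (eq_bigr _ (fun n _ => T1 n)) (eq_bigr _ (fun n _ => T2 n)).
  have -> : \sum_(n <- iota 0 J) sug_mode n v = \sum_(n < J) sug_mode n v.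
    by rewrite -(big_mkord xpredT (fun n => sug_mode n v)) /index_iota subn0.
  rewrite -mulr2n -[X in _ *: X = _]scaler_nat scalerA invfM mulrAC mulVf ?mul1r ?pnatr_eq0 //.
- rewrite cat_uniq !map_inj_uniq ?iota_uniq //=; first last.
  + by move=> m n [].
  + by move=> m n /oppr_inj[].
  rewrite andbT; apply/hasPn => _ /mapP[n _ ->]; apply/negP => /mapP[m _].
  by case: n.
- move=> j; rewrite mem_cat negb_or => /andP[j1 j2].
  have [n En] : exists n, j = n.+1%:Z \/ j = - n%:Z.
    by case: (intP j) => [|n|n]; [exists 0%N; right|exists n; left|exists n.+1; right].
  have Jn : (J <= n)%N.
    rewrite leqNgt; apply/negP => nJ; case: En => Ej.
      by case/mapP: j1; exists n; rewrite // mem_iota add0n.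
    by case/mapP: j2; exists n; rewrite // mem_iota add0n.
  by case: En => ->; rewrite ?T1 ?T2 sN // (leq_trans NJ).
Qed.

Lemma sugawara_lin : linear_on setT L.
Proof.
move=> a u v _ _; have [N1 s1] := sugawara_sum u; have [N2 s2] := sugawara_sum v.
have [N3 s3] := sugawara_sum (a *: u + v).
pose J := maxn N3 (maxn N1 N2).
rewrite (s1 J) ?(s2 J) ?(s3 J) ?leq_max ?leqnn ?orbT //.
rewrite scalerA [a * _]mulrC -scalerA -scalerDr; congr (_ *: _); rewrite scaler_sumr -big_split.
by apply: eq_bigr => n _; rewrite sug_mode_lin.
Qed.

Lemma sug_mode_br n Z p v :
  sug_mode n (mode Z p v) - mode Z p (sug_mode n v) =
  twisted_mode Z (- n.+1%:Z) (n%:Z + p) v - twisted_mode Z (p - n.+1%:Z) n%:Z v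
  + ((if n%:Z + p == 0 then n%:R * kappa else 0) *: mode Z (- n.+1%:Z) v
     - (if p == n.+1%:Z then n.+1%:R * kappa else 0) *: mode Z n%:Z v).
Proof.
set a := - n.+1%:Z; set b := n%:Z.
pose c1 : C := if b + p == 0 then n%:R * kappa else 0.
pose c2 : C := if a + p == 0 then - n.+1%:R * kappa else 0.
have E k : mode (X k) a (mode (Y k) b (mode Z p v)) - mode Z p (mode (X k) a (mode (Y k) b v)) =
    (mode (lbr (X k) Z) (a + p) (mode (Y k) b v)
      + mode (X k) a (mode (lbr (Y k) Z) (b + p) v))
    + (c1 *: (lfrm (Y k) Z *: mode (X k) a v) + c2 *: (lfrm (X k) Z *: mode (Y k) b v)).
  rewrite (mode_br (Y k)) !linearD linearZ /= (mode_br (X k)).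
  have -> : (if b + p == 0 then b%:~R * lfrm (Y k) Z * kappa else 0) = c1 * lfrm (Y k) Z.
    by rewrite /c1; case: ifP => _; rewrite ?mul0r // mulrAC.
  have -> : (if a + p == 0 then a%:~R * lfrm (X k) Z * kappa else 0) = c2 * lfrm (X k) Z.
    by rewrite /c2 /a mulrNz; case: ifP => _; rewrite ?mul0r // mulrAC.
  rewrite -!scalerA [LHS]addrC !addrA addNr add0r -!addrA; congr (_ + _).
  by rewrite addrCA; congr (_ + _); rewrite addrC.
rewrite /sug_mode linear_sum -sumrB (eq_bigr _ (fun k _ => E k)) !big_split /=.
rewrite (canonical_tensor_inv Z (mode_bilinear (a + p) b v)).
rewrite -!scaler_sumr -!mode_sumZl.
have -> : \sum_k lfrm (Y k) Z *: X k = Z.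
  have bf : bilinear_map (fun x y => lfrm x Z *: y).
    split=> z; last by move=> d x y _ _; rewrite linearP.
    by move=> d x y _ _; rewrite (lfrm_bilinear g).1 // scalerDl scalerA.
  by rewrite -(canonical_tensorC bf) canonical_tensor_frm.
rewrite canonical_tensor_frm [a + p]addrC [- _ + _]addrC; congr (_ + (_ + _)).
rewrite -scaleNr; congr (_ *: _); rewrite /c2 addrC subr_eq0.
by case: ifP => _; rewrite ?mulNr ?oppr0.
Qed.

Lemma sum_twisted_mode Z p (m : nat) i v : p - 1 - i = i + m%:Z - 1 ->
  \sum_(l < m) twisted_mode Z (i + l%:Z) (p - 1 - (i + l%:Z)) v =
  m%:R *: (h *: mode Z (p - 1) v).
Proof.
move=> mE; apply: (@scalerI _ _ 2); first by rewrite pnatr_eq0.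
rewrite scaler_nat mulr2n {2}(reindex_inj rev_ord_inj) -big_split /=.
rewrite (eq_bigr (fun=> (2 * h) *: mode Z (p - 1) v)) => [|l _]; last first.
  have -> : i + (m - l.+1)%N%:Z = p - 1 - (i + l%:Z).
    by have := ltn_ord l; move: mE; clear; lia.
  by rewrite subKr twisted_mode_sym addrC subrK.
by rewrite sumr_const card_ord -scaler_nat !scalerA mulrCA mulrA.
Qed.

Hypothesis kappah : kappa + h != 0.

(** The commutator of [L_(-1)] with [Z z^p]: in the double sum for the commutator
    the shifted index ranges differ by the [|p|] terms evaluated in
    [sum_twisted_mode], which contribute [h]; the central terms contribute [kappa]. *)
Theorem sugawara_mode Z p v : L (mode Z p v) - mode Z p (L v) = - (p%:~R *: mode Z (p - 1) v).
Proof.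
have [N1 s1] := sugawara_sum v; have [N2 s2] := sugawara_sum (mode Z p v).
have [N3 s3] := mode_smooth v.
pose J := (maxn N1 (maxn N2 (N3 + `|p| + `|p|).+1))%N.
rewrite (s1 J) ?(s2 J) ?leq_max ?leqnn ?orbT // linearZ /= -scalerBr.
suff -> : \sum_(n < J) sug_mode n (mode Z p v) - mode Z p (\sum_(n < J) sug_mode n v) =
    (kappa + h) *: - (p%:~R *: mode Z (p - 1) v).
  by rewrite scalerA mulVf // scale1r.
rewrite linear_sum -sumrB; under eq_bigr do rewrite sug_mode_br.
rewrite big_split /=.
have JN : (N3 + `|p| + `|p| < J)%N by rewrite !leq_max leqnn !orbT.
pose G i := twisted_mode Z i (p - 1 - i) v.
have G0 i : (N3%:Z <= p - 1 - i) -> G i = 0.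
  by move=> le; apply: big1 => k _; rewrite s3 // linear0.
rewrite (eq_bigr (fun n : 'I_J => G (0 - n.+1%:Z) - G (p - n.+1%:Z))) => [|n _]; last first.
  rewrite /G; congr (twisted_mode _ _ _ _ - twisted_mode _ _ _ _).
  - by rewrite sub0r.
  - by rewrite -addn1 PoszD; ring.
  - by rewrite -addn1 PoszD; ring.
have shift q m : (forall l : 'I_m, N3%:Z <= p - 1 - (q + l%:Z - J%:Z)) ->
    \sum_(n < J) G (q + m%:Z - n.+1%:Z) =
    \sum_(l < m) G (q + l%:Z) + \sum_(n < J) G (q - n.+1%:Z).
  have step q' : \sum_(n < J) G (q' + 1 - n.+1%:Z) =
      G q' - G (q' - J%:Z) + \sum_(n < J) G (q' - n.+1%:Z).
    elim: (J) => [|J' IH]; first by rewrite !big_ord0 subr0 subrr addr0.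
    rewrite !big_ord_recr IH /= (_ : q' + 1 - J'.+1%:Z = q' - J'%:Z); last by lia.
    by rewrite addrAC subrK [X in _ = _ + X]addrC addrA subrK.
  elim: m => [|m IH] Gm; first by rewrite big_ord0 add0r addr0.
  rewrite (_ : q + m.+1%:Z = q + m%:Z + 1) ?step; last by lia.
  rewrite IH => [|l]; last exact: (Gm (widen_ord (leqnSn m) l)).
  by rewrite (G0 _ (Gm ord_max)) subr0 big_ord_recr /= addrCA addrA.
rewrite sumrB.
have -> : \sum_(n < J) G (0 - n.+1%:Z) - \sum_(n < J) G (p - n.+1%:Z) =
    - (p%:~R *: (h *: mode Z (p - 1) v)).
  have [m [Ep|Ep]] : exists m : nat, p = m%:Z \/ p = - m%:Z.
    by exists `|p|%N; case: (intP p) => [|m|m]; rewrite ?abszN; [left|left|right].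
  - have -> : \sum_(n < J) G (p - n.+1%:Z) = \sum_(n < J) G (0 + m%:Z - n.+1%:Z).
      by rewrite Ep add0r.
    rewrite (shift 0 m) => [|l]; last by have := ltn_ord l; lia.
    rewrite opprD addrCA subrr addr0; congr (- _).
    have -> : p%:~R = m%:R :> C by rewrite Ep -pmulrn.
    rewrite -(@sum_twisted_mode Z p m 0 v); last by lia.
    by apply: eq_bigr.
  - have -> : \sum_(n < J) G (0 - n.+1%:Z) = \sum_(n < J) G (p + m%:Z - n.+1%:Z).
      by rewrite Ep addNr.
    rewrite (shift p m) => [|l]; last by have := ltn_ord l; lia.
    rewrite addrK (@sum_twisted_mode Z p m p v); last by lia.
    by rewrite Ep mulrNz scaleNr opprK.
rewrite scalerN scalerA [_ * p%:~R]mulrC -scalerA scalerDl scalerDr opprD addrC.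
congr (_ + _).
case: (intP p) JN => [|m|m] JN.
- rewrite scale0r oppr0 big1 // => n _; rewrite addr0 eqz_nat; case: (n : nat) => [|n'] /=.
    by rewrite mul0r !scale0r subr0.
  by rewrite !scale0r subr0.
- have mJ : (m < J)%N by lia.
  rewrite (bigD1 (Ordinal mJ)) //= eqxx big1 => [|n nm]; last first.
    rewrite (_ : (n%:Z + m.+1%:Z == 0) = false) ?scale0r ?sub0r; last by lia.
    rewrite (_ : (m.+1%:Z == n.+1%:Z) = false) ?scale0r ?oppr0 //.
    by apply/negbTE; move: nm; rewrite -val_eqE /=; lia.
  rewrite (_ : (m%:Z + m.+1%:Z == 0) = false) ?scale0r ?sub0r ?addr0; last by lia.
  by rewrite scalerA (_ : m.+1%:Z - 1 = m%:Z) //; lia.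
- have mJ : (m.+1 < J)%N by lia.
  rewrite (bigD1 (Ordinal mJ)) //= addrN eqxx big1 => [|n nm]; last first.
    rewrite scale0r subr0.
    rewrite (_ : (n%:Z - m.+1%:Z == 0) = false) ?scale0r //.
    by apply/negbTE; move: nm; rewrite -val_eqE /=; lia.
  rewrite scale0r subr0 addr0.
  rewrite mulrNz scaleNr opprK scalerA (_ : - m.+1%:Z - 1 = - m.+2%:Z) //; lia.
Qed.

Lemma act_laurentD f1 f2 v : act (f1 + f2, 0) v = act (f1, 0) v + act (f2, 0) v.
Proof.
rewrite -[act (f1, 0) v]scale1r -(act_linl actP v) //; congr (act _ v).
by rewrite scale1r; congr pair; rewrite addr0.
Qed.

(** For a Laurent series only finitely many modes act nontrivially on a given
    vector. *)
Lemma act_truncate (M : int) v : exists N : nat, forall f J,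
  (forall k, k < M -> f k = 0) -> (N <= J)%N ->
  act (f, 0) v = \sum_(n < J) mode (f (M + n%:Z)) (M + n%:Z) v.
Proof.
clear kappah; have [N sN] := act_smooth actP v; exists (N + `|M|)%N => f J fM NJ.
have modeE n : mode (f (M + n%:Z)) (M + n%:Z) v = act (monomial (f (M + n%:Z)) (M + n%:Z), 0) v.
  by [].
pose r := \sum_(n < J) monomial (f (M + n%:Z)) (M + n%:Z).
have rE (k : int) : r k = if k < M + J%:Z then f k else 0.
  have -> : r k = \sum_(n < J) monomial (f (M + n%:Z)) (M + n%:Z) k.
    by rewrite /r; elim/big_rec2: _ => // n y1 y2 _ <-.
  have [kM|Mk] := ltP k M.
    rewrite big1 => [|n _]; first by rewrite fM // if_same.
    by rewrite /=; case: eqP => // kn; exfalso; lia.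
  have [kJ|Jk] := ltP k (M + J%:Z).
    have nJ : (`|k - M| < J)%N by lia.
    have kE : k = M + `|k - M|%N%:Z by lia.
    rewrite (bigD1 (Ordinal nJ)) //= -kE eqxx big1 ?addr0 // => n nn.
    by case: eqP => // kn; case/eqP: nn; apply: val_inj => /=; lia.
  by rewrite big1 // => n _ /=; case: eqP => // kn; have nJ := ltn_ord n; exfalso; lia.
rewrite -{1}[f](subrK r) act_laurentD sN ?add0r => [|k kN]; last first.
  rewrite -[LHS]/(f k - r k) rE; case: ltP => [_|Jk]; first by rewrite subrr.
  by lia.
rewrite /r; elim: (J) => [|J' IH].
  by rewrite !big_ord0 -(linear_of_eq (act_linl actP v)) (_ : (0, 0) = 0) // linear0.
by rewrite !big_ord_recr /= -IH act_laurentD.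
Qed.

Theorem sugawara_laurent f v : L (act (f, 0) v) - act (f, 0) (L v) = - act (dlaurent f, 0) v.
Proof.
have [M fM] := laurent_below f.
have dfM k : k < M - 1 -> dlaurent f k = 0.
  by move=> kM; rewrite /= fM ?scaler0 // -ltrBrDr.
have [N1 s1] := act_truncate M v; have [N2 s2] := act_truncate M (L v).
have [N3 s3] := act_truncate (M - 1) v.
pose J := maxn N1 (maxn N2 N3).
rewrite (s1 f J) ?(s2 f J) ?(s3 _ J) ?leq_max ?leqnn ?orbT //.
rewrite -(linear_of_eq sugawara_lin) linear_sum -sumrB -sumrN; apply: eq_bigr => n _.
rewrite linear_of_eq sugawara_mode -mode_scale; congr (- _).
have -> : M - 1 + n%:Z = M + n%:Z - 1 by rewrite addrAC.
by rewrite /= subrK.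
Qed.

End Sugawara.

(** * Singularity modules are smooth *)
Section QuotientLinear.
Variables (C : numClosedFieldType) (V : lmodType C) (S : set V).

Lemma qlift_linear (W : lmodType C) (F : V -> W) :
  linear_on setT F -> (forall x, S x -> F x = 0) ->
  linear_on setT (qlift (S := S) F).
Proof.
move=> Fl FS a x y _ _; rewrite -(qreprK x) -(qreprK y) -qpi_linear //.
by rewrite !qliftE // Fl.
Qed.

Lemma qpi_eq0 x : lspan S x -> qpi S x = 0.
Proof. by move=> Sx; apply/qpiP; rewrite subr0. Qed.

HB.instance Definition _ := GRing.isLinear.Build C V (lquot S) *:%R (@qpi C V S)
  (linear_on_linear (@qpi_linear C V S)).

End QuotientLinear.

Section FreeModuleLemmas.
Variables (C : numClosedFieldType) (T : choiceType).

Lemma fmodE (f : fmod C T) : f = fext (fbase C (T := T)) f.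
Proof.
have finf : finite_set [set t | f t != 0] by case: f => f /= /asboolP.
rewrite (fext_supp _ finf) //; apply/val_inj/funext => s.
transitivity (\sum_(t <- fset_set [set t | f t != 0]) f t * (s == t)%:R).
  rewrite -[LHS]/(f s); have [fs|fs] := eqVneq (f s) 0.
    by rewrite fs big_seq big1 // => t; case: (s =P t) => [<-|_]; rewrite ?fs ?mul0r ?mulr0.
  rewrite (bigD1_seq s) ?fset_uniq //=; last by rewrite in_fset_set // inE.
  by rewrite eqxx mulr1 big1 ?addr0 // => t ts; rewrite eq_sym (negPf ts) mulr0.
by elim/big_rec2: _ => // t y1 y2 _ ->.
Qed.

Lemma fmod_span (f : fmod C T) : lspan (range (fbase C (T := T))) f.
Proof.
have finf : finite_set [set t | f t != 0] by case: f => f /= /asboolP.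
rewrite [f]fmodE (fext_supp _ finf) //; apply: lspan_sum => t _.
by apply/lspanZ/lspan_in; exists t.
Qed.

End FreeModuleLemmas.

Section InducedModule.
Variables (C : numClosedFieldType) (L : lmodType C) (brL : L -> L -> L).
Variables (P : set L) (chi : L -> C^o).
Local Notation M := (Defs.induced brL P chi).
Local Notation word := (ind_word brL P chi).

Lemma ind_span (v : M) : lspan (range word) v.
Proof.
rewrite -(qreprK v); elim: (fmod_span (qrepr v)) => [_ [u _ <-]||a x y _ sx _ sy].
- by apply: lspan_in; exists u.
- by rewrite linear0; apply: lspan_0.
- by rewrite linearP; apply: lspan_lin.
Qed.

Lemma ind_word_rel z : (env_rel brL `|` balance_rel P chi) z ->
  qpi (env_rel brL `|` balance_rel P chi) z = 0.
Proof. by move=> zR; apply/qpi_eq0/lspan_in. Qed.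

Lemma ind_word_lin u w a x y :
  word (u ++ (a *: x + y) :: w) = a *: word (u ++ x :: w) + word (u ++ y :: w).
Proof.
have /ind_word_rel/eqP : (env_rel brL `|` balance_rel P chi) (fbase C (u ++ (a *: x + y) :: w)
    - (a *: fbase C (u ++ x :: w) + fbase C (u ++ y :: w))).
  by left; left; exists u, w, a, x, y.
by rewrite linearB linearP subr_eq0 => /eqP.
Qed.

Lemma ind_word_br u w x y :
  word (u ++ [:: x, y & w]) = word (u ++ [:: y, x & w]) + word (u ++ brL x y :: w).
Proof.
have /ind_word_rel/eqP : (env_rel brL `|` balance_rel P chi) (fbase C (u ++ [:: x, y & w])
    - (fbase C (u ++ [:: y, x & w]) + fbase C (u ++ brL x y :: w))).
  by left; right; exists u, w, x, y.
by rewrite linearB linearD subr_eq0 => /eqP.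
Qed.

Lemma ind_word_chi u x : P x -> word (rcons u x) = chi x *: word u.
Proof.
move=> Px.
have /ind_word_rel/eqP : (env_rel brL `|` balance_rel P chi)
    (fbase C (rcons u x) - chi x *: fbase C u).
  by right; exists x => //; exists u.
by rewrite linearB linearZ subr_eq0 => /eqP.
Qed.

Lemma ind_act_lin x : linear_on setT (ind_act (brL := brL) (P := P) (chi := chi) x).
Proof.
apply: qlift_linear; first exact: fext_linear.
pose F := linear_of (@fext_linear C (seq L) M (fun u => word (x :: u))).
move=> z; rewrite -[fext _ z]/(F z).
case=> [[[u [w [a [y1 [y2 ->]]]]]|[u [w [y1 [y2 ->]]]]]|[y Py [u ->]]].
- by rewrite linearB linearP /= !fext_base -!cat_cons ind_word_lin subrr.
- by rewrite linearB linearD /= !fext_base -!cat_cons ind_word_br subrr.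
- by rewrite linearB linearZ /= !fext_base -rcons_cons ind_word_chi // subrr.
Qed.

Lemma ind_ext (W : lmodType C) (F G : M -> W) : linear_on setT F -> linear_on setT G ->
  (forall u, F (word u) = G (word u)) -> forall v, F v = G v.
Proof.
move=> Fl Gl FG v; elim: (ind_span v) => [_ [u _ <-] //||a x y _ Fx _ Fy].
  by rewrite -(linear_of_eq Fl) -(linear_of_eq Gl) !linear0.
by rewrite Fl // Gl // Fx Fy.
Qed.

End InducedModule.

Section SingularityModule.
Variables (C : numClosedFieldType) (g : quad_lie C).
Variables (h kappa : C) (hh : is_dual_coxeter g h).
Variables (X Y : 'I_(\dim {: g}) -> g) (hXY : dual_bases X Y).
Variables (r : nat) (psi : nat -> set (cartan_dual g)).
Hypothesis hpsi : parabolic_filtration r psi.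
Variables (lam : 'I_r -> g -> C^o) (chi : affine g -> C^o).
Hypothesis hchi : is_singular_char psi lam kappa chi.
Local Notation M := (sing_module psi chi).
Local Notation act := (@sing_act C g psi chi).
Local Notation word := (ind_word (@affine_br C g) (phat psi) chi).

Lemma act_word x u : act x (word u) = word (x :: u).
Proof. exact: ind_act_word. Qed.

Lemma sing_act_lin x : linear_on setT (act x).
Proof. exact: ind_act_lin. Qed.

Lemma sing_act_linl v : linear_on setT (act^~ v).
Proof.
move=> a x y _ _; move: v; apply: ind_ext => [|b v w _ _|u].
- exact: sing_act_lin.
- rewrite !sing_act_lin // !scalerDr !scalerA [a * b]mulrC -!scalerA.
  by rewrite addrACA.
- by rewrite !act_word; apply: (ind_word_lin _ _ _ [::]).
Qed.

Lemma sing_act_br x y v : act x (act y v) = act y (act x v) + act (affine_br x y) v.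
Proof.
move: v; apply: ind_ext => [b v w _ _|b v w _ _|u].
- by rewrite !sing_act_lin.
- by rewrite !sing_act_lin // scalerDr addrACA.
- by rewrite !act_word; apply: (ind_word_br _ _ _ [::]).
Qed.

Lemma aK_central x : affine_br (aK g) x = 0.
Proof.
congr pair; first apply: laurent_ext => k /=; apply: fsbig1 => i _.
  by rewrite lbr0l.
by rewrite lfrmC linear0 mulr0.
Qed.

Lemma sing_act_level v : act (aK g) v = kappa *: v.
Proof.
have aKP : phat psi (aK g).
  by split=> // i; apply: lspan_0.
move: v; apply: ind_ext => [|b v w _ _|u]; first exact: sing_act_lin.
  by rewrite scalerDr !scalerA mulrC.
have [_ <- _ _ _] := hchi; elim: u => [|x u IH].
  by rewrite act_word -[[:: _]]/(rcons [::] (aK g)) ind_word_chi.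
rewrite -act_word sing_act_br IH aK_central -(linear_of_eq (sing_act_lin x)) linearZ.
by rewrite -[X in _ + X](linear_of_eq (sing_act_linl (word u))) linear0 addr0.
Qed.

(** On the cyclic vector smoothness is the condition on the character; it uses
    that all of [g] lies in the sum of [t] and the root spaces. The bound then
    propagates along words, since bracketing with a fixed element lowers the order
    of vanishing by a bounded amount. *)
Lemma sing_smooth v : exists N : nat, forall f : laurent g,
  (forall k : int, k < N%:Z -> f k = 0) -> act (f, 0) v = 0.
Proof.
elim: (ind_span v) => [_ [u _ <-]||a x y _ [N1 s1] _ [N2 s2]]; first last.
- exists (maxn N1 N2) => f fN; rewrite sing_act_lin // s1 ?s2 ?scaler0 ?addr0 // => k kN;
  by apply: fN; lia.
- by exists 0%N => f _; rewrite -(linear_of_eq (sing_act_lin _)) linear0.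
elim: u => [|x u [N sN]].
  exists r => f fr; rewrite act_word -[[:: _]]/(rcons [::] (f, 0)) ind_word_chi.
    by have [_ _ _ _ ->] := hchi; rewrite ?scale0r.
  split=> [k k0|i] /=; first by apply: fr; lia.
  have [ir|ri] := ltnP i r; first by rewrite fr ?ltz_nat //; apply: lspan_0.
  by have [_ _ ->] := hpsi; first exact: (psub_roots hXY hh).
have [M xM] := laurent_below x.1.
exists (N + `|M|.+1)%N => f fN; rewrite -act_word sing_act_br.
rewrite sN => [|k kN]; last by apply: fN; lia.
rewrite -(linear_of_eq (sing_act_lin x)) linear0 add0r.
have -> : affine_br (f, 0) x = (laurent_br f x.1, 0).
  congr pair; apply: fsbig1 => k _ /=.
  have [kN|Nk] := ltP k (N + `|M|.+1)%N%:Z; first by rewrite fN // lfrmC linear0 mulr0.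
  by rewrite xM ?linear0 ?mulr0 //; lia.
apply: sN => k kN /=; apply: fsbig1 => i _.
have [iN|Ni] := ltP i (N + `|M|.+1)%N%:Z; first by rewrite fN // lbr0l.
by rewrite xM ?linear0 //; lia.
Qed.

Theorem sing_module_smooth : smooth_module kappa act.
Proof.
split; [exact: sing_act_lin|exact: sing_act_linl|exact: sing_act_br|
  exact: sing_act_level|exact: sing_smooth].
Qed.

End SingularityModule.

(** * Operators on tensor products *)
Section TensorSlots.
Variables (C : numClosedFieldType) (n : nat) (M : 'I_n -> lmodType C).
Local Notation T := (tensor M).
Implicit Types (i j : 'I_n) (m : forall i, M i).

Lemma tensor_span (v : T) : lspan (range (@tpure C n M)) v.
Proof.
rewrite -(qreprK v); elim: (fmod_span (qrepr v)) => [_ [m _ <-]||a x y _ sx _ sy].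
- by apply: lspan_in; exists m.
- by rewrite linear0; apply: lspan_0.
- by rewrite linearP; apply: lspan_lin.
Qed.

Lemma tensor_ext (W : lmodType C) (F G : T -> W) : linear_on setT F -> linear_on setT G ->
  (forall m, F (tpure m) = G (tpure m)) -> forall v, F v = G v.
Proof.
move=> Fl Gl FG v; elim: (tensor_span v) => [_ [u _ <-] //||a x y _ Fx _ Fy].
  by rewrite -(linear_of_eq Fl) -(linear_of_eq Gl) !linear0.
by rewrite Fl // Gl // Fx Fy.
Qed.

Lemma dfwith_dfwith i m (u w : M i) : dfwith (dfwith m i u) i w = dfwith m i w.
Proof.
apply: functional_extensionality_dep => k.
by case: (eqVneq i k) => [ik|ik]; [subst k; rewrite !dfwithin|rewrite !dfwithout].
Qed.

Lemma dfwith_id i m : dfwith m i (m i) = m.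
Proof.
apply: functional_extensionality_dep => k.
by case: (eqVneq i k) => [ik|ik]; [subst k; rewrite dfwithin|rewrite dfwithout].
Qed.

Lemma dfwith_comm i j m (u : M i) (w : M j) : i != j ->
  dfwith (dfwith m i u) j w = dfwith (dfwith m j w) i u.
Proof.
move=> ij; apply: functional_extensionality_dep => k.
case: (eqVneq i k) => [ik|ik].
  by subst k; rewrite dfwithin dfwithout ?dfwithin // eq_sym.
rewrite [RHS]dfwithout //; case: (eqVneq j k) => [jk|jk].
  by subst k; rewrite !dfwithin.
by rewrite !dfwithout.
Qed.

Lemma slot_lin i (S : M i -> M i) : linear_on setT S -> linear_on setT (slot S).
Proof.
move=> Sl; apply: qlift_linear; first exact: fext_linear.
move=> _ [j [m [a [u [w ->]]]]].
pose F := linear_of (@fext_linear C _ T (fun m : {classic (forall i, M i)} =>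
  tpure (dfwith m i (S (m i))))).
rewrite -[fext _ _]/(F _) linearB linearP /= !fext_base.
case: (eqVneq j i) => [ji|ji].
  by subst j; rewrite !dfwith_dfwith !dfwithin Sl // tpure_linear // subrr.
by rewrite !(dfwith_comm _ _ _ ji) !(dfwithout _ _ ji) tpure_linear // subrr.
Qed.

Lemma slot_comp i (S S' : M i -> M i) : linear_on setT S -> linear_on setT S' ->
  forall v, slot S (slot S' v) = slot (S \o S') v.
Proof.
move=> Sl S'l.
have SS'l : linear_on setT (S \o S') by move=> a x y _ _ /=; rewrite S'l // Sl.
apply: tensor_ext => [a x y _ _||m]; [|exact: slot_lin|].
  by rewrite (slot_lin S'l) // (slot_lin Sl).
by rewrite (slot_pure _ S'l) (slot_pure _ Sl) (slot_pure _ SS'l) dfwithin dfwith_dfwith.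
Qed.

Lemma slot_comm i j (S : M i -> M i) (S' : M j -> M j) : i != j ->
  linear_on setT S -> linear_on setT S' ->
  forall v, slot S (slot S' v) = slot S' (slot S v).
Proof.
move=> ij Sl S'l; apply: tensor_ext => [a x y _ _|a x y _ _|m].
- by rewrite (slot_lin S'l) // (slot_lin Sl).
- by rewrite (slot_lin Sl) // (slot_lin S'l).
rewrite !(slot_pure _ S'l) !(slot_pure _ Sl) !(slot_pure _ S'l).
have ji : j != i by rewrite eq_sym.
by rewrite (dfwithout _ _ ij) (dfwithout _ _ ji) (dfwith_comm _ _ _ ij).
Qed.

Lemma slot_combine i a (S S' S'' : M i -> M i) :
  linear_on setT S -> linear_on setT S' -> (forall v, S'' v = a *: S v + S' v) ->
  forall v, slot S'' v = a *: slot S v + slot S' v.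
Proof.
move=> Sl S'l S''E.
have S''l : linear_on setT S''.
  by move=> b x y _ _; rewrite !S''E Sl // S'l // !scalerDr !scalerA [a * b]mulrC addrACA.
apply: tensor_ext => [|b x y _ _|m]; first exact: slot_lin.
  by rewrite (slot_lin Sl) // (slot_lin S'l) // !scalerDr !scalerA [a * b]mulrC addrACA.
by rewrite !slot_pure // S''E tpure_linear.
Qed.

End TensorSlots.

Section TensorSmooth.
Variables (C : numClosedFieldType) (g : quad_lie C).
Variables (h kappa : C) (hh : is_dual_coxeter g h) (kappah : kappa + h != 0).
Variables (X Y : 'I_(\dim {: g}) -> g) (hXY : dual_bases X Y).
Variables (n : nat) (r : 'I_n -> nat) (psi : 'I_n -> nat -> set (cartan_dual g)).
Hypothesis hpsi : forall i, parabolic_filtration (r i) (psi i).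
Variables (lam : forall i : 'I_n, 'I_(r i) -> g -> C^o) (chi : 'I_n -> affine g -> C^o).
Hypothesis hchi : forall i, is_singular_char (psi i) (@lam i) kappa (chi i).
Local Notation M := (Mhat psi chi).
Local Notation sact i := (@sing_act C g (psi i) (chi i)).
Local Notation MM := (fun j => sing_module (psi j) (chi j)).
Implicit Types (i j : 'I_n) (v : M).

Let sm i := sing_module_smooth hh hXY (hpsi i) (hchi i).

Theorem slot_smooth j : smooth_module kappa (@slot_act C g n psi chi j).
Proof.
have l x := act_linr (sm j) x.
have sl x := slot_lin (M := MM) (i := j) (l x).
split=> [//|v a x y _ _|x y v|v|v].
- by apply: (slot_combine (M := MM) (i := j)) => // u; apply: act_linl (sm j) _ _ _ _ _ _.
- rewrite /slot_act !(slot_comp (M := MM) (i := j)) // -[slot (sact j x \o sact j y) v]scale1r.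
  have ll x' y' : linear_on setT (sact j x' \o sact j y').
    by move=> a u w _ _ /=; rewrite (l y') // (l x').
  rewrite -[slot (sact j y \o sact j x) v]scale1r scale1r; apply: (slot_combine (M := MM) (i := j)) => // u /=.
  by rewrite scale1r; apply: act_brE (sm j) _ _ _.
- move: v; apply: tensor_ext => [|b v w _ _|m]; first exact: sl.
    by rewrite scalerDr !scalerA mulrC.
  rewrite /slot_act (slot_pure (M := MM) (i := j)) // (act_level (sm j)).
  rewrite -(linear_of_eq (tpure_linear (M := MM) (i := j) m)) linearZ /=.
  by rewrite (dfwith_id (M := MM)).
- elim: (tensor_span v) => [_ [m _ <-]||a x y _ [N1 s1] _ [N2 s2]].
  + have [N sN] := act_smooth (sm j) (m j); exists N => f fN.
    rewrite /slot_act (slot_pure (M := MM) (i := j)) // sN //.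
    exact: (linear0 (linear_of (tpure_linear (M := MM) (i := j) m))).
  + by exists 0%N => f _; rewrite [LHS](linear0 (linear_of (sl (f, 0)))).
  + exists (maxn N1 N2) => f fN.
    have -> : slot_act j (f, 0) (a *: x + y) = a *: slot_act j (f, 0) x + slot_act j (f, 0) y.
      exact: sl.
    rewrite s1 ?s2 ?scaler0 ?addr0 // => k kN;
    by apply: fN; lia.
Qed.

Lemma slot_vir_lin i : linear_on setT (slot_vir (psi := psi) (chi := chi) X Y h kappa (-1) i).
Proof. by apply: (slot_lin (M := MM) (i := i)); exact: (sugawara_lin (sm i) hXY h). Qed.

Lemma slot_vir_comm i j v :
  slot_vir X Y h kappa (-1) i (slot_vir X Y h kappa (-1) j v) =
  slot_vir X Y h kappa (-1) j (slot_vir X Y h kappa (-1) i v).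
Proof.
have [->//|ij] := eqVneq i j.
by apply: (slot_comm (M := MM)) => //; [exact: (sugawara_lin (sm i) hXY h)|exact: (sugawara_lin (sm j) hXY h)].
Qed.

(** [L_(-1)] acts on the modes of its own slot as minus the derivation along
    the coordinate, and commutes with those of the other slots. *)
Lemma slot_vir_act i j (f : laurent g) v :
  slot_vir X Y h kappa (-1) i (slot_act j (f, 0) v) =
  slot_act j (f, 0) (slot_vir X Y h kappa (-1) i v) -
  (if i == j then slot_act j (dlaurent f, 0) v else 0).
Proof.
have sl := sugawara_lin (sm i) hXY h.
have [ij|ij] := eqVneq i j; last by rewrite subr0; apply: (slot_comm (M := MM)) => //; apply: act_linr (sm j) _.
subst j; have al f' := act_linr (sm i) (f', 0).
have Vl : linear_on setT (sugawara X Y h kappa (sact i) (-1)) by [].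
rewrite /slot_vir /slot_act !(slot_comp (M := MM) (i := i)) //.
have ll : linear_on setT (sact i (f, 0) \o sugawara X Y h kappa (sact i) (-1)).
  by move=> a u w _ _ /=; rewrite Vl // al.
rewrite addrC -scaleN1r; apply: (slot_combine (M := MM) (i := i)) => // u /=.
rewrite scaleN1r; apply/eqP; rewrite -subr_eq.
by rewrite (sugawara_laurent (sm i) hXY hh kappah f u).
Qed.

End TensorSmooth.

(** * Holomorphic functions and sections *)
Section Holomorphic.
Variables (C : numClosedFieldType) (n : nat).
Local Notation pt := 'rV[C]_n.
Implicit Types (U W : set pt) (c : pt -> C^o) (t : pt) (i j : 'I_n).

Local Notation e_ i := (delta_mx ord0 i : pt).

Lemma holo_uptoW k U c : holo_upto k.+1 U c -> holo_upto k U c.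
Proof.
elim: k c => [|k IH] c [cc dc]; split=> // i.
by have [der /IH] := dc i.
Qed.

Lemma holo_upto_sub k U W c : W `<=` U -> holo_upto k U c -> holo_upto k W c.
Proof.
move=> WU; elim: k c => [|k IH] c [cc dc]; (split; first by move=> t /WU/cc) => // i.
by have [der /IH] := dc i; split=> // t /WU/der.
Qed.

Lemma holo_sub U W c : W `<=` U -> holo U c -> holo W c.
Proof. by move=> WU hc k; apply: holo_upto_sub WU (hc k). Qed.

Lemma holo_cont U c t : holo U c -> U t -> {for t, continuous c}.
Proof. by move=> /(_ 0%N)[cc _]; apply: cc. Qed.

Lemma holo_derivable U c t i : holo U c -> U t -> derivable c t (e_ i).
Proof. by move=> /(_ 1%N)[_ /(_ i)[dc _]]; apply: dc. Qed.

Lemma holo_pderiv U c i : holo U c -> holo U (pderiv i c).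
Proof. by move=> hc k; have [_ /(_ i)[]] := hc k.+1. Qed.

Lemma pderiv_ext U c c' t i : open U -> U t -> (forall u, U u -> c u = c' u) ->
  pderiv i c t = pderiv i c' t.
Proof.
move=> oU Ut cc'; apply: near_eq_derive; near=> u; apply: cc'.
by near: u; apply: open_nbhs_nbhs.
Unshelve. all: by end_near. Qed.

Lemma for_cont_ext U c c' t : open U -> U t -> (forall u, U u -> c u = c' u) ->
  {for t, continuous c} -> {for t, continuous c'}.
Proof.
move=> oU Ut cc'; rewrite /prop_for /continuous_at -(cc' t Ut) => ct.
have nE : \forall u \near t, c u = c' u.
  by near=> u; apply: cc'; near: u; apply: open_nbhs_nbhs.
by apply: cvg_trans ct; apply: near_eq_cvg nE.
Unshelve. all: by end_near. Qed.

Lemma holo_upto_ext k U c c' : open U -> (forall u, U u -> c u = c' u) ->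
  holo_upto k U c -> holo_upto k U c'.
Proof.
move=> oU; elim: k c c' => [|k IH] c c' cc' [co dc];
  (split; first by move=> t Ut; apply: for_cont_ext oU Ut cc' (co t Ut)) => // i.
have [der hd] := dc i; split=> [t Ut|].
  apply: near_eq_derivable (der t Ut); near=> u; apply: cc'.
  by near: u; apply: open_nbhs_nbhs.
by apply: IH hd => u Uu; apply: pderiv_ext cc'.
Unshelve. all: by end_near. Qed.

Lemma holo_ext U c c' : open U -> (forall u, U u -> c u = c' u) -> holo U c -> holo U c'.
Proof. by move=> oU cc' hc k; apply: holo_upto_ext cc' (hc k). Qed.

Lemma pderiv_cst (a : C) i t : pderiv i (fun=> a : C^o) t = 0.
Proof. exact: derive_cst. Qed.

Lemma holo_cst U (a : C) : holo U (fun=> a : C^o).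
Proof.
move=> k; elim: k a => [|k IH] a; (split; first by move=> t _; apply: cst_continuous) => // i.
split=> [t _|]; first exact: derivable_cst.
have -> : pderiv i (fun=> a : C^o) = (fun=> 0 : C^o).
  by apply: funext => t; apply: pderiv_cst.
exact: IH.
Qed.

Lemma pderiv_lin U c c' (a : C) i t : holo U c -> holo U c' -> U t ->
  pderiv i (fun u => a * c u + c' u : C^o) t = a * pderiv i c t + pderiv i c' t.
Proof.
move=> hc hc' Ut; rewrite /pderiv.
have dc := holo_derivable (i := i) hc Ut; have dc' := holo_derivable (i := i) hc' Ut.
have -> : (fun u => a * c u + c' u : C^o) = (a \*: c) + c' by [].
rewrite deriveD; [rewrite deriveZ; [by []|exact: dc]|exact: derivableZ|exact: dc'].
Qed.

Lemma pderivM U c c' i t : holo U c -> holo U c' -> U t ->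
  pderiv i (fun u => c u * c' u : C^o) t = c t * pderiv i c' t + c' t * pderiv i c t.
Proof.
move=> hc hc' Ut; rewrite /pderiv.
have dc := holo_derivable (i := i) hc Ut; have dc' := holo_derivable (i := i) hc' Ut.
exact: (deriveM dc dc').
Qed.

Lemma pderivV U c i t : holo U c -> U t -> c t != 0 ->
  pderiv i (fun u => (c u)^-1 : C^o) t = - pderiv i c t * (c t)^-1 ^+ 2.
Proof.
move=> hc Ut c0; have dc := holo_derivable (i := i) hc Ut.
rewrite /pderiv deriveV // /GRing.scale /= mulNr mulNr mulrC; congr (- (_ * _)).
by rewrite exprVn.
Qed.

Lemma holo_upto_lin k U c c' (a : C) : open U -> holo_upto k U c -> holo_upto k U c' ->
  holo_upto k U (fun u => a * c u + c' u : C^o).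
Proof.
move=> oU; elim: k c c' => [|k IH] c c' [co dc] [co' dc'];
  (split; first by move=> t Ut; apply: continuousD;
    [apply: continuousM; [exact: cst_continuous|exact: co]|exact: co']) => // i.
have [der hd] := dc i; have [der' hd'] := dc' i; split=> [t Ut|].
  by apply: derivableD; [apply: derivableZ; exact: der|exact: der'].
apply: holo_upto_ext (IH _ _ hd hd') => // t Ut; rewrite /pderiv.
have -> : (fun u => a * c u + c' u : C^o) = (a \*: c) + c' by [].
by rewrite deriveD ?deriveZ //; [exact: der|apply: derivableZ; exact: der|exact: der'].
Qed.

Lemma holo_lin U c c' (a : C) : open U -> holo U c -> holo U c' ->
  holo U (fun u => a * c u + c' u : C^o).
Proof. by move=> oU hc hc' k; apply: holo_upto_lin. Qed.

Lemma holo_upto_mul k U c c' : open U -> holo_upto k U c -> holo_upto k U c' ->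
  holo_upto k U (fun u => c u * c' u : C^o).
Proof.
move=> oU; elim: k c c' => [|k IH] c c' hc hc'; have [co dc] := hc; have [co' dc'] := hc';
  (split; first by move=> t Ut; apply: continuousM; [exact: co|exact: co']) => // i.
have [der hd] := dc i; have [der' hd'] := dc' i; split=> [t Ut|].
  by apply: derivableM; [exact: der|exact: der'].
have h1 := IH _ _ (holo_uptoW hc) hd'; have h2 := IH _ _ (holo_uptoW hc') hd.
apply: holo_upto_ext (holo_upto_lin 1 oU h1 h2) => // t Ut.
by rewrite mul1r /pderiv (deriveM (der t Ut) (der' t Ut)).
Qed.

Lemma holo_mul U c c' : open U -> holo U c -> holo U c' -> holo U (fun u => c u * c' u : C^o).
Proof. by move=> oU hc hc' k; apply: holo_upto_mul. Qed.

Lemma holo_exp U c m : open U -> holo U c -> holo U (fun u => c u ^+ m : C^o).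
Proof.
move=> oU hc; elim: m => [|m IH]; first exact: holo_cst.
apply: holo_ext (holo_mul oU hc IH) => // u _; by rewrite exprS.
Qed.

Lemma holo_inv U c : open U -> (forall t, U t -> c t != 0) -> holo U c ->
  holo U (fun u => (c u)^-1 : C^o).
Proof.
move=> oU c0 hc; elim=> [|k IH];
  (split; first by move=> t Ut; apply: continuousV; [exact: c0|exact: holo_cont hc Ut]) => // i.
split=> [t Ut|]; first by apply: derivableV; [exact: c0|exact: holo_derivable hc Ut].
have h1 := holo_upto_mul oU (holo_pderiv i hc k) (holo_upto_mul oU IH IH).
apply: holo_upto_ext (holo_upto_mul oU (holo_cst U (-1) k) h1) => // t Ut.
by rewrite (pderivV i hc Ut (c0 t Ut)) mulN1r mulNr expr2.
Qed.

Lemma coord_cont i : continuous (fun u : pt => u ord0 i : C^o).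
Proof. by move=> u; apply: coord_continuous. Qed.

Lemma coord_growth i j t : (fun h : C => h^-1 *: ((h *: e_ i + t) ord0 j - t ord0 j : C^o)) @ 0^'
   --> ((i == j)%:R : C^o).
Proof.
apply: cvg_near_cst; near=> a; rewrite !mxE addrK eqxx eq_sym.
by rewrite /GRing.scale /= mulrA mulVf ?mul1r //; near: a; apply: nbhs_dnbhs_neq.
Unshelve. all: by end_near. Qed.

Lemma pderiv_coord i j t : pderiv i (fun u => u ord0 j : C^o) t = (i == j)%:R.
Proof. by apply: (@cvg_lim C^o); [exact: norm_hausdorff|exact: (@coord_growth i j t)]. Qed.

Lemma holo_coord U j : open U -> holo U (fun u => u ord0 j : C^o).
Proof.
move=> oU; elim=> [|k IH]; (split; first by move=> t _; apply: coord_cont) => // i.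
split=> [t _|]; first by apply/cvg_ex; exists (i == j)%:R; apply: coord_growth.
by apply: holo_upto_ext (holo_cst U (i == j)%:R k) => // t _; rewrite pderiv_coord.
Qed.

Lemma holo_sum U (I : Type) (r : seq I) (P : pred I) (F : I -> pt -> C^o) : open U ->
  (forall a, holo U (F a)) -> holo U (fun u => \sum_(a <- r | P a) F a u : C^o).
Proof.
move=> oU hF; elim: r => [|a r IH].
  by apply: holo_ext (holo_cst U 0) => // u _; rewrite big_nil.
have hFa : holo U (fun u => (if P a then 1 else 0) * F a u + \sum_(b <- r | P b) F b u : C^o).
  by apply: holo_lin.
apply: holo_ext hFa => // u _; rewrite big_cons; case: ifP => _; first by rewrite mul1r.
by rewrite mul0r add0r.
Qed.

Lemma pderiv_sum U (I : Type) (r : seq I) (P : pred I) (F : I -> pt -> C^o) i t : open U -> U t ->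
  (forall a, holo U (F a)) ->
  pderiv i (fun u => \sum_(a <- r | P a) F a u : C^o) t = \sum_(a <- r | P a) pderiv i (F a) t.
Proof.
move=> oU Ut hF; elim: r => [|a r IH].
  rewrite big_nil -[RHS](pderiv_cst 0 i t); apply: (pderiv_ext i oU Ut) => u _.
  by rewrite big_nil.
rewrite big_cons -IH.
have E : pderiv i (fun u => (if P a then 1 else 0) * F a u + \sum_(b <- r | P b) F b u : C^o) t =
    (if P a then 1 else 0) * pderiv i (F a) t + pderiv i (fun u => \sum_(b <- r | P b) F b u : C^o) t.
  by apply: pderiv_lin Ut; [exact: hF|exact: holo_sum].
transitivity (pderiv i (fun u => (if P a then 1 else 0) * F a u + \sum_(b <- r | P b) F b u : C^o) t).
  apply: pderiv_ext oU Ut _ => u _; rewrite big_cons; case: ifP => _; first by rewrite mul1r.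
  by rewrite mul0r add0r.
by rewrite E; case: ifP => _; rewrite ?mul1r ?mul0r ?add0r.
Qed.

End Holomorphic.

Section ComplexReal.
Variable R : realType.
Local Notation C := (cplx R).

(** A real linear functional of norm at most one; the real and the imaginary part
    are treated uniformly. *)
Definition real_functional (phi : C -> R) :=
  [/\ forall x y, phi (x - y) = phi x - phi y,
      forall (a : R) z, phi ((a%:C)%C * z) = a * phi z &
      forall z, ((`|phi z|)%:C)%C <= `|z|].

Lemma real_functional_Re : real_functional (@complex.Re R).
Proof.
split=> [[a b] [c d]//|a [x y]|z]; last exact: normc_ge_Re.
by rewrite /= mul0r subr0.
Qed.

Lemma real_functional_Im : real_functional (@complex.Im R).
Proof.
split=> [[a b] [c d]//|a [x y]|[x y]].
  by rewrite /= mul0r addr0.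
rewrite normc_def lecR /= -sqrtr_sqr ler_wsqrtr // lerDr sqr_ge0 //.
Qed.

Lemma cplx_pos (e : C) : 0 < e -> exists2 r : R, 0 < r & e = (r%:C)%C.
Proof.
move=> e0; exists (complex.Re e); last by rewrite RRe_real // gtr0_real.
by rewrite -ltcR RRe_real // gtr0_real.
Qed.

Lemma cplx_norm_real (x : R) : `|(x%:C)%C : C| = (`|x|%:C)%C.
Proof. by rewrite normc_def /= expr0n /= addr0 sqrtr_sqr. Qed.

Lemma real_functional_cvg (phi : C -> R) T (F : set_system T) {FF : Filter F} (f : T -> C^o) (y : C) :
  real_functional phi -> f @ F --> (y : C^o) -> phi \o f @ F --> (phi y : R^o).
Proof.
move=> [phiB _ phin] fy; apply/cvgrPdist_lt => e e0.
have e0' : 0 < (e%:C)%C :> C by rewrite ltcR.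
move/cvgrPdist_lt : fy => /(_ _ e0'); apply: filterS => x /= xe.
by rewrite -phiB -ltcR; apply: le_lt_trans xe; apply: phin.
Qed.

Lemma real_dnbhs : (fun x : R => (x%:C)%C : C) @ 0^' `=>` (0 : C)^'.
Proof.
move=> A /= [e e0 eA]; have [r r0 er] := cplx_pos e0.
exists r => //= x /=; rewrite sub0r normrN => xr x0; apply: eA.
  by rewrite /= sub0r normrN cplx_norm_real er ltcR.
by apply: contra x0 => /eqP[->].
Qed.

Section Schwarz.
Variables (n : nat).
Local Notation pt := 'rV[C]_n.
Implicit Types (U : set pt) (c : pt -> C^o) (t : pt) (i j : 'I_n).
Local Notation e_ i := (delta_mx ord0 i : pt).
Variables (phi : C -> R) (phiP : real_functional phi).

Lemma line_derive c t v x : derivable c (t + (x%:C)%C *: v) v ->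
  is_derive x 1 (fun y : R => phi (c (t + (y%:C)%C *: v)) : R^o) (phi ('D_v c (t + (x%:C)%C *: v))).
Proof.
move=> dc; have [phiB phiZ phin] := phiP.
have H : (fun k : R => k^-1 *: (phi (c (t + ((k *: 1 + x)%:C)%C *: v))
     - phi (c (t + (x%:C)%C *: v)) : R^o)) @ 0^' --> (phi ('D_v c (t + (x%:C)%C *: v)) : R^o).
  have Hc := real_functional_cvg phiP (cvg_comp _ _ real_dnbhs dc).
  suff -> : (fun k : R => k^-1 *: (phi (c (t + ((k *: 1 + x)%:C)%C *: v))
      - phi (c (t + (x%:C)%C *: v)) : R^o)) =
    phi \o ((fun h : C => h^-1 *: (c (h *: v + (t + (x%:C)%C *: v)) - c (t + (x%:C)%C *: v))) \o
      (fun x : R => (x%:C)%C)) by exact: Hc.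
  apply: funext => k /=; rewrite [in RHS]/GRing.scale /= -fmorphV phiZ phiB.
  congr (_ * (phi (c _) - _)).
  by rewrite addrCA -scalerDl /GRing.scale /= mulr1 rmorphD.
apply: DeriveDef; first by apply/cvg_ex; eexists; exact: H.
by apply: (@cvg_lim R^o); [exact: norm_hausdorff|exact: H].
Unshelve. all: by end_near. Qed.

(** The mean value theorem, applied first along [e_ i] and then along [e_ j]. *)
Lemma mixed_difference U c t i j (s : R) : holo U c -> 0 < s ->
  (forall x y : R, 0 <= x <= s -> 0 <= y <= s ->
     U (t + (x%:C)%C *: e_ i + (y%:C)%C *: e_ j)) ->
  exists x y : R, [/\ 0 <= x <= s, 0 <= y <= s &
   phi (c (t + (s%:C)%C *: e_ i + (s%:C)%C *: e_ j)) - phi (c (t + (s%:C)%C *: e_ i))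
   - phi (c (t + (s%:C)%C *: e_ j)) + phi (c t) =
   phi (pderiv j (pderiv i c) (t + (x%:C)%C *: e_ i + (y%:C)%C *: e_ j)) * s * s].
Proof.
move=> hc s0 PU; have [phiB phiZ phin] := phiP.
have Us x : 0 <= x <= s -> U (t + (s%:C)%C *: e_ j + (x%:C)%C *: e_ i).
  by move=> xs; rewrite addrAC; apply: PU; rewrite // ltW // lexx.
have U0 x : 0 <= x <= s -> U (t + (x%:C)%C *: e_ i).
  by move=> xs; rewrite -[_ + _]addr0 -(scale0r (e_ j)); apply: PU; rewrite // lexx ltW.
pose f (x : R) : R^o := phi (c (t + (s%:C)%C *: e_ j + (x%:C)%C *: e_ i))
   - phi (c (t + (x%:C)%C *: e_ i)).
pose df (x : R) : R := phi (pderiv i c (t + (s%:C)%C *: e_ j + (x%:C)%C *: e_ i))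
   - phi (pderiv i c (t + (x%:C)%C *: e_ i)).
have fd x : 0 <= x <= s -> is_derive x 1 f (df x).
  move=> xs; apply: is_deriveB; apply: line_derive; apply: holo_derivable hc _.
    exact: Us.
  exact: U0.
have fcont : {within `[0, s], continuous f}.
  apply: derivable_within_continuous => x; rewrite in_itv /= => /fd dfx.
  exact: ex_derive.
have [x xs Ex] := MVT s0 (fun x xs => fd x (subset_itv_oo_cc xs)) fcont.
have {}xs : 0 <= x <= s by move: xs; rewrite in_itv /= => /andP[/ltW-> /ltW->].
pose k (y : R) : R^o := phi (pderiv i c (t + (x%:C)%C *: e_ i + (y%:C)%C *: e_ j)).
pose dk (y : R) : R := phi (pderiv j (pderiv i c) (t + (x%:C)%C *: e_ i + (y%:C)%C *: e_ j)).
have kd y : 0 <= y <= s -> is_derive y 1 k (dk y).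
  move=> ys; apply: line_derive; apply: (holo_derivable (holo_pderiv i hc)).
  exact: PU.
have kcont : {within `[0, s], continuous k}.
  apply: derivable_within_continuous => y; rewrite in_itv /= => /kd dky.
  exact: ex_derive.
have [y ys Ey] := MVT s0 (fun y ys => kd y (subset_itv_oo_cc ys)) kcont.
have {}ys : 0 <= y <= s by move: ys; rewrite in_itv /= => /andP[/ltW-> /ltW->].
exists x, y; split=> //.
have z0 (v : pt) : ((0 : R)%:C)%C *: v = 0 by rewrite rmorph0 scale0r.
have Edf : df x = dk y * s.
  transitivity (k s - k 0); last by rewrite Ey subr0.
  have p0 : t + (x%:C)%C *: e_ i = t + (x%:C)%C *: e_ i + ((0 : R)%:C)%C *: e_ j.
    by rewrite (z0 (e_ j)) addr0.
  have ps : t + (s%:C)%C *: e_ j + (x%:C)%C *: e_ i = t + (x%:C)%C *: e_ i + (s%:C)%C *: e_ j.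
    exact: addrAC.
  exact (f_equal2 (fun a b => phi (pderiv i c a) - phi (pderiv i c b)) ps p0).
transitivity (f s - f 0); first by rewrite /f z0 !addr0 opprB addrA addrAC [t + _ + _]addrAC.
by rewrite Ex subr0 Edf.
Qed.

Lemma mixed_pderiv_phi U c t i j : open U -> holo U c -> U t ->
  phi (pderiv j (pderiv i c) t) = phi (pderiv i (pderiv j c) t).
Proof.
move=> oU hc Ut; have [phiB phiZ phin] := phiP.
have dcont a b : {for t, continuous (pderiv a (pderiv b c))}.
  by apply: holo_cont Ut; do 2!apply: holo_pderiv.
have close a b (e : R) : 0 < e -> \forall q \near t,
    `|phi (pderiv a (pderiv b c) t) - phi (pderiv a (pderiv b c) q)| < e.
  move=> e0; have H : phi \o pderiv a (pderiv b c) @ t --> (phi (pderiv a (pderiv b c) t) : R^o).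
    exact: (real_functional_cvg phiP (dcont a b)).
  by move/cvgrPdist_lt: H => /(_ _ e0).
apply/eqP; rewrite -subr_eq0 -normr_le0; apply/ler_addgt0Pr => e e0.
have e20 : 0 < e / 2 by rewrite divr_gt0.
have : \forall q \near t, [/\ U q,
    `|phi (pderiv j (pderiv i c) t) - phi (pderiv j (pderiv i c) q)| < e / 2 &
    `|phi (pderiv i (pderiv j c) t) - phi (pderiv i (pderiv j c) q)| < e / 2].
  have h1 : \forall q \near t, U q by apply: open_nbhs_nbhs.
  have h2 := close j i (e / 2) e20; have h3 := close i j (e / 2) e20.
  by apply: filterS3 h1 h2 h3 => q; apply: And3.
move=> /nbhs_ballP[d d0 dQ]; have [r r0 dr] := cplx_pos d0.
pose s := r / 4; have s0 : 0 < s by rewrite divr_gt0.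
have near_t k l x y : 0 <= x <= s -> 0 <= y <= s ->
    ball t d (t + (x%:C)%C *: e_ k + (y%:C)%C *: e_ l).
  move=> /andP[x0 xs] /andP[y0 ys]; rewrite dr; split=> [|a b]; first by rewrite ltcR.
  rewrite /ball /= !mxE.
  rewrite -addrA opprD addrA subrr add0r normrN.
  apply: le_lt_trans (_ : ((x + y)%:C)%C < _).
    rewrite rmorphD; apply: le_trans (ler_normD _ _) _.
    have bnd (z : R) (q : bool) : 0 <= z -> `|(z%:C)%C * q%:R : C| <= (z%:C)%C.
      by move=> z0; case: q; rewrite ?mulr1 ?mulr0 ?normr0 ?cplx_norm_real ?ger0_norm // ler0c.
    by apply: lerD; apply: bnd.
  by rewrite ltcR; apply: le_lt_trans (lerD xs ys) _; rewrite /s; lra.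
have PU k l x y : 0 <= x <= s -> 0 <= y <= s -> U (t + (x%:C)%C *: e_ k + (y%:C)%C *: e_ l).
  by move=> xs ys; have /dQ[] := near_t k l x y xs ys.
have [x [y [xs ys E1]]] := mixed_difference hc s0 (PU i j).
have [x' [y' [xs' ys' E2]]] := mixed_difference hc s0 (PU j i).
have /dQ[_ b1 _] := near_t i j x y xs ys.
have /dQ[_ _ b2] := near_t j i x' y' xs' ys'.
have symm (a a' b b' w : R) : a = a' -> a - b - b' + w = a' - b' - b + w.
  by move=> ->; rewrite [a' - b - _]addrAC.
have EP : phi (c (t + (s%:C)%C *: e_ i + (s%:C)%C *: e_ j)) =
    phi (c (t + (s%:C)%C *: e_ j + (s%:C)%C *: e_ i)).
  by congr (phi (c _)); apply: addrAC.
have E : phi (pderiv j (pderiv i c) (t + (x%:C)%C *: e_ i + (y%:C)%C *: e_ j)) =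
         phi (pderiv i (pderiv j c) (t + (x'%:C)%C *: e_ j + (y'%:C)%C *: e_ i)).
  apply: (mulIf (lt0r_neq0 s0)); apply: (mulIf (lt0r_neq0 s0)).
  apply: (etrans (esym E1)); apply: (etrans _ E2); exact: symm EP.
have fin (u v w w' : R) : w = w' -> `|u - w| < e / 2 -> `|v - w'| < e / 2 ->
    `|u - v| <= 0 + e.
  clear; move=> <-; rewrite !ltr_norml ler_norml add0r => /andP[u1 u2] /andP[v1 v2].
  by apply/andP; split; lra.
exact: fin E b1 b2.
Qed.

End Schwarz.

Lemma mixed_pderiv n (U : set 'rV[C]_n) (c : 'rV[C]_n -> C^o) t (i j : 'I_n) :
  open U -> holo U c -> U t ->
  pderiv j (pderiv i c) t = pderiv i (pderiv j c) t.
Proof.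
move=> oU hc Ut.
have ext (z w : R[i]) : complex.Re z = complex.Re w -> complex.Im z = complex.Im w -> z = w.
  by case: z w => a b [a' b'] /= -> ->.
exact: (ext _ _ (mixed_pderiv_phi real_functional_Re i j oU hc Ut)
  (mixed_pderiv_phi real_functional_Im i j oU hc Ut)).
Qed.

End ComplexReal.

Section Sections.
Variables (C : numClosedFieldType) (n : nat).
Local Notation pt := 'rV[C]_n.
Implicit Types (U W : set pt) (t : pt) (i j : 'I_n).

Section OneBundle.
Variable V : lmodType C.
Implicit Types (s : pt -> V).

(** The derivative of a combination is determined by the combination: linearly
    dependent vectors are eliminated one at a time, and the coefficients of
    independent vectors are determined. *)
Lemma decomp0_pderiv W k (d : 'I_k -> pt -> C^o) (e : 'I_k -> V) i t : open W -> W t ->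
  (forall a, holo W (d a)) -> (forall u, W u -> \sum_a d a u *: e a = 0) ->
  \sum_a pderiv i (d a) t *: e a = 0.
Proof.
move=> oW Wt; elim: k d e => [|k IH] d e hd d0; first by rewrite big_ord0.
have [[x x0 [a xa]]|indep] := pselect (exists2 x : 'I_k.+1 -> C, \sum_b x b *: e b = 0 & exists a, x a != 0).
  pose q b : C := - (x b / x a).
  pose d' b : pt -> C^o := fun u => q b * d a u + d b u.
  have hd' b : holo W (d' b) by apply: holo_lin.
  have lin (y : 'I_k.+1 -> C) : \sum_b (q b * y a + y b) *: e b = \sum_b y b *: e b.
    under eq_bigr do rewrite scalerDl.
    rewrite big_split /= (eq_bigr (fun b => (- (y a / x a)) *: (x b *: e b))).
      by rewrite -scaler_sumr x0 scaler0 add0r.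
    by move=> b _; rewrite scalerA /q; congr (_ *: _); ring.
  have qa y : q a * y + y = 0 by rewrite /q divff // mulN1r addNr.
  have dE b : pderiv i (d' b) t = q b * pderiv i (d a) t + pderiv i (d b) t.
    exact: pderiv_lin.
  rewrite -(lin (fun b => pderiv i (d b) t)) (bigD1_ord a) //= qa scale0r add0r.
  rewrite -[RHS](IH (fun b => d' (lift a b)) (fun b => e (lift a b))) => [|b|u /d0].
  - by apply: eq_bigr => b _; rewrite dE.
  - exact: hd'.
  - by rewrite -(lin (fun b => d b u)) (bigD1_ord a) //= qa scale0r add0r.
rewrite big1 // => b _; suff -> : pderiv i (d b) t = 0 by rewrite scale0r.
rewrite -[RHS](pderiv_cst 0 i t); apply: (pderiv_ext i oW Wt) => u Wu.
apply/eqP; apply: contra_notT indep => db; exists (fun b => d b u); first exact: d0.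
by exists b.
Qed.

Lemma decomp_sub W W' k (c : 'I_k -> pt -> C^o) (e : 'I_k -> V) s : W' `<=` W ->
  decomp W c e s -> decomp W' c e s.
Proof.
by move=> W'W [hc sE]; split=> [a|t /W'W]; [apply: holo_sub W'W (hc a)|apply: sE].
Qed.

Lemma decomp_eq_pderiv W k (c : 'I_k -> pt -> C^o) (e : 'I_k -> V) k' (c' : 'I_k' -> pt -> C^o) e' s i t :
  open W -> W t -> decomp W c e s -> decomp W c' e' s ->
  \sum_a pderiv i (c a) t *: e a = \sum_a pderiv i (c' a) t *: e' a.
Proof.
move=> oW Wt [hc sE] [hc' sE'].
pose d (a : 'I_(k + k')) : pt -> C^o :=
  match fintype.split a with inl a => c a | inr a => fun u => -1 * c' a u + 0 : C^o end.
pose f (a : 'I_(k + k')) := match fintype.split a with inl a => e a | inr a => e' a end.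
have hd a : holo W (d a).
  by rewrite /d; case: (fintype.split a) => b //; apply: holo_lin => //; apply: holo_cst.
have dl a : d (lshift k' a) = c a by rewrite /d -[lshift _ _]/(fintype.unsplit (inl a)) fintype.unsplitK.
have dr a : d (rshift k a) = (fun u => -1 * c' a u + 0 : C^o).
  by rewrite /d -[rshift _ _]/(fintype.unsplit (inr a)) fintype.unsplitK.
have fl a : f (lshift k' a) = e a by rewrite /f -[lshift _ _]/(fintype.unsplit (inl a)) fintype.unsplitK.
have fr a : f (rshift k a) = e' a by rewrite /f -[rshift _ _]/(fintype.unsplit (inr a)) fintype.unsplitK.
have H := @decomp0_pderiv W _ d f i t oW Wt hd.
apply/eqP; rewrite -subr_eq0 -[X in _ == X]H => [|u Wu]; rewrite big_split_ord /=.
  apply/eqP; rewrite -sumrN; congr (_ + _); apply: eq_bigr => a _; first by rewrite dl fl.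
  rewrite dr fr (pderiv_lin (-1) i (hc' a) (holo_cst _ 0) Wt) pderiv_cst.
  by rewrite addr0 mulN1r scaleNr.
rewrite -[RHS](subrr (s u)) {1}(sE u Wu) (sE' u Wu) -sumrN.
congr (_ + _); apply: eq_bigr => a _; first by rewrite dl fl.
by rewrite dr fr addr0 mulN1r scaleNr.
Qed.

Lemma vpderivE W k (c : 'I_k -> pt -> C^o) (e : 'I_k -> V) s i t :
  open W -> W t -> decomp W c e s -> vpderiv i s t = \sum_a pderiv i (c a) t *: e a.
Proof.
move=> oW Wt dec; rewrite /vpderiv; case: xgetP => [v _|/(_ (\sum_a pderiv i (c a) t *: e a))[]].
  move=> [W' [oW' W't [k' [c' [e' [dec' ->]]]]]].
  have oWW' : open (W `&` W') by apply: openI.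
  apply: (@decomp_eq_pderiv (W `&` W') _ _ _ _ _ _ s) => //.
    by apply: decomp_sub dec' => ? [].
  by apply: decomp_sub dec => ? [].
by exists W; split=> //; exists k, c, e.
Qed.

Lemma lsec_local U s : (forall t, U t -> exists W, [/\ open W, W t & lsec W s]) -> lsec U s.
Proof.
move=> sl t /sl[W [oW Wt /(_ t Wt)[W' [oW' W't [k [c [e dec]]]]]]].
by exists W'; split=> //; exists k, c, e.
Qed.

Lemma lsec_sub U W s : W `<=` U -> lsec U s -> lsec W s.
Proof. by move=> WU sl t /WU/sl. Qed.

Lemma decomp_lsec U W k (c : 'I_k -> pt -> C^o) (e : 'I_k -> V) s :
  open W -> U `<=` W -> decomp W c e s -> lsec U s.
Proof. by move=> oW UW dec t /UW Wt; exists W; split=> //; exists k, c, e. Qed.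

Lemma lsec_ext U s s' : open U -> (forall u, U u -> s u = s' u) -> lsec U s -> lsec U s'.
Proof.
move=> oU ss' sl t Ut; have [W [oW Wt [k [c [e [hc sE]]]]]] := sl t Ut.
exists (U `&` W); split=> //; first exact: openI.
exists k, c, e; split=> [a|u [Uu Wu]]; first by apply: holo_sub (hc a) => ? [].
by rewrite -ss' // sE.
Qed.

Lemma vpderiv_ext U s s' i t : open U -> U t -> lsec U s -> (forall u, U u -> s u = s' u) ->
  vpderiv i s t = vpderiv i s' t.
Proof.
move=> oU Ut sl ss'; have [W [oW Wt [k [c [e dec]]]]] := sl t Ut.
rewrite (vpderivE i oW Wt dec).
have oUW : open (U `&` W) by apply: openI.
have dec' : decomp (U `&` W) c e s'.
  case: dec => hc sE; split=> [a|u [Uu Wu]]; first by apply: holo_sub (hc a) => ? [].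
  by rewrite -ss' // sE.
by rewrite (vpderivE i oUW _ dec').
Qed.

Lemma decomp_cst W (v : V) :
  decomp W (fun _ : 'I_1 => fun=> 1 : C^o) (fun=> v) (fun=> v).
Proof. by split=> [_|t _]; [apply: holo_cst|rewrite big_ord1 scale1r]. Qed.

Lemma lsec_cst U (v : V) : lsec U (fun=> v).
Proof. exact: decomp_lsec openT (@subsetT _ _) (decomp_cst _ _). Qed.

Lemma vpderiv_cst (v : V) i t : vpderiv i (fun=> v) t = 0.
Proof.
by rewrite (vpderivE i openT _ (decomp_cst setT v)) // big_ord1 pderiv_cst scale0r.
Qed.

Lemma lsec_vpderiv U s i : lsec U s -> lsec U (vpderiv i s).
Proof.
move=> sl t Ut; have [W [oW Wt [k [c [e dec]]]]] := sl t Ut.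
exists W; split=> //; exists k, (fun a => pderiv i (c a)), e; split=> [a|u Wu].
  by apply: holo_pderiv; case: dec.
exact: vpderivE dec.
Qed.

End OneBundle.

(** Sections and their derivatives are compatible with any bilinear pairing of the
    fibres: this one lemma covers sums, products by functions and the action of
    sections of Lie algebras. *)
Section Bilinear.
Variables (V1 V2 V3 : lmodType C) (B : V1 -> V2 -> V3).
Hypotheses (Bl : forall y, linear_on setT (B^~ y)) (Br : forall x, linear_on setT (B x)).

Lemma decomp_bilinear W k (c : 'I_k -> pt -> C^o) e s k' (c' : 'I_k' -> pt -> C^o) e' s' :
  open W -> decomp W c e s -> decomp W c' e' s' ->
  decomp W (fun a : 'I_#|{: 'I_k * 'I_k'}| => fun u =>
      c (enum_val a).1 u * c' (enum_val a).2 u : C^o)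
    (fun a => B (e (enum_val a).1) (e' (enum_val a).2)) (fun u => B (s u) (s' u)).
Proof.
move=> oW [hc sE] [hc' sE']; split=> [a|u Wu]; first exact: holo_mul.
rewrite sE // sE' // (linear_on_sumZ (Bl _)).
under eq_bigr do rewrite (linear_on_sumZ (Br _)) scaler_sumr.
rewrite pair_bigA /= (reindex (@enum_val _ predT)) /=; last first.
  by apply: (onW_bij _ (@enum_val_bij _)).
by apply: eq_bigr => a _; rewrite scalerA.
Qed.

Lemma lsec_bilinear U s s' : lsec U s -> lsec U s' -> lsec U (fun u => B (s u) (s' u)).
Proof.
move=> sl sl' t Ut; have [W [oW Wt [k [c [e dec]]]]] := sl t Ut.
have [W' [oW' W't [k' [c' [e' dec']]]]] := sl' t Ut.
have oWW' : open (W `&` W') by apply: openI.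
exists (W `&` W'); split=> //.
do 3!eexists; apply: (decomp_bilinear oWW').
  by apply: decomp_sub dec => ? [].
by apply: decomp_sub dec' => ? [].
Qed.

Lemma vpderiv_bilinear U s s' i t : U t -> lsec U s -> lsec U s' ->
  vpderiv i (fun u => B (s u) (s' u)) t = B (vpderiv i s t) (s' t) + B (s t) (vpderiv i s' t).
Proof.
move=> Ut sl sl'; have [W0 [oW0 W0t [k [c [e dec0]]]]] := sl t Ut.
have [W' [oW' W't [k' [c' [e' dec0']]]]] := sl' t Ut.
pose W := W0 `&` W'; have oW : open W by apply: openI.
have Wt : W t by [].
have dec : decomp W c e s by apply: decomp_sub dec0 => ? [].
have dec' : decomp W c' e' s' by apply: decomp_sub dec0' => ? [].
rewrite (vpderivE i oW Wt dec) (vpderivE i oW Wt dec').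
rewrite (vpderivE i oW Wt (decomp_bilinear oW dec dec')).
have [hc sE] := dec; have [hc' sE'] := dec'.
rewrite sE // sE' // !(linear_on_sumZ (Bl _)).
under [X in _ = X + _]eq_bigr do rewrite (linear_on_sumZ (Br _)) scaler_sumr.
under [X in _ = _ + X]eq_bigr do rewrite (linear_on_sumZ (Br _)) scaler_sumr.
rewrite -big_split /=; under [RHS]eq_bigr do rewrite -big_split /=.
rewrite pair_bigA /= [RHS](reindex (@enum_val _ predT)) /=; last first.
  by apply: (onW_bij _ (@enum_val_bij _)).
apply: eq_bigr => a _; rewrite (pderivM i (hc _) (hc' _) Wt) !scalerA -scalerDl.
by congr (_ *: _); rewrite addrC [X in X + _]mulrC.
Qed.

End Bilinear.
End Sections.

Section SectionOperations.
Variables (C : numClosedFieldType) (n : nat).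
Local Notation pt := 'rV[C]_n.
Implicit Types (U W : set pt) (t : pt) (i j : 'I_n).

Section Linear.
Variables (V1 V2 : lmodType C) (T : V1 -> V2) (Tl : linear_on setT T).

Lemma decomp_linear W k (c : 'I_k -> pt -> C^o) (e : 'I_k -> V1) s :
  decomp W c e s -> decomp W c (fun a => T (e a)) (fun u => T (s u)).
Proof. by move=> [hc sE]; split=> // u Wu; rewrite sE // (linear_on_sumZ Tl). Qed.

Lemma lsec_linear U s : lsec U s -> lsec U (fun u => T (s u)).
Proof.
move=> sl t Ut; have [W [oW Wt [k [c [e dec]]]]] := sl t Ut.
by exists W; split=> //; do 3!eexists; apply: decomp_linear dec.
Qed.

Lemma vpderiv_linear U s i t : U t -> lsec U s ->
  vpderiv i (fun u => T (s u)) t = T (vpderiv i s t).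
Proof.
move=> Ut sl; have [W [oW Wt [k [c [e dec]]]]] := sl t Ut.
rewrite (vpderivE i oW Wt dec) (vpderivE i oW Wt (decomp_linear dec)).
by rewrite (linear_on_sumZ Tl).
Qed.

End Linear.

Section Add.
Variable V : lmodType C.
Implicit Types (s : pt -> V).

Lemma decompD W k (c : 'I_k -> pt -> C^o) (e : 'I_k -> V) s k' (c' : 'I_k' -> pt -> C^o) e' s' :
  decomp W c e s -> decomp W c' e' s' ->
  decomp W (fun a => match fintype.split a with inl b => c b | inr b => c' b end)
    (fun a => match fintype.split a with inl b => e b | inr b => e' b end)
    (fun u => s u + s' u).
Proof.
move=> [hc sE] [hc' sE']; split=> [a|u Wu]; first by case: (fintype.split a).
rewrite sE // sE' // big_split_ord /=; congr (_ + _); apply: eq_bigr => a _.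
  by rewrite -[lshift _ _]/(fintype.unsplit (inl a)) fintype.unsplitK.
by rewrite -[rshift _ _]/(fintype.unsplit (inr a)) fintype.unsplitK.
Qed.

Lemma lsecD U s s' : lsec U s -> lsec U s' -> lsec U (fun u => s u + s' u).
Proof.
move=> sl sl' t Ut; have [W0 [oW0 W0t [k [c [e dec0]]]]] := sl t Ut.
have [W' [oW' W't [k' [c' [e' dec0']]]]] := sl' t Ut.
exists (W0 `&` W'); split=> //; first exact: openI.
do 3!eexists; apply: decompD; first by apply: decomp_sub dec0 => ? [].
by apply: decomp_sub dec0' => ? [].
Qed.

Lemma vpderivD U s s' i t : U t -> lsec U s -> lsec U s' ->
  vpderiv i (fun u => s u + s' u) t = vpderiv i s t + vpderiv i s' t.
Proof.
move=> Ut sl sl'; have [W0 [oW0 W0t [k [c [e dec0]]]]] := sl t Ut.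
have [W' [oW' W't [k' [c' [e' dec0']]]]] := sl' t Ut.
pose W := W0 `&` W'; have oW : open W by apply: openI.
have Wt : W t by [].
have dec : decomp W c e s by apply: decomp_sub dec0 => ? [].
have dec' : decomp W c' e' s' by apply: decomp_sub dec0' => ? [].
rewrite (vpderivE i oW Wt dec) (vpderivE i oW Wt dec') (vpderivE i oW Wt (decompD dec dec')).
rewrite big_split_ord /=; congr (_ + _); apply: eq_bigr => a _.
  by rewrite -[lshift _ _]/(fintype.unsplit (inl a)) fintype.unsplitK.
by rewrite -[rshift _ _]/(fintype.unsplit (inr a)) fintype.unsplitK.
Qed.

Lemma scale_linear_on (a : C) : linear_on setT (fun v : V => a *: v).
Proof. by move=> b x y _ _; rewrite scalerDr !scalerA mulrC. Qed.

Lemma lsecZ U a s : lsec U s -> lsec U (fun u => a *: s u).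
Proof. exact: lsec_linear (scale_linear_on a) _ _. Qed.

Lemma vpderivZ U a s i t : U t -> lsec U s ->
  vpderiv i (fun u => a *: s u) t = a *: vpderiv i s t.
Proof. exact: vpderiv_linear (scale_linear_on a) _ _ _ _. Qed.

Lemma lsec_sum U (I : Type) (r : seq I) (F : I -> pt -> V) :
  (forall a, lsec U (F a)) -> lsec U (fun u => \sum_(a <- r) F a u).
Proof.
move=> hF; elim: r => [|a r IH].
  have -> : (fun u => \sum_(a <- [::]) F a u) = (fun=> 0).
    by apply: funext => u; rewrite big_nil.
  exact: lsec_cst.
have -> : (fun u => \sum_(b <- a :: r) F b u) = (fun u => F a u + \sum_(b <- r) F b u).
  by apply: funext => u; rewrite big_cons.
exact: lsecD.
Qed.

Lemma vpderiv_sum U (I : Type) (r : seq I) (F : I -> pt -> V) i t : U t ->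
  (forall a, lsec U (F a)) ->
  vpderiv i (fun u => \sum_(a <- r) F a u) t = \sum_(a <- r) vpderiv i (F a) t.
Proof.
move=> Ut hF; elim: r => [|a r IH].
  have -> : (fun u => \sum_(a <- [::]) F a u) = (fun=> 0).
    by apply: funext => u; rewrite big_nil.
  by rewrite vpderiv_cst big_nil.
have -> : (fun u => \sum_(b <- a :: r) F b u) = (fun u => F a u + \sum_(b <- r) F b u).
  by apply: funext => u; rewrite big_cons.
by rewrite (vpderivD i Ut) // ?IH ?big_cons //; apply: lsec_sum.
Qed.

Lemma decomp_fun W (c : pt -> C^o) : holo W c ->
  decomp W (fun _ : 'I_1 => c) (fun=> 1 : C^o) c.
Proof. by move=> hc; split=> // u _; rewrite big_ord1 /GRing.scale /= mulr1. Qed.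

Lemma lsec_fun U (c : pt -> C^o) : open U -> holo U c -> lsec U c.
Proof. by move=> oU hc; apply: (decomp_lsec oU) (decomp_fun hc). Qed.

Lemma vpderiv_fun U (c : pt -> C^o) i t : open U -> U t -> holo U c ->
  vpderiv i c t = pderiv i c t.
Proof.
move=> oU Ut hc; rewrite (vpderivE i oU Ut (decomp_fun hc)) big_ord1.
by rewrite /GRing.scale /= mulr1.
Qed.

Let scale_l (v : V) : linear_on setT (fun a : C^o => a *: v).
Proof. by move=> a x y _ _; rewrite scalerDl scalerA. Qed.

Lemma lsec_pmul U (c : pt -> C^o) s : open U -> holo U c -> lsec U s -> lsec U (pmul c s).
Proof.
move=> oU hc sl.
exact: (lsec_bilinear scale_l scale_linear_on (lsec_fun oU hc) sl).
Qed.

Lemma vpderiv_pmul U (c : pt -> C^o) s i t : open U -> U t -> holo U c -> lsec U s ->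
  vpderiv i (pmul c s) t = pderiv i c t *: s t + c t *: vpderiv i s t.
Proof.
move=> oU Ut hc sl; rewrite -(vpderiv_fun i oU Ut hc).
exact: (vpderiv_bilinear scale_l scale_linear_on i Ut (lsec_fun oU hc) sl).
Qed.

End Add.
End SectionOperations.

(** Over [C] the partial derivatives of holomorphic functions commute. *)
Definition mixed_partials (C : numClosedFieldType) := forall n (U : set 'rV[C]_n)
  (c : 'rV[C]_n -> C^o) (i j : 'I_n) t, open U -> holo U c -> U t ->
  pderiv i (pderiv j c) t = pderiv j (pderiv i c) t.

Lemma mixed_vpderiv (C : numClosedFieldType) n (V : lmodType C) (U : set 'rV[C]_n)
    (s : 'rV[C]_n -> V) (i j : 'I_n) t : mixed_partials C -> U t -> lsec U s ->
  vpderiv i (vpderiv j s) t = vpderiv j (vpderiv i s) t.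
Proof.
move=> mix Ut sl; have [W [oW Wt [k [c [e dec]]]]] := sl t Ut; have [hc sE] := dec.
have dd l : decomp W (fun a => pderiv l (c a)) e (vpderiv l s).
  split=> [a|u Wu]; first exact: holo_pderiv.
  exact: vpderivE dec.
rewrite (vpderivE i oW Wt (dd j)) (vpderivE j oW Wt (dd i)).
by apply: eq_bigr => a _; rewrite (mix n W).
Qed.

(** * Laurent expansions of rational functions *)
Section PowerSeries.
Variable C : numClosedFieldType.
Hypothesis arch : forall e : C, 0 < e -> exists K : nat, 2^-1 ^+ K < e.

Lemma cvg_half (u : nat -> C^o) (M : C) : (forall k, `|u k| <= M * 2^-1 ^+ k) ->
  u @ \oo --> (0 : C^o).
Proof.
move=> uM; apply/cvgrPdist_lt => e e0.
have M0 : 0 <= M.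
  by have := uM 0%N; rewrite expr0 mulr1; apply: le_trans.
have M1 : 0 < M + 1 by rewrite ltr_wpDl.
have [K Ke] := arch (divr_gt0 e0 M1).
exists K => // k /= Kk; rewrite sub0r normrN; apply: le_lt_trans (uM k) _.
have h0 k' : 0 < (2^-1 : C) ^+ k' by rewrite exprn_gt0 // invr_gt0.
apply: le_lt_trans (_ : (M + 1) * 2^-1 ^+ K < e); last by rewrite mulrC -ltr_pdivlMr.
apply: (ler_pM M0 (ltW (h0 k))).
  by rewrite lerDl ler01.
rewrite -(subnK Kk) exprD; apply: ler_piMl; first exact: ltW.
by apply: exprn_ile1; rewrite ?invr_ge0 // invf_le1 // ler1n.
Qed.

(** Coefficients of the expansion of [(w + A) ^- m.+1] in powers of [w]. *)
Definition pole_coef (A : C) (m k : nat) : C :=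
  (-1) ^+ k * 'C(m + k, k)%:R * A ^- (m + k).+1.

Definition pole_sum (A w : C) (m n : nat) : C := \sum_(k < n) pole_coef A m k * w ^+ k.

Lemma pole_coefSS A m k : A != 0 ->
  A * pole_coef A m.+1 k.+1 + pole_coef A m.+1 k = pole_coef A m k.+1.
Proof.
move=> A0; rewrite /pole_coef !addSn !addnS binS natrD exprS [_ ^+ (m + k).+3]exprS.
by field; rewrite expf_neq0.
Qed.

Lemma pole_coefS0 A m : A != 0 -> A * pole_coef A m.+1 0 = pole_coef A m 0.
Proof.
move=> A0; rewrite /pole_coef !addn0 !bin0 expr0 !mul1r [_ ^+ m.+2]exprS.
by field; rewrite expf_neq0.
Qed.

Lemma pole_coef0S A k : A != 0 -> A * pole_coef A 0 k.+1 + pole_coef A 0 k = 0.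
Proof.
move=> A0; rewrite /pole_coef !add0n !binn exprS [_ ^+ k.+2]exprS.
by field; rewrite expf_neq0.
Qed.

Lemma pole_sumS A w m n : A != 0 ->
  (w + A) * pole_sum A w m.+1 n.+1 = pole_sum A w m n.+1 + pole_coef A m.+1 n * w ^+ n.+1.
Proof.
move=> A0; elim: n => [|n IH].
  rewrite /pole_sum !big_ord1 !expr0 expr1 !mulr1 mulrDl pole_coefS0 //.
  by rewrite addrC [w * _]mulrC.
rewrite /pole_sum big_ord_recr [in RHS]big_ord_recr /= mulrDr -/(pole_sum _ _ _ _) IH.
rewrite -/(pole_sum _ _ _ _) -(pole_coefSS m n A0) [w ^+ n.+2]exprS; ring.
Qed.

Lemma pole_sum0 A w n : A != 0 ->
  (w + A) * pole_sum A w 0 n.+1 = 1 + pole_coef A 0 n * w ^+ n.+1.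
Proof.
move=> A0; elim: n => [|n IH].
  rewrite /pole_sum big_ord1 /pole_coef bin0 expr0 expr1 !mul1r expr1 mulr1 mulrDl divff //.
  by rewrite addrC mulrC.
rewrite /pole_sum big_ord_recr /= mulrDr -/(pole_sum _ _ _ _) IH.
have E := pole_coef0S n A0.
have -> : pole_coef A 0 n = - (A * pole_coef A 0 n.+1) by apply/eqP; rewrite -addr_eq0 addrC E.
rewrite [w ^+ n.+2]exprS; ring.
Qed.

Lemma pole_remainder A w m : A != 0 -> `|w| <= `|A| / 4 ->
  (fun n => pole_coef A m n * w ^+ n.+1 : C^o) @ \oo --> (0 : C^o).
Proof.
move=> A0 wA; apply: (@cvg_half _ (2 ^+ m * `|A| ^- m)) => n.
have nA : `|A| != 0 by rewrite normr_eq0.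
rewrite /pole_coef !normrM normrX normrN1 expr1n mul1r normr_nat normfV !normrX.
have bin2 : 'C(m + n, n)%:R <= 2 ^+ (m + n) :> C.
  rewrite -natrX ler_nat; have := leq_bigmax (F := fun i : 'I_(m + n).+1 => 'C(m + n, i)) (inord n).
  move=> _; rewrite -[2%N]/(1 + 1)%N expnDn.
  have nn : (n < (m + n).+1)%N by rewrite ltnS leq_addl.
  by rewrite (bigD1 (Ordinal nn)) //= !exp1n !muln1 leq_addr.
apply: le_trans (_ : 2 ^+ (m + n) * `|A| ^- (m + n).+1 * (`|A| / 4) ^+ n.+1 <= _).
  apply: ler_pM; rewrite ?mulr_ge0 ?exprn_ge0 ?invr_ge0 //.
    by apply: ler_wpM2r; rewrite ?invr_ge0 ?exprn_ge0.
  by rewrite lerXn2r // nnegrE // divr_ge0.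
have -> : 2 ^+ (m + n) * `|A| ^- (m + n).+1 * (`|A| / 4) ^+ n.+1 =
   2 ^+ m * `|A| ^- m * 2^-1 ^+ n * 4^-1 :> C.
  have h4 : 4 = 2 * 2 :> C by rewrite -natrM.
  rewrite expr_div_n h4 exprVn exprMn ![_ ^+ _.+1]exprS !exprD.
  by field; rewrite nA !expf_neq0 ?pnatr_eq0.
rewrite ler_piMr ?mulr_ge0 ?exprn_ge0 ?invr_ge0 //.
by rewrite invf_le1 // ler1n.
Qed.

Lemma pole_cvg A w m : A != 0 -> `|w| <= `|A| / 4 ->
  (fun n => pole_sum A w m n : C^o) @ \oo --> ((w + A) ^- m.+1 : C^o).
Proof.
move=> A0 wA.
have wA0 : w + A != 0.
  have A1 : 0 < `|A| by rewrite normr_gt0.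
  rewrite -normr_gt0 addrC; apply: lt_le_trans (lerB_normD _ _).
  rewrite subr_gt0; apply: le_lt_trans wA _; rewrite ltr_pdivrMr //.
  by rewrite ltr_pMr // ltr1n.
elim: m => [|m IH].
  rewrite -cvg_shiftS.
  have -> : [sequence pole_sum A w 0 n.+1 : C^o]_n =
      (fun n => (w + A)^-1 * (1 + pole_coef A 0 n * w ^+ n.+1) : C^o).
    by apply: funext => n; rewrite -pole_sum0 // mulKf.
  have H : (fun n => 1 + pole_coef A 0 n * w ^+ n.+1 : C^o) @ \oo --> (1 + 0 : C^o).
    by apply: cvgD; [exact: cvg_cst|exact: pole_remainder].
  have := @cvgMl_tmp C nat \oo _ _ (w + A)^-1 _ H.
  by rewrite addr0 mulr1; apply.
rewrite -cvg_shiftS.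
have -> : [sequence pole_sum A w m.+1 n.+1 : C^o]_n =
    (fun n => (w + A)^-1 * (pole_sum A w m n.+1 + pole_coef A m.+1 n * w ^+ n.+1) : C^o).
  by apply: funext => n; rewrite -pole_sumS // mulKf.
have H : (fun n => pole_sum A w m n.+1 + pole_coef A m.+1 n * w ^+ n.+1 : C^o) @ \oo -->
    ((w + A) ^- m.+1 + 0 : C^o).
  apply: cvgD; last exact: pole_remainder.
  by move: IH; rewrite -(@cvg_shiftS C^o).
have := @cvgMl_tmp C nat \oo _ _ (w + A)^-1 _ H.
by rewrite addr0 -invfM -exprS; apply.
Qed.

Lemma geometric_sum_le2 (q : C) n : 0 <= q -> q <= 2^-1 -> \sum_(k < n) q ^+ k <= 2.
Proof.
move=> q0 q1; elim: n => [|n IH]; first by rewrite big_ord0.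
rewrite big_ord_recl expr0 (eq_bigr (fun k : 'I_n => q * q ^+ k)) => [|k _]; last first.
  by rewrite exprS.
rewrite -mulr_sumr -[leRHS]/(1 + 1) lerD2l.
apply: le_trans (ler_wpM2l q0 IH) _.
by apply: le_trans (ler_wpM2r _ q1) _; rewrite // mulVf.
Qed.

Lemma le_half0 (y M : C) : 0 <= y -> (forall j, y <= M * 2^-1 ^+ j) -> y = 0.
Proof.
move=> y0 yM; apply/eqP; rewrite eq_le y0 andbT.
have M0 : 0 <= M by have := yM 0%N; rewrite expr0 mulr1; apply: le_trans.
rewrite real_leNgt ?ger0_real //; apply/negP => y1.
have M1 : 0 < M + 1 by rewrite ltr_wpDl.
have [K Ke] := arch (divr_gt0 y1 M1).
have := lt_le_trans Ke (_ : y / (M + 1) <= 2^-1 ^+ K).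
rewrite ltxx => H; suff: false by []; apply: H.
rewrite ler_pdivrMr // mulrC; apply: le_trans (yM K) _.
by rewrite ler_wpM2r ?exprn_ge0 ?invr_ge0 // lerDl ler01.
Qed.

(** A power series that vanishes on a punctured neighbourhood has no coefficients:
    after division by the first nonzero term, the rest is bounded by a geometric
    series with ratio proportional to [w]. *)
Lemma power_series0 (x : nat -> C) :
  (\forall w \near (0 : C)^', series (fun k => w ^+ k * x k : C^o) @ \oo --> (0 : C^o)) ->
  forall k, x k = 0.
Proof.
move=> [/= e e0 ex].
have {}ex w : w != 0 -> `|w| < e -> series (fun k => w ^+ k * x k : C^o) @ \oo --> (0 : C^o).
  by move=> w0 we; apply: ex => //=; rewrite sub0r normrN.
pose w0 := e / 2; have w00 : 0 < w0 by rewrite divr_gt0.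
have w0e : w0 < e by rewrite ltr_pdivrMr // ltr_pMr // ltr1n.
have [B B0 xB] : exists2 B, 0 <= B & forall k, `|x k| * w0 ^+ k <= B.
  have := ex w0 (lt0r_neq0 w00); rewrite gtr0_norm // => /(_ w0e) cs.
  have : (fun k => w0 ^+ k * x k : C^o) @ \oo --> (0 : C^o).
    by apply: cvg_series_cvg_0; apply/cvg_ex; exists (0 : C^o).
  move/cvgrPdist_lt => /(_ _ ltr01)[K _ KB].
  exists (1 + \sum_(k < K) `|x k| * w0 ^+ k).
    by rewrite addr_ge0 // sumr_ge0 // => k _; rewrite mulr_ge0 // exprn_ge0 // ltW.
  have t0 k : 0 <= `|x k| * w0 ^+ k by rewrite mulr_ge0 // exprn_ge0 // ltW.
  move=> k; have [kK|Kk] := ltnP k K.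
    rewrite (bigD1 (Ordinal kK)) //= addrCA lerDl addr_ge0 // sumr_ge0 //.
  apply: le_trans (_ : 1 <= _); last by rewrite lerDl sumr_ge0.
  have := KB k Kk; rewrite /= sub0r normrN normrM normrX (gtr0_norm w00) mulrC.
  exact: ltW.
move=> m; have [n] := ubnP m; elim: n m => // n IH m; rewrite ltnS => mn.
have {IH} xlt k : (k < m)%N -> x k = 0 by move=> km; apply: IH; apply: leq_trans mn.
apply/eqP; rewrite -normr_eq0; apply/eqP.
apply: (@le_half0 _ (2 * B / w0 ^+ m)) => // j.
pose q : C := 2^-1 ^+ j.+1; pose w := w0 * q.
have q0 : 0 < q by rewrite exprn_gt0 // invr_gt0.
have w1 : 0 < w by rewrite mulr_gt0.
have half1 : (2^-1 : C) <= 1 by rewrite invf_le1 // ler1n.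
have q1 : q <= 2^-1.
  by rewrite /q exprS ler_piMr ?invr_ge0 // exprn_ile1 // invr_ge0.
have we : `|w| < e.
  rewrite gtr0_norm //; apply: le_lt_trans w0e; rewrite ler_piMr ?ltW //.
  by apply: le_lt_trans q1 _; rewrite invf_lt1 // ltr1n.
have /cvgrPdist_lt cs := ex w (lt0r_neq0 w1) we.
have key d : 0 < d -> `|x m| * w ^+ m <= d + 2 * B * q ^+ m.+1.
  move=> d0; have [K _ Kd] := cs d d0.
  pose N := (K + m.+1)%N; have := Kd N (leq_addr _ _); rewrite /= sub0r normrN => sN.
  have sE : series (fun k => w ^+ k * x k : C^o) N =
      w ^+ m * x m + \sum_(k < K) w ^+ (m.+1 + k) * x (m.+1 + k)%N.
    rewrite seriesEnat /= big_mkord /N addnC big_split_ord /= big_ord_recr /=.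
    by rewrite big1 ?add0r // => k _; rewrite xlt ?mulr0.
  rewrite sE in sN.
  have -> : `|x m| * w ^+ m = `|w ^+ m * x m| by rewrite normrM normrX (gtr0_norm w1) mulrC.
  set S := \sum_(k < K) _ in sN.
  rewrite -[w ^+ m * x m](addrK S); apply: le_trans (ler_normB _ _) _.
  apply: lerD; first exact: ltW.
  apply: le_trans (ler_norm_sum _ _ _) _.
  apply: le_trans (_ : \sum_(k < K) B * q ^+ m.+1 * q ^+ k <= _).
    apply: ler_sum => k _; rewrite normrM normrX (gtr0_norm w1) /w exprMn.
    rewrite -[B * _ * _]mulrA -exprD [X in X <= _](_ : _ = (`|x (m.+1 + k)%N| * w0 ^+ (m.+1 + k)) * q ^+ (m.+1 + k)); last by ring.
    apply: ler_wpM2r; last exact: xB.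
    by rewrite exprn_ge0 // ltW.
  rewrite -mulr_sumr [2 * B]mulrC -!mulrA; apply: ler_wpM2l => //.
  rewrite mulrC; apply: ler_wpM2r; first by rewrite exprn_ge0 // ltW.
  by apply: geometric_sum_le2; rewrite // ltW.
have {}key : `|x m| * w ^+ m <= 2 * B * q ^+ m.+1.
  rewrite real_leNgt ?ger0_real ?mulr_ge0 ?exprn_ge0 ?(ltW w1) ?(ltW q0) //.
  apply/negP => lt; have d0 : 0 < (`|x m| * w ^+ m - 2 * B * q ^+ m.+1) / 2.
    by rewrite divr_gt0 // subr_gt0.
  have := key _ d0; rewrite -subr_ge0.
  set a := `|x m| * w ^+ m in lt d0 *; set b := 2 * B * q ^+ m.+1 in lt d0 *.
  have -> : (a - b) / 2 + b - a = - ((a - b) / 2) by field.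
  by rewrite oppr_ge0 => /(lt_le_trans d0); rewrite ltxx.
move: key; rewrite /w exprMn exprS !mulrA.
have -> : `|x m| * w0 ^+ m * q ^+ m <= 2 * B * q * q ^+ m = (`|x m| * w0 ^+ m <= 2 * B * q).
  by rewrite ler_pM2r // exprn_gt0.
rewrite -ler_pdivlMr ?exprn_gt0 // => xm; apply: le_trans xm _.
rewrite mulrAC; apply: ler_wpM2l.
  by rewrite mulr_ge0 ?invr_ge0 ?exprn_ge0 ?(ltW w00) // mulr_ge0.
by rewrite /q exprS ler_piMl // exprn_ge0 // invr_ge0.
Qed.

End PowerSeries.

Section LaurentExpansion.
Variable C : numClosedFieldType.
Hypothesis arch : forall e : C, 0 < e -> exists K : nat, 2^-1 ^+ K < e.
Variables (g : quad_lie C).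
Local Notation "x ^z k" := (x ^ (k : int)) (at level 29).

Lemma quarter_near (a : C) : a != 0 -> \forall w \near (0 : C)^', `|w| <= `|a| / 4.
Proof.
move=> a0; exists (`|a| / 4) => /=; first by rewrite divr_gt0 // normr_gt0.
by move=> w /=; rewrite sub0r normrN => /ltW.
Qed.

Lemma addr_quarter_neq0 (a w : C) : a != 0 -> `|w| <= `|a| / 4 -> w + a != 0.
Proof.
move=> a0 wa; have A1 : 0 < `|a| by rewrite normr_gt0.
rewrite -normr_gt0 addrC; apply: lt_le_trans (lerB_normD _ _).
rewrite subr_gt0; apply: le_lt_trans wa _; rewrite ltr_pdivrMr //.
by rewrite ltr_pMr // ltr1n.
Qed.

Lemma series_single (u : nat -> C^o) K : (forall k, k != K -> u k = 0) ->
  series u @ \oo --> (u K : C^o).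
Proof.
move=> uK; apply: cvg_near_cst; exists K.+1 => // n /= Kn.
rewrite seriesEnat /= big_mkord (bigD1 (Ordinal Kn)) //= big1 ?addr0 // => k kK.
by apply: uK; apply: contraNneq kK => kK; apply/eqP/val_inj.
Qed.

Definition laurent_on (N : nat) (f : C -> g) (t : C) (a : laurent g) :=
  (forall k : int, k < - N%:Z -> a k = 0) /\
  \forall w \near (0 : C)^', forall l : 'Hom(g, C^o),
      series (fun k : nat => w ^ (k%:Z - N%:Z) * l (a (k%:Z - N%:Z)))
        @ \oo --> (l (f (t + w)) : C^o).

Lemma laurent_onS N f t a : laurent_on N f t a -> laurent_on N.+1 f t a.
Proof.
move=> [a0 ha]; split=> [k kN|]; first by apply: a0; lia.
apply: filterS ha => w hw l; rewrite -cvg_shiftS.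
suff -> : [sequence series (fun k : nat => w ^ (k%:Z - N.+1%:Z) * l (a (k%:Z - N.+1%:Z))) n.+1]_n =
  series (fun k : nat => w ^ (k%:Z - N%:Z) * l (a (k%:Z - N%:Z))) by exact: hw.
apply: funext => n /=.
rewrite !seriesEnat /= !big_mkord big_ord_recl a0 ?linear0 ?mulr0 ?add0r; last by lia.
by apply: eq_bigr => k _; have -> : (lift ord0 k)%:Z - N.+1%:Z = k%:Z - N%:Z by rewrite /= /bump /=; lia.
Qed.

Lemma laurent_on_le N N' f t a : (N <= N')%N -> laurent_on N f t a -> laurent_on N' f t a.
Proof.
move=> NN' ha; rewrite -(subnK NN'); elim: (N' - N)%N => // d IH.
by rewrite addSn; apply: laurent_onS.
Qed.

Lemma laurent_on_unique N f t a a' : laurent_on N f t a -> laurent_on N f t a' -> a = a'.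
Proof.
move=> [a0 ha] [a0' ha']; apply: laurent_ext => k.
have [kN|Nk] := ltP k (- N%:Z); first by rewrite a0 ?a0'.
have kE : k = (absz (k + N%:Z))%:Z - N%:Z by lia.
apply/eqP; rewrite -subr_eq0; apply/eqP.
suff cf (l : 'Hom(g, C^o)) : l (a k - a' k) = 0.
  set v := a k - a' k in cf *; rewrite (coord_vbasis (memvf v)); apply: big1 => i _.
  have := cf (linfun (coord (vbasis {: g}) i)); rewrite lfunE /= => ->.
  by rewrite scale0r.
rewrite kE; move: (absz (k + N%:Z)) => p.
apply: (power_series0 arch (x := fun p => l (a (p%:Z - N%:Z) - a' (p%:Z - N%:Z)))).
have nz : \forall w \near (0 : C)^', w != 0 by apply: nbhs_dnbhs_neq.
apply: filterS3 nz ha ha' => w w0 /(_ l) hw /(_ l) hw'.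
have FF : Filter (\oo : set_system nat) by typeclasses eauto.
have H := cvgB hw hw'; rewrite subrr in H.
have H2 := @cvgMl_tmp C nat \oo _ _ (w ^+ N) _ (H FF); rewrite mulr0 in H2.
suff -> : series (fun k => w ^+ k * l (a (k%:Z - N%:Z) - a' (k%:Z - N%:Z)) : C^o) =
  (fun n => w ^+ N * (series (fun k : nat => w ^ (k%:Z - N%:Z) * l (a (k%:Z - N%:Z))) n -
    series (fun k : nat => w ^ (k%:Z - N%:Z) * l (a' (k%:Z - N%:Z))) n)) by exact: (H2 FF).
apply: funext => n; rewrite !seriesEnat /= -sumrB mulr_sumr; apply: eq_bigr => k' _.
rewrite -mulrBr -linearB /= mulrA; congr (_ * _).
by rewrite !exprnP -expfzDr // addrC subrK.
Qed.

Lemma laurent_at_unique N f t a : laurent_on N f t a -> laurent_at f t = a.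
Proof.
move=> ha; rewrite /laurent_at; case: xgetP => [b _ [M [b0 hb]]|/(_ a)[]]; last by exists N.
have hb' : laurent_on M f t b by [].
apply: (@laurent_on_unique (maxn M N) f t); first exact: laurent_on_le (leq_maxl _ _) hb'.
exact: laurent_on_le (leq_maxr _ _) ha.
Qed.

Section PartialFractions.
Variable n : nat.
Local Notation pt := 'rV[C]_n.
Implicit Types (t : pt) (i j : 'I_n).

(** The coefficient of [w ^ k] in the expansion of [(z - t_j) ^- m.+1] at
    [z = t_i + w]. *)
Definition frac_coef i j (m : nat) (k : int) t : C :=
  if j == i then (k == - m.+1%:Z)%:R
  else if 0 <= k then pole_coef (t ord0 i - t ord0 j) m `|k|%N else 0.

Lemma frac_coef_below i j m k N t : (m < N)%N -> k < - N%:Z -> frac_coef i j m k t = 0.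
Proof.
move=> mN kN; rewrite /frac_coef; case: ifP => _.
  by case: eqP => // kE; exfalso; lia.
by case: ifP => // k0; exfalso; lia.
Qed.

Lemma frac_coef_cvg i j m N t : config t -> (m < N)%N ->
  \forall w \near (0 : C)^',
    series (fun k : nat => w ^ (k%:Z - N%:Z) * frac_coef i j m (k%:Z - N%:Z) t : C^o) @ \oo -->
      ((w + (t ord0 i - t ord0 j)) ^- m.+1 : C^o).
Proof.
move=> ct mN; rewrite /frac_coef; case: (eqVneq j i) => [->|ji].
  apply: nearW => w; rewrite subrr addr0.
  have := @series_single (fun k : nat => w ^ (k%:Z - N%:Z) * (k%:Z - N%:Z == - m.+1%:Z)%:R) (N - m.+1)%N.
  have -> : (N - m.+1)%N%:Z - N%:Z = - m.+1%:Z by lia.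
  rewrite eqxx mulr1 => H; have := H _; rewrite -[w ^ (- m.+1%:Z)]exprnN; apply => k kE.
  by rewrite (_ : (_ == _) = false) ?mulr0 //; apply/negbTE; move: kE; lia.
have A0 : t ord0 i - t ord0 j != 0 by rewrite subr_eq0 ct // eq_sym.
apply: filterS (quarter_near A0) => w wA.
have H := pole_cvg (m := m) arch A0 wA; rewrite -(@cvg_shiftn N C^o).
suff -> : [sequence series (fun k : nat => w ^ (k%:Z - N%:Z) *
     (if 0 <= k%:Z - N%:Z then pole_coef (t ord0 i - t ord0 j) m (absz (k%:Z - N%:Z)) else 0) : C^o) (p + N)%N]_p =
   (fun p => pole_sum (t ord0 i - t ord0 j) w m p : C^o) by exact: H.
apply: funext => p /=.
rewrite seriesEnat /= big_mkord addnC big_split_ord /= big1 ?add0r => [|k _]; last first.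
  by rewrite (_ : (0 <= _) = false) ?mulr0 //; apply/negbTE; have := ltn_ord k; lia.
apply: eq_bigr => k _; have -> : (N + k)%N%:Z - N%:Z = k%:Z by lia.
by rewrite absz_nat -exprnP mulrC.
Qed.

Variables (N : nat) (X0 : pt -> g) (X : 'I_n -> nat -> pt -> g).

Definition pf_coef i (k : int) t : g :=
  (k == 0)%:R *: X0 t + \sum_j \sum_(m < N) frac_coef i j m k t *: X j m t.

Lemma pf_coef_below i k t : k < - N%:Z -> pf_coef i k t = 0.
Proof.
move=> kN; rewrite /pf_coef (_ : (k == 0) = false) ?scale0r ?add0r; last by lia.
apply: big1 => j _; apply: big1 => m _.
by rewrite (@frac_coef_below _ _ _ _ N) ?scale0r.
Qed.

Lemma pf_laurent_subproof i t : (fun k => pf_coef i k t) \in @below C g.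
Proof. by apply/asboolP; exists (- N%:Z) => k; apply: pf_coef_below. Qed.

Definition pf_laurent i t : laurent g := Laurent (pf_laurent_subproof i t).

Lemma pf_laurent_on (f : C -> g) i t : config t ->
  (forall z, off t z -> f z = pfrac t N (X0 t) (fun j m => X j m t) z) ->
  laurent_on N f (t ord0 i) (pf_laurent i t).
Proof.
move=> ct fE; split=> [k|]; first exact: pf_coef_below.
have H1 : \forall w \near (0 : C)^', forall j, forall m : 'I_N,
    series (fun k : nat => w ^ (k%:Z - N%:Z) * frac_coef i j m (k%:Z - N%:Z) t : C^o) @ \oo -->
      ((w + (t ord0 i - t ord0 j)) ^- m.+1 : C^o).
  by do 2!apply: filter_forall => ?; apply: frac_coef_cvg.
have H2 : \forall w \near (0 : C)^', off t (t ord0 i + w).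
  apply: filter_forall => j; case: (eqVneq j i) => [->|ji].
    have nz : \forall w \near (0 : C)^', w != 0 by apply: nbhs_dnbhs_neq.
    by apply: filterS nz => w w0; rewrite -subr_eq0 addrAC subrr add0r.
  have A0 : t ord0 i - t ord0 j != 0 by rewrite subr_eq0 ct // eq_sym.
  apply: filterS (quarter_near A0) => w wA.
  by rewrite -subr_eq0 addrAC addrC addr_quarter_neq0.
apply: filterS2 H1 H2 => w hw ow l; rewrite fE // /pfrac.
have h0 : series (fun k : nat => w ^ (k%:Z - N%:Z) * (k%:Z - N%:Z == 0)%:R : C^o) @ \oo --> (1 : C^o).
  have := @series_single (fun k : nat => w ^ (k%:Z - N%:Z) * (k%:Z - N%:Z == 0)%:R) N.
  rewrite subrr eqxx mulr1 expr0z; apply => k kN.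
  by rewrite (_ : (_ == _) = false) ?mulr0 //; apply/negbTE; move: kN; lia.
have cM (u : nat -> C^o) (y b : C) : u @ \oo --> (y : C^o) -> (fun n => u n * b : C^o) @ \oo --> (y * b : C^o).
  by move=> uy; apply: (cvgM (g := fun=> b) uy); apply: cvg_cst.
have -> : series (fun k : nat => w ^ (k%:Z - N%:Z) * l (pf_laurent i t (k%:Z - N%:Z))) =
  (fun p => series (fun k : nat => w ^ (k%:Z - N%:Z) * (k%:Z - N%:Z == 0)%:R : C^o) p * l (X0 t) +
    \sum_j \sum_(m < N)
     series (fun k : nat => w ^ (k%:Z - N%:Z) * frac_coef i j m (k%:Z - N%:Z) t : C^o) p * l (X j m t)).
  apply: funext => p; rewrite !seriesEnat /= !big_mkord mulr_suml.
  rewrite (eq_bigr (fun k : 'I_p => w ^ (k%:Z - N%:Z) * (k%:Z - N%:Z == 0)%:R * l (X0 t) +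
     \sum_j \sum_(m < N) w ^ (k%:Z - N%:Z) * frac_coef i j m (k%:Z - N%:Z) t * l (X j m t))).
    rewrite big_split /=; congr (_ + _); rewrite exchange_big; apply: eq_bigr => j _ /=.
    rewrite exchange_big; apply: eq_bigr => m _ /=.
    by rewrite seriesEnat /= big_mkord mulr_suml.
  move=> k _; rewrite /= /pf_coef linearD linearZ linear_sum mulrDr /=; congr (_ + _).
    by rewrite /GRing.scale /= mulrA.
  rewrite mulr_sumr; apply: eq_bigr => j _; rewrite linear_sum mulr_sumr.
  by apply: eq_bigr => m _; rewrite linearZ /= /GRing.scale /= mulrA.
have -> : l (X0 t + \sum_j \sum_(m < N) (t ord0 i + w - t ord0 j) ^- m.+1 *: X j m t) =
   1 * l (X0 t) + \sum_j \sum_(m < N) (w + (t ord0 i - t ord0 j)) ^- m.+1 * l (X j m t).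
  rewrite linearD linear_sum mul1r; congr (_ + _); apply: eq_bigr => j _.
  rewrite linear_sum; apply: eq_bigr => m _; rewrite linearZ /=.
  by congr (_ ^- _ * _); rewrite addrAC addrC.
apply: cvgD; first exact: cM.
have csum (I : Type) (s : seq I) (F : I -> nat -> C^o) (y : I -> C) :
    (forall a, F a @ \oo --> (y a : C^o)) ->
    (fun p => \sum_(a <- s) F a p : C^o) @ \oo --> (\sum_(a <- s) y a : C^o).
  move=> Fy; elim: s => [|a s IH].
    have -> : (fun p => \sum_(a <- [::]) F a p) = (fun=> 0 : C^o).
      by apply: funext => p; rewrite big_nil.
    by rewrite big_nil; apply: cvg_cst.
  have -> : (fun p => \sum_(b <- a :: s) F b p) = (fun p => F a p + \sum_(b <- s) F b p : C^o).
    by apply: funext => p; rewrite big_cons.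
  by rewrite big_cons; apply: cvgD.
by apply: (csum) => j; apply: (csum) => m; apply: (cM).
Qed.

End PartialFractions.
End LaurentExpansion.

Section FractionDerivatives.
Variables (C : numClosedFieldType) (n : nat).
Local Notation pt := 'rV[C]_n.
Implicit Types (W : set pt) (t : pt) (i j : 'I_n).

Lemma holo_negexp W (D : pt -> C^o) q : open W -> (forall u, W u -> D u != 0) -> holo W D ->
  holo W (fun u => D u ^- q : C^o).
Proof.
move=> oW D0 hD; apply: holo_inv => //; last exact: holo_exp.
by move=> t Wt; rewrite expf_neq0 // D0.
Qed.

Lemma pderiv_negexp W (D : pt -> C^o) q i t : open W -> W t -> (forall u, W u -> D u != 0) ->
  holo W D -> pderiv i (fun u => D u ^- q : C^o) t = - q%:R * pderiv i D t * D t ^- q.+1.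
Proof.
move=> oW Wt D0 hD; elim: q => [|q IH].
  by rewrite oppr0 !mul0r -[RHS](pderiv_cst 1 i t); congr (pderiv i _ t); apply: funext => u; rewrite expr0 invr1.
transitivity (pderiv i (fun u => (D u)^-1 * D u ^- q : C^o) t).
  by congr (pderiv i _ t); apply: funext => u; rewrite exprS invfM.
rewrite (pderivM i (holo_inv oW D0 hD) (holo_negexp q oW D0 hD) Wt) IH (pderivV i hD Wt (D0 t Wt)).
have Dt := D0 t Wt; rewrite [_ ^+ q.+2]exprS [_ ^+ q.+1]exprS -[q.+1]addn1 natrD.
by field; rewrite Dt expf_neq0.
Qed.

Lemma holo_coordB W i j : open W -> holo W (fun u : pt => u ord0 i - u ord0 j : C^o).
Proof.
move=> oW; have h := holo_lin (-1) oW (holo_coord j oW) (holo_coord i oW).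
by apply: holo_ext oW _ h => u _; rewrite mulN1r addrC.
Qed.

Lemma pderiv_coordB l i j t :
  pderiv l (fun u : pt => u ord0 i - u ord0 j : C^o) t = (l == i)%:R - (l == j)%:R.
Proof.
transitivity (pderiv l (fun u : pt => -1 * u ord0 j + u ord0 i : C^o) t).
  by congr (pderiv l _ t); apply: funext => u; rewrite mulN1r addrC.
have h k : holo setT (fun u : pt => u ord0 k : C^o) by apply: holo_coord; exact: openT.
by rewrite (pderiv_lin (-1) l (h j) (h i)) // !pderiv_coord mulN1r addrC.
Qed.

Lemma frac_coef_holo W i j m k : open W -> W `<=` config -> holo W (frac_coef i j m k : pt -> C^o).
Proof.
move=> oW Wc; rewrite /frac_coef; case: (eqVneq j i) => [_|ji]; first exact: holo_cst.
case: (0 <= k); last exact: holo_cst.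
apply: holo_mul => //; first exact: holo_cst.
apply: holo_negexp => //; last exact: holo_coordB.
by move=> u /Wc cu; rewrite subr_eq0 cu // eq_sym.
Qed.

(** Moving the pole [t_j] raises the order of the fraction; moving the centre [t_i]
    of the expansion differentiates the expansion. *)
Lemma frac_coef_pderiv W l i j m k t : open W -> W `<=` config -> W t ->
  pderiv l (frac_coef i j m k : pt -> C^o) t =
    (l == j)%:R * (m.+1%:R * frac_coef i j m.+1 k t)
    + (l == i)%:R * ((k + 1)%:~R * frac_coef i j m (k + 1) t).
Proof.
move=> oW Wc Wt; rewrite /frac_coef; case: (eqVneq j i) => [->|ji].
  rewrite pderiv_cst; case: (l == i); rewrite ?mul0r ?addr0 // !mul1r.
  have -> : (k + 1 == - m.+1%:Z) = (k == - m.+2%:Z) by apply/eqP/eqP; lia.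
  case: eqP => [->|_]; last by rewrite !mulr0 addr0.
  have -> : - m.+2%:Z + 1 = - m.+1%:Z by lia.
  by rewrite mulrNz !mulr1 subrr.
have D0 u : W u -> u ord0 i - u ord0 j != 0 by move=> /Wc cu; rewrite subr_eq0 cu // eq_sym.
case: k => [k|k]; last first.
  rewrite /= pderiv_cst !mulr0 add0r; case: k => [|k].
    by rewrite (_ : Negz 0 + 1 = 0) // mul0r mulr0.
  by rewrite (_ : (0 <= Negz k.+1 + 1) = false) ?mulr0 //; apply/negbTE; lia.
have -> : k%:Z + 1 = k.+1%:Z by lia.
rewrite /= /pole_coef.
transitivity ((-1) ^+ k * 'C(m + k, k)%:R *
  pderiv l (fun u : pt => (u ord0 i - u ord0 j) ^- (m + k).+1 : C^o) t).
  have hz : holo W (fun=> 0 : C^o) by apply: holo_cst.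
  have hD := holo_negexp (m + k).+1 oW D0 (holo_coordB i j oW).
  have := pderiv_lin ((-1) ^+ k * 'C(m + k, k)%:R) l hD hz Wt.
  rewrite pderiv_cst addr0 => <-; congr (pderiv l _ t).
  by apply: funext => u; rewrite addr0.
rewrite (pderiv_negexp (m + k).+1 l oW Wt D0 (holo_coordB i j oW)) pderiv_coordB.
have e1 : m.+1%:R * 'C(m.+1 + k, k)%:R = (m + k).+1%:R * 'C(m + k, k)%:R :> C.
  rewrite -!natrM; congr (_%:R); rewrite -[in RHS]bin_sub ?leq_addl // addnK.
  by rewrite mul_bin_diag addSn -[in RHS]bin_sub ?ltnS ?leq_addr // subSS addKn.
have e2 : k.+1%:R * 'C((m + k).+1, k.+1)%:R = (m + k).+1%:R * 'C(m + k, k)%:R :> C.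
  by rewrite -!natrM -mul_bin_diag.
have fin (a b s q M K c1 c2 mk c : C) : M * c1 = mk * c -> K * c2 = mk * c ->
    s * c * (- mk * (a - b) * q) = b * (M * (s * c1 * q)) + a * (K * (-1 * s * c2 * q)).
  move=> E1 E2; have -> : b * (M * (s * c1 * q)) = b * s * q * (M * c1) by ring.
  have -> : a * (K * (-1 * s * c2 * q)) = - a * s * q * (K * c2) by ring.
  by rewrite E1 E2; ring.
rewrite [(-1) ^+ k.+1]exprS addnS.
exact: fin e1 e2.
Qed.

Section FractionSum.
Variables (V : lmodType C) (N : nat) (X0 : pt -> V) (X : 'I_n -> nat -> pt -> V).

(** The numerators of the partial fraction decomposition of the derivative of a
    family of rational functions. *)
Definition dnum l j m t : V :=
  (if (m < N)%N then vpderiv l (X j m) t else 0) +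
  (if l == j then m%:R *: X j m.-1 t else 0).

Definition frac_sum (a : C) (phi : 'I_n -> nat -> pt -> C^o) t : V :=
  a *: X0 t + \sum_j \sum_(m < N) phi j m t *: X j m t.

Variables (W : set pt).
Hypotheses (oW : open W) (lX0 : lsec W X0) (lX : forall j m, lsec W (X j m)).

Lemma lsec_dnum l j m : lsec W (dnum l j m).
Proof.
apply: lsecD; first by case: (m < N)%N; [apply: lsec_vpderiv|apply: lsec_cst].
by case: (l == j); [apply: lsecZ|apply: lsec_cst].
Qed.

Lemma lsec_frac_sum a phi : (forall j m, holo W (phi j m)) -> lsec W (frac_sum a phi).
Proof.
move=> hphi; apply: lsecD; first exact: lsecZ.
by apply: lsec_sum => j; apply: lsec_sum => m; apply: lsec_pmul.
Qed.

Lemma frac_sum_vpderiv a phi psi l t : W t -> (forall j m, holo W (phi j m)) ->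
  (forall j m, pderiv l (phi j m) t = (l == j)%:R * (m.+1%:R * phi j m.+1 t) + psi j m) ->
  vpderiv l (frac_sum a phi) t =
  a *: vpderiv l X0 t + \sum_j \sum_(m < N.+1) phi j m t *: dnum l j m t
  + \sum_j \sum_(m < N) psi j m *: X j m t.
Proof.
move=> Wt hphi dphi.
have lpX j m : lsec W (pmul (phi j m) (X j m)) by apply: lsec_pmul.
have lsum j : lsec W (fun u => \sum_(m < N) phi j m u *: X j m u).
  by apply: lsec_sum => m; apply: lpX.
rewrite /frac_sum (vpderivD l Wt (lsecZ a lX0)); last by apply: lsec_sum.
rewrite (vpderivZ a l Wt lX0) (vpderiv_sum _ l Wt lsum) -addrA; congr (_ + _).
rewrite -big_split /=; apply: eq_bigr => j _.
rewrite (vpderiv_sum _ l Wt (fun m : 'I_N => lpX j m)).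
rewrite [in RHS]/dnum; under [X in _ = X + _]eq_bigr do rewrite scalerDr.
rewrite big_split /= [X in _ = X + _ + _]big_ord_recr /= ltnn scaler0 addr0.
rewrite [X in _ = _ + X + _]big_ord_recl /= scale0r if_same scaler0 add0r -!big_split /=.
apply: eq_bigr => m _; rewrite ltn_ord (vpderiv_pmul l oW Wt (hphi j m) (lX j m)) dphi.
rewrite scalerDl [LHS]addrC addrA; congr (_ + _ + _).
by case: ifP => _; rewrite ?mul0r ?scale0r ?scaler0 // mul1r mulrC scalerA.
Qed.

End FractionSum.
End FractionDerivatives.

(** * The action of meromorphic sections *)
Section MeromorphicAction.
Variable C : numClosedFieldType.
Hypothesis arch : forall e : C, 0 < e -> exists K : nat, 2^-1 ^+ K < e.
Variables (g : quad_lie C) (n : nat).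
Variables (psi : 'I_n -> nat -> set (cartan_dual g)) (chi : 'I_n -> affine g -> C^o).
Local Notation pt := 'rV[C]_n.
Local Notation M := (Mhat psi chi).
Local Notation SA := (@slot_act C g n psi chi).
Local Notation gact := (@gDact C g n psi chi).
Local Notation gact_sec := (@gDact_sec C g n psi chi).
Variable kappa : C.
Hypothesis saP : forall j, smooth_module kappa (SA j).
Implicit Types (U W : set pt) (t u : pt) (i j l : 'I_n) (v : M) (f : pt -> C -> g).

Lemma gDact_lin t (f : C -> g) : linear_on setT (gact t f).
Proof.
move=> a v w _ _; rewrite /gDact scaler_sumr -big_split; apply: eq_bigr => j _ /=.
by rewrite (act_linr (saP j)).
Qed.

Lemma slot_act_bilinear j k :
  (forall v, linear_on setT (fun x => SA j (aX x k) v)) /\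
  (forall x : g, linear_on setT (SA j (aX x k))).
Proof.
split=> [v a x y _ _|x]; last exact: act_linr (saP j) _.
by rewrite (aX_lin k) // (act_linl (saP j)).
Qed.

(** A bound on the relevant Laurent coefficients that is uniform over a
    finite-dimensional subspace. *)
Lemma gDact_truncate (N K : nat) (e : 'I_K -> M) : exists J : nat,
  forall j (a : laurent g) (c : 'I_K -> C), (forall k : int, k < - N%:Z -> a k = 0) ->
  SA j (a, 0) (\sum_b c b *: e b) =
  \sum_(p < J) SA j (aX (a (- N%:Z + p%:Z)) (- N%:Z + p%:Z)) (\sum_b c b *: e b).
Proof.
have /(_ _ _)/cid JP j b := act_truncate (saP j) (- N%:Z) (e b).
pose J := (\max_j \max_b sval (JP j b))%N; exists J => j a c aN.
under [RHS]eq_bigr do rewrite (linear_on_sumZ ((slot_act_bilinear j _).2 _)).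
rewrite (linear_on_sumZ (act_linr (saP j) _)) exchange_big; apply: eq_bigr => b _ /=.
rewrite -scaler_sumr; congr (_ *: _); apply: (svalP (JP j b)) aN _.
by apply: leq_trans (leq_bigmax (F := fun j => \max_b sval (JP j b))%N j); apply: (leq_bigmax (F := fun b => sval (JP j b))).
Qed.

(** On a small open set a section of the meromorphic algebra is a partial fraction
    with holomorphic numerators. *)
Definition pf_section W f N (X0 : pt -> g) (X : 'I_n -> nat -> pt -> g) :=
  [/\ open W, W `<=` config, lsec W X0, forall j m, lsec W (X j m) &
    forall u, W u -> forall z, off u z -> f u z = pfrac u N (X0 u) (fun j m => X j m u) z].

Lemma gDsec_local U f t : open U -> U `<=` config -> gDsec U f -> U t ->
  exists W N X0 X, [/\ W t, W `<=` U & pf_section W f N X0 X].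
Proof.
move=> oU Uc hf Ut; have [W [oW Wt [N [X0 [X [lX0 lX fE]]]]]] := hf t Ut.
exists (U `&` W), N, X0, X; split=> [||]; [by []|by move=> ? []|].
split=> [||||u [_ Wu]]; [exact: openI|by move=> ? [/Uc]| | |exact: fE].
  by apply: lsec_sub lX0 => ? [].
by move=> j m; apply: lsec_sub (lX j m) => ? [].
Qed.

Lemma pf_section_laurent W f N X0 X u j : pf_section W f N X0 X -> W u ->
  laurent_at (f u) (u ord0 j) = pf_laurent N X0 X j u.
Proof.
move=> [oW Wc lX0 lX fE] Wu; apply: (laurent_at_unique arch (N := N)).
by apply: (pf_laurent_on arch); [exact: Wc|exact: fE].
Qed.

Lemma off_open (z : C) : open [set u : pt | off u z].
Proof.
rewrite openE => t tz; rewrite /interior.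
apply: (@filter_forall _ _ (fun j (u : pt) => z != u ord0 j) (nbhs t)) => j.
have cj := @coord_cont C n j t.
have nz : \forall x \near (t ord0 j : C^o), x != z.
  exists `|t ord0 j - z| => /=; first by rewrite normr_gt0 subr_eq0 eq_sym; apply: tz.
  by move=> x /=; apply: contraTneq => ->; rewrite ltxx.
by have := cj _ nz; rewrite /= /nbhs /=; apply: (@filterS _ (nbhs t)) => u; rewrite /= eq_sym.
Qed.

Lemma pf_coefE N X0 X i k : pf_coef N X0 X i k =
  @frac_sum C n g N X0 X (k == 0)%:R (fun j m => frac_coef i j m k).
Proof. by []. Qed.

Lemma pf_section_coef W f N X0 X j k : pf_section W f N X0 X -> lsec W (pf_coef N X0 X j k).
Proof.
move=> [oW Wc lX0 lX fE]; rewrite pf_coefE; apply: lsec_frac_sum => // j' m.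
exact: frac_coef_holo.
Qed.

Lemma pf_coef_vpderiv W f N X0 X l i k t : pf_section W f N X0 X -> W t ->
  vpderiv l (pf_coef N X0 X i k) t =
  pf_coef N.+1 (vpderiv l X0) (dnum N X l) i k t
  + (if l == i then (k + 1)%:~R *: pf_coef N X0 X i (k + 1) t else 0).
Proof.
move=> [oW Wc lX0 lX fE] Wt; rewrite pf_coefE.
rewrite (@frac_sum_vpderiv C n g N X0 X W oW lX0 lX _ _ (fun j m =>
  (l == i)%:R * ((k + 1)%:~R * frac_coef i j m (k + 1) t)) l t Wt) //; first last.
- by move=> j m; apply: (frac_coef_pderiv l i j m k oW Wc Wt).
- by move=> j m; apply: frac_coef_holo.
congr (_ + _); case: (l == i); last first.
  by apply: big1 => j _; apply: big1 => m _; rewrite mul0r scale0r.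
rewrite /pf_coef scalerDr scalerA [X in X *: X0 t](_ : _ = 0) ?scale0r ?add0r; last first.
  by case: eqP => [->|_]; rewrite ?mul0r ?mulr0.
rewrite scaler_sumr; apply: eq_bigr => j _; rewrite scaler_sumr; apply: eq_bigr => m _.
by rewrite scalerA mul1r.
Qed.

Lemma pf_section_pderiv W f N X0 X l : pf_section W f N X0 X ->
  pf_section W (gDpderiv l f) N.+1 (vpderiv l X0) (dnum N X l).
Proof.
move=> [oW Wc lX0 lX fE]; split=> //; first exact: lsec_vpderiv.
  by move=> j m; apply: lsec_dnum.
move=> t Wt z tz; pose W' := W `&` [set u | off u z].
have oW' : open W' by apply: openI => //; apply: off_open.
have W't : W' t by [].
have lX0' : lsec W' X0 by apply: lsec_sub lX0 => ? [].
have lX' j m : lsec W' (X j m) by apply: lsec_sub (lX j m) => ? [].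
pose D j (u : pt) : C^o := -1 * u ord0 j + z.
have DE j u : D j u = z - u ord0 j by rewrite /D mulN1r addrC.
have hz : holo W' (fun=> z : C^o) by apply: holo_cst.
have hc j := holo_coord j oW'.
have hD j : holo W' (D j) by apply: holo_lin.
have D0 j u : W' u -> D j u != 0 by move=> [_ uz]; rewrite DE subr_eq0.
have dD j : pderiv l (D j) t = - (l == j)%:R.
  by rewrite (pderiv_lin (-1) l (hc j) hz W't) pderiv_coord pderiv_cst addr0 mulN1r.
have hphi j m : holo W' (fun u => D j u ^- m.+1 : C^o) by apply: holo_negexp => //; exact: D0.
have E := @frac_sum_vpderiv C n g N X0 X W' oW' lX0' lX' 1
  (fun j m u => D j u ^- m.+1 : C^o) (fun _ _ => 0) l t W't hphi.
rewrite /gDpderiv.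
transitivity (vpderiv l (frac_sum N X0 X 1 (fun j m u => D j u ^- m.+1 : C^o)) t).
  apply/esym/(vpderiv_ext l oW' W't); first exact: lsec_frac_sum.
  move=> u [Wu uz]; rewrite fE // /frac_sum /pfrac scale1r; congr (_ + _).
  by apply: eq_bigr => j _; apply: eq_bigr => m _; rewrite DE.
rewrite E => [|j m].
  rewrite scale1r [X in _ + X]big1 ?addr0 => [|j _]; last first.
    by apply: big1 => m _; rewrite scale0r.
  by congr (_ + _); apply: eq_bigr => j _; apply: eq_bigr => m _; rewrite DE.
rewrite (pderiv_negexp m.+1 l oW' W't (D0 j) (hD j)) dD addr0.
by case: (l == j); rewrite ?oppr0 ?mulr0 ?mul0r // mul1r mulrN1 opprK.
Qed.

Lemma gDsec_gDpderiv U f l : open U -> U `<=` config -> gDsec U f -> gDsec U (gDpderiv l f).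
Proof.
move=> oU Uc hf t Ut; have [W [N [X0 [X [Wt WU pf]]]]] := gDsec_local oU Uc hf Ut.
have [oW Wc lX0 lX fE] := pf_section_pderiv l pf.
by exists W; split=> //; exists N.+1, (vpderiv l X0), (dnum N X l).
Qed.

(** The pairing of the Laurent coefficients of [f] with a section [s]; the common
    lower bound [N.+1] of the orders serves [f], its derivative and its expansion
    differentiated in the coordinate. *)
Lemma gDact_sec_truncate W f N X0 X k (c : 'I_k -> pt -> C^o) e s :
  pf_section W f N X0 X -> decomp W c e s -> exists J : nat,
  (forall (a : 'I_n -> laurent g) (b : 'I_k -> C),
     (forall j (q : int), q < - N.+1%:Z -> a j q = 0) -> forall j,
     SA j (a j, 0) (\sum_x b x *: e x) = \sum_(p < J)
       SA j (aX (a j (- N.+1%:Z + p%:Z)) (- N.+1%:Z + p%:Z)) (\sum_x b x *: e x)) /\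
  (forall u, W u -> gact_sec f s u = \sum_j \sum_(p < J)
     SA j (aX (pf_coef N X0 X j (- N.+1%:Z + p%:Z) u) (- N.+1%:Z + p%:Z)) (s u)).
Proof.
move=> pf [hc sE]; have [J JP] := gDact_truncate N.+1 e; exists J; split=> [a b aN j|u Wu].
  by apply: JP; apply: aN.
rewrite /gDact_sec /gDact; apply: eq_bigr => j _.
rewrite (pf_section_laurent j pf Wu) sE // JP // => q qN.
by apply: pf_coef_below; lia.
Qed.

Lemma local_data U f (s : pt -> M) t : open U -> U `<=` config -> gDsec U f -> lsec U s -> U t ->
  exists W N X0 X k (c : 'I_k -> pt -> C^o) e,
    [/\ W t, W `<=` U, pf_section W f N X0 X & decomp W c e s].
Proof.
move=> oU Uc hf sl Ut.
have [W0 [N [X0 [X [W0t W0U [oW0 W0c lX0 lX fE]]]]]] := gDsec_local oU Uc hf Ut.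
have [W1 [oW1 W1t [k [c [e dec1]]]]] := sl t Ut.
exists (W0 `&` W1), N, X0, X, k, c, e; split=> [||| ].
- by [].
- by move=> u [/W0U].
- split; [exact: openI|by move=> ? [/W0c]| | |by move=> ? [/fE]].
    by apply: lsec_sub lX0 => ? [].
  by move=> j m; apply: lsec_sub (lX j m) => ? [].
- by apply: decomp_sub dec1 => ? [].
Qed.

Theorem lsec_gDact U f s : open U -> U `<=` config -> gDsec U f -> lsec U s ->
  lsec U (gact_sec f s).
Proof.
move=> oU Uc hf sl; apply: lsec_local => t Ut.
have [W [N [X0 [X [k [c [e [Wt WU pf dec]]]]]]]] := local_data oU Uc hf sl Ut.
have [J [_ E]] := gDact_sec_truncate pf dec; have [oW _ _ _ _] := pf.
exists W; split=> //; apply: (lsec_ext oW (fun u Wu => esym (E u Wu))).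
apply: lsec_sum => j; apply: lsec_sum => p.
have [Bl Br] := slot_act_bilinear j (- N.+1%:Z + p%:Z).
apply: (lsec_bilinear Bl Br); first exact: pf_section_coef pf.
exact: lsec_sub WU sl.
Qed.

(** Leibniz rule for the action: besides the derivatives of the two factors there is
    the contribution of the moving expansion point [t_l] in the slot [l]. *)
Theorem vpderiv_gDact U f s l t : open U -> U `<=` config -> gDsec U f -> lsec U s -> U t ->
  vpderiv l (gact_sec f s) t = gact_sec (gDpderiv l f) s t
    + SA l (dlaurent (laurent_at (f t) (t ord0 l)), 0) (s t)
    + gact t (f t) (vpderiv l s t).
Proof.
move=> oU Uc hf sl Ut.
have [W [N [X0 [X [k [c [e [Wt WU pf dec]]]]]]]] := local_data oU Uc hf sl Ut.
have [J [T E]] := gDact_sec_truncate pf dec; have [oW _ _ _ _] := pf.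
pose q (p : 'I_J) : int := - N.+1%:Z + p%:Z.
have sW := lsec_sub WU sl.
have lcf j p := pf_section_coef j (q p) pf.
have lB j p : lsec W (fun u => SA j (aX (pf_coef N X0 X j (q p) u) (q p)) (s u)).
  by have [Bl Br] := slot_act_bilinear j (q p); apply: (lsec_bilinear Bl Br).
have lS j : lsec W (fun u => \sum_(p < J) SA j (aX (pf_coef N X0 X j (q p) u) (q p)) (s u)).
  by apply: lsec_sum.
rewrite -(vpderiv_ext l oW Wt _ (fun u Wu => esym (E u Wu))); last exact: lsec_sum.
rewrite (vpderiv_sum _ l Wt lS).
have dB j p : vpderiv l (fun u => SA j (aX (pf_coef N X0 X j (q p) u) (q p)) (s u)) t =
    SA j (aX (pf_coef N.+1 (vpderiv l X0) (dnum N X l) j (q p) t) (q p)) (s t)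
  + (if l == j then SA j (aX ((q p + 1)%:~R *: pf_coef N X0 X j (q p + 1) t) (q p)) (s t) else 0)
  + SA j (aX (pf_coef N X0 X j (q p) t) (q p)) (vpderiv l s t).
  have [Bl Br] := slot_act_bilinear j (q p).
  rewrite (vpderiv_bilinear Bl Br l Wt (lcf j p) sW) (pf_coef_vpderiv l j (q p) pf Wt).
  congr (_ + _); rewrite -[X in aX (X + _)]scale1r Bl // scale1r; congr (_ + _).
  by case: (l == j) => //; rewrite -(linear_of_eq (Bl (s t))) linear0.
under eq_bigr do rewrite (vpderiv_sum _ l Wt (lB _)).
under eq_bigr do (under eq_bigr do rewrite dB); under eq_bigr do rewrite !big_split.
rewrite !big_split /=; have [hc sE] := dec; apply: (f_equal2 +%R); first apply: (f_equal2 +%R).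
- rewrite /gDact_sec /gDact; apply: eq_bigr => j _.
  rewrite (pf_section_laurent j (pf_section_pderiv l pf) Wt) sE //.
  by rewrite (T (fun j => pf_laurent N.+1 _ _ j t)) // => j' r; apply: pf_coef_below.
- rewrite (bigD1 l) //= eqxx [X in _ + X]big1 ?addr0 => [|j /negPf jl]; last first.
    by rewrite eq_sym jl big1.
  rewrite (pf_section_laurent l pf Wt) sE // (T (fun=> dlaurent (pf_laurent N X0 X l t))) // => _ r rN.
  by rewrite /= pf_coef_below ?scaler0 //; lia.
rewrite /gDact (vpderivE l oW Wt dec); apply: eq_bigr => j _.
rewrite (pf_section_laurent j pf Wt) (T (fun j => pf_laurent N X0 X j t)) // => j' r rN.
by apply: pf_coef_below; lia.
Qed.

End MeromorphicAction.

(** * Connections with constant commuting coefficients *)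
Section ConstantConnection.
Variables (C : numClosedFieldType) (n : nat) (V : lmodType C) (T : 'I_n -> V -> V).
Hypotheses (Tl : forall i, linear_on setT (T i)) (Tc : forall i j v, T i (T j v) = T j (T i v)).
Local Notation pt := 'rV[C]_n.
Local Notation w := (fun i (_ : pt) => T i).
Implicit Types (U W : set pt) (s : pt -> V) (t u : pt) (i j : 'I_n).

Lemma constant_strongly_flat : strongly_flat w.
Proof. by move=> i j t _; split=> v; [rewrite !vpderiv_cst|apply: Tc]. Qed.

Lemma opp_linear_on (W : lmodType C) (S : V -> W) : linear_on setT S ->
  linear_on setT (fun v => - S v).
Proof. by move=> Sl a x y _ _; rewrite Sl // opprD scalerN. Qed.

Lemma lsec_nabla U i s : lsec U s -> lsec U (nabla w i s).
Proof.
move=> sl; apply: lsecD; first exact: lsec_vpderiv.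
exact: (lsec_linear (opp_linear_on (Tl i))).
Qed.

Lemma nabla_ext U i s s' t : open U -> U t -> lsec U s -> (forall u, U u -> s u = s' u) ->
  nabla w i s t = nabla w i s' t.
Proof. by move=> oU Ut sl ss'; rewrite /nabla (vpderiv_ext i oU Ut sl ss') ss'. Qed.

Lemma nabla_lin U i a s s' t : lsec U s -> lsec U s' -> U t ->
  nabla w i (fun u => a *: s u + s' u) t = a *: nabla w i s t + nabla w i s' t.
Proof.
move=> sl sl' Ut; rewrite /nabla (vpderivD i Ut (lsecZ a sl) sl') (vpderivZ a i Ut sl).
by rewrite Tl // opprD scalerBr addrACA.
Qed.

Lemma constant_connection : is_connection (pmul (V := V)) lsec (nabla w).
Proof.
move=> U i oU _; split=> [s|s s' sl sl' ss' t Ut|s s' sl sl' t Ut|c s hc sl t Ut].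
- exact: lsec_nabla.
- exact: nabla_ext oU Ut sl ss'.
- have := nabla_lin i 1 sl sl' Ut; rewrite scale1r.
  by congr (_ = _); congr (nabla w i _ t); apply: funext => u; rewrite scale1r.
rewrite /nabla (vpderiv_pmul i oU Ut hc sl) /pmul.
by rewrite -(linear_of_eq (Tl i)) linearZ /= scalerBr addrA.
Qed.

Lemma constant_flat : mixed_partials C -> is_flat lsec (nabla w).
Proof.
move=> mix U i j s oU _ sl t Ut; have ll k := lsec_linear (opp_linear_on (Tl k)) sl.
have E k l : nabla w k (nabla w l s) t = vpderiv k (vpderiv l s) t
    - (T l (vpderiv k s t) + T k (vpderiv l s t)) + T k (T l (s t)).
  rewrite {1}/nabla (vpderivD k Ut (lsec_vpderiv l sl) (ll l)).
  rewrite (vpderiv_linear (opp_linear_on (Tl l)) k Ut sl) /nabla.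
  have -> x y : T k (x - y) = T k x - T k y by rewrite -!(linear_of_eq (Tl k)) linearB.
  by rewrite opprB opprD !addrA [LHS]addrAC.
apply: etrans (E i j) (etrans _ (esym (E j i))).
rewrite (mixed_vpderiv i j mix Ut sl) (Tc i j (s t)).
exact (f_equal2 +%R (f_equal (fun x => _ - x) (addrC _ _)) erefl).
Qed.

Lemma constant_flat_connection : mixed_partials C ->
  flat_connection (pmul (V := V)) lsec (nabla w).
Proof. by move=> mix; split; [exact: constant_connection|exact: constant_flat]. Qed.

End ConstantConnection.

(** * Compatibility, and descent to the covacua *)
Section Covacua.
Variable C : numClosedFieldType.
Hypothesis arch : forall e : C, 0 < e -> exists K : nat, 2^-1 ^+ K < e.
Hypothesis mix : mixed_partials C.
Variables (g : quad_lie C) (h kappa : C).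
Hypotheses (hh : is_dual_coxeter g h) (kappah : kappa + h != 0).
Variables (X Y : 'I_(\dim {: g}) -> g) (hXY : dual_bases X Y).
Variables (n : nat) (r : 'I_n -> nat) (psi : 'I_n -> nat -> set (cartan_dual g)).
Hypothesis hpsi : forall i, parabolic_filtration (r i) (psi i).
Variables (lam : forall i : 'I_n, 'I_(r i) -> g -> C^o) (chi : 'I_n -> affine g -> C^o).
Hypothesis hchi : forall i, is_singular_char (psi i) (@lam i) kappa (chi i).
Local Notation pt := 'rV[C]_n.
Local Notation M := (Mhat psi chi).
Local Notation SA := (@slot_act C g n psi chi).
Local Notation gact := (@gDact C g n psi chi).
Local Notation gact_sec := (@gDact_sec C g n psi chi).
Local Notation image_near := (near_sec (@gDimage_sec C g n psi chi)).
Local Notation class := (@covac_class C g n psi chi).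
Local Notation vir i := (slot_vir (psi := psi) (chi := chi) X Y h kappa (-1) i).
Local Notation mvir := (fun i (_ : pt) v => - vir i v).
Local Notation D i := (nabla mvir i).
Implicit Types (U W : set pt) (t u : pt) (i j l : 'I_n) (v : M) (f : pt -> C -> g) (s : pt -> M).

Let saP := slot_smooth hh kappah hXY hpsi hchi.

Lemma vir_lin i : linear_on setT (vir i).
Proof. by move=> a x y _ _; exact: (slot_vir_lin hh hXY hpsi hchi i a). Qed.

Lemma mvir_lin i : linear_on setT (fun v => - vir i v).
Proof. exact: opp_linear_on (vir_lin i). Qed.

Lemma mvir_comm i j v : - vir i (- vir j v) = - vir j (- vir i v).
Proof.
have virN k x : vir k (- x) = - vir k x by rewrite -!(linear_of_eq (vir_lin k)) linearN.
by rewrite !virN (slot_vir_comm hh hXY hpsi hchi).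
Qed.

Lemma vir_gDact i t (f : C -> g) v : vir i (gact t f v) =
  gact t f (vir i v) - SA i (dlaurent (laurent_at f (t ord0 i)), 0) v.
Proof.
rewrite /gDact -(linear_of_eq (vir_lin i)) linear_sum /=.
under eq_bigr => j _ do rewrite (slot_vir_act hh kappah hXY hpsi hchi).
rewrite sumrB; congr (_ - _).
by rewrite (bigD1 i) //= eqxx big1 ?addr0 // => j /negPf ji; rewrite eq_sym ji.
Qed.

(** The contribution of the moving expansion point to the derivative of [f . s] is
    cancelled by the commutator of [f] with [L_(-1)]. *)
Theorem nabla_gDact U f s i t : open U -> U `<=` config -> gDsec U f -> lsec U s -> U t ->
  D i (gact_sec f s) t - gact_sec f (D i s) t = gact_sec (gDpderiv i f) s t.
Proof.
move=> oU Uc hf sl Ut; rewrite /nabla (vpderiv_gDact arch saP i oU Uc hf sl Ut).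
rewrite !opprK [vir i _](vir_gDact i t (f t) (s t)) /gDact_sec.
have -> x y : gact t (f t) (x + y) = gact t (f t) x + gact t (f t) y.
  by rewrite -!(linear_of_eq (gDact_lin saP t (f t))) linearD.
have arith (V : zmodType) (a b c d : V) : a + b + c + (d - b) - (c + d) = a.
  apply/eqP; rewrite subr_eq [a + b + c]addrAC -[_ + _ + (d - b)]addrA [b + _]addrC.
  by rewrite subrK addrA.
by rewrite opprK; apply: arith.
Qed.

Lemma gDsec_sub U W f : W `<=` U -> gDsec U f -> gDsec W f.
Proof. by move=> WU hf t /WU/hf. Qed.

Lemma gDsec_gD U f t : gDsec U f -> U t -> gD t (f t).
Proof.
move=> hf /hf[W [_ Wt [N [X0 [X' [_ _ fE]]]]]].
by exists N, (X0 t), (fun j m => X' j m t); apply: fE.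
Qed.

(** An element of the algebra at one point extends to a section, with constant
    numerators. *)
Lemma gD_extend t (f : C -> g) : config t -> gD t f ->
  exists F : pt -> C -> g, (forall U, open U -> gDsec U F) /\ forall v, gact t (F t) v = gact t f v.
Proof.
move=> ct [N [X0 [X' fE]]]; exists (fun u => pfrac u N X0 X'); split=> [U oU u Uu|v].
  by exists U; split=> //; exists N, (fun=> X0), (fun j m => fun=> X' j m); split=> // *; apply: lsec_cst.
apply: eq_bigr => j _; congr (SA j (_, 0) v).
rewrite (laurent_at_unique arch (pf_laurent_on arch (N := N) (X0 := fun=> X0) (X := fun j m _ => X' j m) j ct _)) //.
by apply/esym/(laurent_at_unique arch (N := N)); apply: (pf_laurent_on arch).
Qed.

Lemma lsec_image U s : open U -> U `<=` config -> gDimage_sec U s -> lsec U s.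
Proof.
move=> oU Uc hs; apply: lsec_local => t Ut.
have [W [oW Wt [k [f [v [hf hv sE]]]]]] := hs t Ut; have oUW := openI oU oW.
exists (U `&` W); split=> //.
apply: (lsec_ext oUW (s := fun u => \sum_a gact_sec (f a) (v a) u)) => [u [_ Wu]|].
  by rewrite sE.
apply: lsec_sum => a; apply: (lsec_gDact arch saP oUW) => [u [/Uc]//||].
  by apply: gDsec_sub (hf a) => ? [].
by apply: lsec_sub (hv a) => ? [].
Qed.

Lemma image_nearP t s : image_near t s <->
  exists W, [/\ open W, W t, W `<=` config & exists k (f : 'I_k -> pt -> C -> g) (v : 'I_k -> pt -> M),
    [/\ forall a, gDsec W (f a), forall a, lsec W (v a) &
        forall u, W u -> s u = \sum_a gact_sec (f a) (v a) u]].
Proof.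
split=> [[W [oW Wt Wc hs]]|[W [oW Wt Wc hs]]]; last first.
  by exists W; split=> // u Wu; exists W.
have [W' [oW' W't [k [f [v [hf hv sE]]]]]] := hs t Wt.
exists (W `&` W'); split=> // [|u [/Wc]//|]; first exact: openI.
exists k, f, v; split=> [a|a|u [_ /sE]//]; first by apply: gDsec_sub (hf a) => ? [].
by apply: lsec_sub (hv a) => ? [].
Qed.

Lemma image_near_lin t a s s' : image_near t s -> image_near t s' ->
  image_near t (fun u => a *: s u + s' u).
Proof.
move=> /image_nearP[W [oW Wt Wc [k [f [v [hf hv sE]]]]]].
move=> /image_nearP[W' [oW' W't _ [k' [f' [v' [hf' hv' sE']]]]]].
apply/image_nearP; exists (W `&` W'); split=> // [|u [/Wc]//|]; first exact: openI.
exists (k + k')%N, (fun b => match fintype.split b with inl b => f b | inr b => f' b end).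
exists (fun b => match fintype.split b with inl b => fun u => a *: v b u | inr b => v' b end).
split=> [b|b|u [Wu W'u]].
- by case: (fintype.split b) => c; [apply: gDsec_sub (hf c)|apply: gDsec_sub (hf' c)] => ? [].
- case: (fintype.split b) => c; first by apply: lsecZ; apply: lsec_sub (hv c) => ? [].
  by apply: lsec_sub (hv' c) => ? [].
rewrite (sE u Wu) (sE' u W'u) big_split_ord scaler_sumr.
apply: f_equal2; apply: eq_bigr => b _.
  rewrite -[lshift _ _]/(fintype.unsplit (inl b)) fintype.unsplitK.
  by rewrite /gDact_sec -!(linear_of_eq (gDact_lin saP u (f b u))) linearZ.
by rewrite -[rshift _ _]/(fintype.unsplit (inr b)) fintype.unsplitK.
Qed.

Lemma image_near_ext W t s s' : open W -> W t -> (forall u, W u -> s u = s' u) ->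
  image_near t s -> image_near t s'.
Proof.
move=> oW Wt ss' /image_nearP[W' [oW' W't Wc [k [f [v [hf hv sE]]]]]].
apply/image_nearP; exists (W `&` W'); split=> // [|u [_ /Wc]//|]; first exact: openI.
exists k, f, v; split=> [a|a|u [Wu /sE <-]]; last by rewrite ss'.
  by apply: gDsec_sub (hf a) => ? [].
by apply: lsec_sub (hv a) => ? [].
Qed.

Lemma image_near0 W t : open W -> W t -> W `<=` config -> image_near t (fun=> 0).
Proof.
move=> oW Wt Wc; apply/image_nearP; exists W; split=> //.
by exists 0%N, (fun _ _ _ => 0), (fun _ _ => 0); split=> [[]//|[]//|u _]; rewrite big_ord0.
Qed.

Lemma image_near_act W t f s : open W -> W t -> W `<=` config -> gDsec W f -> lsec W s ->
  image_near t (gact_sec f s).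
Proof.
move=> oW Wt Wc hf hs; apply/image_nearP; exists W; split=> //.
by exists 1%N, (fun=> f), (fun=> s); split=> // u _; rewrite big_ord1.
Qed.

(** By compatibility the connection preserves the image of the algebra. *)
Lemma image_near_nabla t s i : image_near t s -> image_near t (D i s).
Proof.
move=> /image_nearP[W [oW Wt Wc [k [f [v [hf hv sE]]]]]].
have sl : lsec W (fun u => \sum_a gact_sec (f a) (v a) u).
  by apply: lsec_sum => a; apply: (lsec_gDact arch saP oW).
have E u : W u -> \sum_a (gact_sec (f a) (D i (v a)) u + gact_sec (gDpderiv i (f a)) (v a) u) = D i s u.
  move=> Wu; rewrite -(nabla_ext (fun i v => - vir i v) i oW Wu sl) => [|x /sE//].
  rewrite [RHS]/nabla (vpderiv_sum _ i Wu) => [|a]; last exact: (lsec_gDact arch saP oW).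
  rewrite -[X in _ - X](linear_of_eq (mvir_lin i)) linear_sum -sumrB; apply: eq_bigr => a _.
  by rewrite -(nabla_gDact i oW Wc (hf a) (hv a) Wu) addrC subrK linear_of_eq.
apply: (image_near_ext oW Wt E); move=> {E sE sl}.
have acts a : image_near t (fun u => gact_sec (f a) (D i (v a)) u + gact_sec (gDpderiv i (f a)) (v a) u).
  have h1 : image_near t (gact_sec (f a) (D i (v a))).
    by apply: (image_near_act oW) => //; apply: (lsec_nabla mvir_lin).
  have h2 : image_near t (gact_sec (gDpderiv i (f a)) (v a)).
    by apply: (image_near_act oW) => //; apply: gDsec_gDpderiv.
  apply: (image_near_ext oW Wt) (image_near_lin 1 h1 h2) => u _; by rewrite scale1r.
elim: (index_enum _) => [|a l IH].
  by apply: (image_near_ext oW Wt) (image_near0 oW Wt Wc) => u _; rewrite big_nil.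
apply: (image_near_ext oW Wt) (image_near_lin 1 (acts a) IH) => u _.
by rewrite big_cons scale1r.
Qed.

(** The classes at [t] only see the points of the configuration space, so a
    neighbourhood inside it is available as soon as [t] lies there. *)
Lemma lspan_image_near W t s : open W -> W t -> W `<=` config ->
  lspan (image_near t) s -> image_near t s.
Proof.
move=> oW Wt Wc; elim=> [//||a x y _ hx _ hy]; last exact: image_near_lin.
exact: image_near0 oW Wt Wc.
Qed.

Lemma covac_class_eq W t s s' : open W -> W t -> W `<=` config ->
  class s t = class s' t <-> image_near t (fun u => s u - s' u).
Proof.
move=> oW Wt Wc; split=> [/qpiP|H]; first exact: lspan_image_near oW Wt Wc.
by apply/qpiP/lspan_in.
Qed.

Lemma covac_class_ext W t s s' : open W -> W t -> W `<=` config ->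
  (forall u, W u -> s u = s' u) -> class s t = class s' t.
Proof.
move=> oW Wt Wc ss'; apply/(covac_class_eq s s' oW Wt Wc).
apply: (image_near_ext oW Wt) (image_near0 oW Wt Wc) => u Wu.
by rewrite ss' // subrr.
Qed.

Lemma covac_class_lin a s s' t : class (fun u => a *: s u + s' u) t = a *: class s t + class s' t.
Proof. exact: (@qpi_linear C _ (image_near t) a s s' I I). Qed.

Theorem covac_fibre_at t : config t -> covac_fibre psi chi t.
Proof.
move=> ct s [W [oW Wt Wc sl]]; split=> [hs|[s0 [[W0 [oW0 W0t _ sl0]] s00]]].
  have [s1 [hs1 s1t]] : exists s1, image_near t s1 /\ s1 t = s t.
    elim: hs => [_ [f hf [v ->]]||a x y _ [s1 [h1 <-]] _ [s2 [h2 <-]]].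
    - have [F [hF FE]] := gD_extend ct hf; exists (gact_sec F (fun=> v)); split.
        by apply: (image_near_act oW) => //; [exact: hF|exact: lsec_cst].
      exact: FE.
    - by exists (fun=> 0); split=> //; apply: image_near0 oW Wt Wc.
    - by exists (fun u => a *: s1 u + s2 u); split=> //; apply: image_near_lin.
  have [W1 [oW1 W1t W1c /(lsec_image oW1 W1c) sl1]] := hs1.
  have oWW1 : open (W `&` W1) by apply: openI.
  exists (fun u => (-1) *: s1 u + s u).
    split; last by rewrite s1t scaleN1r addNr.
    exists (W `&` W1); split=> [//|//|u [/Wc]//|]; apply: lsecD.
      by apply: lsecZ; apply: lsec_sub sl1 => ? [].
    by apply: lsec_sub sl => ? [].
  apply/(covac_class_eq _ _ oW Wt Wc); apply: (image_near_ext oW Wt) hs1 => u _.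
  by rewrite scaleN1r opprD opprK addrCA subrr addr0.
move/(covac_class_eq s s0 oW Wt Wc)/image_nearP => [W1 [oW1 W1t W1c [k [f [v [hf hv E]]]]]].
rewrite -[s t]subr0 -s00 E //; elim/big_rec: _ => [|a x _ hx]; first exact: lspan_0.
apply: lspanD => //; apply: lspan_in; exists (f a t); first exact: gDsec_gD (hf a) W1t.
by exists (v a t).
Qed.

Definition represents t (x : forall u, covac psi chi u) s := exists W,
  [/\ open W, W t, W `<=` config, lsec W s & forall u, W u -> x u = class s u].

Definition covac_nabla i (x : forall u, covac psi chi u) t : covac psi chi t :=
  class (D i (xget (fun=> 0) (represents t x))) t.

Lemma covac_nablaE i x t s : represents t x s -> covac_nabla i x t = class (D i s) t.
Proof.
move=> hs; rewrite /covac_nabla; case: xgetP => [s' _ hs'|/(_ s)/(_ hs)[]].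
have [W [oW Wt Wc sl xs]] := hs; have [W' [oW' W't _ sl' xs']] := hs'.
have oWW' : open (W `&` W') by apply: openI.
apply/(covac_class_eq _ _ oW Wt Wc).
have /(covac_class_eq _ _ oW Wt Wc)/(image_near_nabla i) : class s' t = class s t.
  by rewrite -xs // -xs'.
apply: (image_near_ext oWW') => // u [Wu W'u].
have lW : lsec (W `&` W') s by apply: lsec_sub sl => ? [].
have lW' : lsec (W `&` W') s' by apply: lsec_sub sl' => ? [].
transitivity (D i (fun u => (-1) *: s u + s' u) u).
  congr (D i _ u); apply: funext => z; by rewrite scaleN1r addrC.
by rewrite (nabla_lin mvir_lin i (-1) lW lW') // scaleN1r addrC.
Qed.

Lemma covac_sec_represents U x t : open U -> U `<=` config -> covac_sec U x -> U t ->
  exists W s, [/\ W t, W `<=` U, open W, lsec W s & forall u, W u -> x u = class s u].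
Proof.
move=> oU Uc hx Ut; have [W [s [oW Wt sl xs]]] := hx t Ut.
exists (U `&` W), s; split=> [//|u []//||| u [_ /xs]//]; first exact: openI.
by apply: lsec_sub sl => ? [].
Qed.

Lemma covac_mul_class W t (c : pt -> C^o) x s : open W -> W t -> W `<=` config -> holo W c ->
  x t = class s t -> covac_mul c x t = class (pmul c s) t.
Proof.
move=> oW Wt Wc hc xs; rewrite /covac_mul xs; apply: (qliftE (S := image_near t)) => [a s1 s2 _ _|s1].
  rewrite -covac_class_lin; apply: (covac_class_ext oW Wt Wc) => u _.
  by rewrite /pmul -[(a *: s1 + s2) u]/(a *: s1 u + s2 u) scalerDr !scalerA mulrC.
move=> /image_nearP[W1 [oW1 W1t W1c [k [f [v [hf hv E]]]]]].
apply/qpi_eq0/lspan_in/image_nearP; exists (W `&` W1).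
have oWW1 : open (W `&` W1) by apply: openI.
split=> [//|//|u [/Wc]//|]; exists k, f, (fun a => pmul c (v a)); split=> [a|a|u [Wu W1u]].
- by apply: gDsec_sub (hf a) => ? [].
- apply: lsec_pmul => //; first by apply: holo_sub hc => ? [].
  by apply: lsec_sub (hv a) => ? [].
rewrite /pmul E // scaler_sumr; apply: eq_bigr => a _.
by rewrite /gDact_sec -!(linear_of_eq (gDact_lin saP u (f a u))) linearZ.
Qed.

Let nablaP : is_connection (pmul (V := M)) lsec (nabla mvir) := constant_connection mvir_lin.

Lemma covac_connection : is_connection (@covac_mul C g n psi chi) (@covac_sec C g n psi chi) covac_nabla.
Proof.
move=> U i oU Uc; split=> [x hx t Ut|x y hx hy xy t Ut|x y hx hy t Ut|c x hc hx t Ut].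
- have [W [s [Wt WU oW sl xs]]] := covac_sec_represents oU Uc hx Ut.
  exists W, (D i s); split=> [||| u Wu];
    [exact: oW|exact: Wt|exact: (lsec_nabla mvir_lin)|].
  by apply: (@covac_nablaE i x u s); exists W; split=> // z /WU/Uc.
- have [W [s [Wt WU oW sl xs]]] := covac_sec_represents oU Uc hx Ut.
  have Wc : W `<=` config by move=> z /WU/Uc.
  rewrite (@covac_nablaE i x t s); last by exists W.
  by rewrite (@covac_nablaE i y t s) //; exists W; split=> // u Wu; rewrite -xy ?xs //; exact: WU.
- have [W1 [s1 [W1t W1U oW1 sl1 xs1]]] := covac_sec_represents oU Uc hx Ut.
  have [W2 [s2 [W2t W2U oW2 sl2 xs2]]] := covac_sec_represents oU Uc hy Ut.
  pose W := W1 `&` W2; have oW : open W by apply: openI.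
  have Wc : W `<=` config by move=> z [/W1U/Uc].
  have l1 : lsec W s1 by apply: lsec_sub sl1 => ? [].
  have l2 : lsec W s2 by apply: lsec_sub sl2 => ? [].
  have x1 u : W u -> x u = class s1 u by move=> [/xs1].
  have y2 u : W u -> y u = class s2 u by move=> [_ /xs2].
  rewrite (@covac_nablaE i x t s1); last by exists W.
  rewrite (@covac_nablaE i y t s2); last by exists W.
  rewrite (@covac_nablaE i _ t (fun u => 1 *: s1 u + s2 u)); last first.
    exists W; split=> // [|u Wu]; first by apply: lsecD => //; apply: lsecZ.
    by rewrite covac_class_lin scale1r x1 // y2.
  rewrite -[X in X + _]scale1r -covac_class_lin; apply: (covac_class_ext oW) => // u Wu.
  exact: (nabla_lin mvir_lin i 1 l1 l2 Wu).
have [W [s [Wt WU oW sl xs]]] := covac_sec_represents oU Uc hx Ut.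
have Wc : W `<=` config by move=> z /WU/Uc.
have hcW := holo_sub WU hc; have hdc := holo_pderiv i hcW.
have xD : covac_nabla i x t = class (D i s) t by apply: covac_nablaE; exists W.
rewrite (covac_mul_class oW Wt Wc hcW xD) (covac_mul_class oW Wt Wc hdc (xs t Wt)).
rewrite (@covac_nablaE i _ t (pmul c s)); last first.
  exists W; split=> [||||u Wu];
    [exact: oW|exact: Wt|exact: Wc|exact: lsec_pmul|exact: covac_mul_class oW Wu Wc hcW (xs u Wu)].
rewrite -[X in X + _]scale1r -covac_class_lin; apply: (covac_class_ext oW) => // u Wu.
by rewrite scale1r; have [_ _ _] := nablaP i oW Wc; apply.
Qed.

Lemma covac_flat : is_flat (@covac_sec C g n psi chi) covac_nabla.
Proof.
move=> U i j x oU Uc hx t Ut.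
have [W [s [Wt WU oW sl xs]]] := covac_sec_represents oU Uc hx Ut.
have Wc : W `<=` config by move=> z /WU/Uc.
have E k l : covac_nabla k (covac_nabla l x) t = class (D k (D l s)) t.
  apply: (@covac_nablaE k (covac_nabla l x) t (D l s)); exists W; split.
  - exact: oW.
  - exact: Wt.
  - exact: Wc.
  - exact: (lsec_nabla mvir_lin).
  by move=> u Wu; apply: (@covac_nablaE l x u s); exists W.
have Fl := constant_flat mvir_lin mvir_comm mix.
have F u : W u -> D i (D j s) u = D j (D i s) u.
  by move=> Wu; apply: Fl Wu.
have Eji := E j i; rewrite (E i j) (covac_class_ext oW Wt Wc F).
symmetry; exact Eji.
Qed.

Theorem covac_descent : exists Dc : 'I_n -> (forall t, covac psi chi t) -> forall t, covac psi chi t,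
  flat_connection (@covac_mul C g n psi chi) (@covac_sec C g n psi chi) Dc /\ forall U s, open U -> U `<=` config -> lsec U s -> forall i t, U t ->
    Dc i (class s) t = class (D i s) t.
Proof.
exists covac_nabla; split=> [|U s oU Uc sl i t Ut].
  by split; [exact: covac_connection|exact: covac_flat].
by apply: covac_nablaE; exists U.
Qed.

(** The dual connection is characterised by the Leibniz rule for the pairing. *)
Local Notation Dd i := (@dual_nabla C g n psi chi mvir i).
Local Notation dsec := (@dual_sec C g n psi chi).
Local Notation vsec := (@vac_sec C g n psi chi).
Implicit Types (p : pt -> M -> C^o).

Lemma dual_strongly_flat : strongly_flat (dual_form (psi := psi) (chi := chi) mvir).
Proof.
move=> i j t _; split=> [p|p]; first by rewrite !vpderiv_cst.
apply: funext => v; pose w i := dual_form (psi := psi) (chi := chi) mvir i t.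
have wE k l : w k (w l p) v = p (- vir l (- vir k v)) := opprK _.
exact: etrans (wE i j) (etrans (congr1 p (mvir_comm j i v)) (esym (wE j i))).
Qed.

Lemma dual_nabla_pairing U p s i t : open U -> dsec U p -> lsec U s -> U t ->
  pderiv i (fun u => p u (s u)) t = Dd i p t (s t) + p t (D i s t).
Proof.
move=> oU [pl ph] sl Ut; have [W [oW Wt [k [c [e [hc sE]]]]]] := sl t Ut.
pose W' := U `&` W; have oW' : open W' by apply: openI.
have W't : W' t by [].
have hc' a : holo W' (c a) by apply: holo_sub (hc a) => ? [].
have hp a : holo W' (fun u => p u (e a)) by apply: holo_sub (ph (e a)) => ? [].
have hM a : holo W' (fun u => c a u * p u (e a) : C^o) by apply: holo_mul.
have psum u x : U u -> p u (\sum_a x a *: e a) = \sum_a x a * p u (e a).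
  by move=> Uu; rewrite (linear_on_sumZ (pl u Uu)).
have -> : pderiv i (fun u => p u (s u)) t = pderiv i (fun u => \sum_a c a u * p u (e a)) t.
  by apply: (pderiv_ext i oW' W't) => u [Uu Wu]; rewrite sE // psum.
rewrite (pderiv_sum _ _ i oW' W't hM) /dual_nabla /nabla.
have -> : p t (vpderiv i s t - - vir i (s t)) = p t (vpderiv i s t) - p t (- vir i (s t)).
  by rewrite -!(linear_of_eq (pl t Ut)) linearB.
have -> : pderiv i (fun u => p u (s t)) t = \sum_a c a t * pderiv i (fun u => p u (e a)) t.
  have hcst a : holo W' (fun u => c a t * p u (e a) : C^o) by apply: holo_mul => //; apply: holo_cst.
  have -> : pderiv i (fun u => p u (s t)) t = pderiv i (fun u => \sum_a c a t * p u (e a)) t.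
    by apply: (pderiv_ext i oW' W't) => u [Uu Wu]; rewrite (sE t) // psum.
  rewrite (pderiv_sum _ _ i oW' W't hcst); apply: eq_bigr => a _.
  by rewrite (pderivM i (holo_cst W' (c a t)) (hp a) W't) pderiv_cst mulr0 addr0.
have -> : p t (vpderiv i s t) = \sum_a p t (e a) * pderiv i (c a) t.
  rewrite (@vpderivE _ _ _ W _ c e s i t) // psum //.
  by apply: eq_bigr => a _; rewrite mulrC.
have arith (V : zmodType) (a b w : V) : a + b = a + w + (b - w).
  by rewrite [b - w]addrC addrA addrK.
rewrite -arith -big_split; apply: eq_bigr => a _.
exact: pderivM (hc' a) (hp a) W't.
Qed.

Lemma dual_connection : is_connection (pmul (V := M -> C^o)) dsec (fun i => Dd i).
Proof.
move=> U i oU Uc; split=> [p [pl ph]|p p' [_ ph] [_ ph'] pp' t Ut|p p' [_ ph] [_ ph'] t Ut|c p hc [_ ph] t Ut].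
- split=> [t Ut a x y _ _|v]; last first.
    apply: (holo_ext oU) (holo_lin 1 oU (holo_pderiv i (ph v)) (ph (- vir i v))) => u _.
    by rewrite mul1r.
  have -> : Dd i p t (a *: x + y) = a * pderiv i (fun u => p u x) t + pderiv i (fun u => p u y) t
      + (a *: p t (- vir i x) + p t (- vir i y)).
    rewrite /dual_nabla mvir_lin // pl //; congr (_ + _).
    rewrite -(pderiv_lin a i (ph x) (ph y) Ut); apply: (pderiv_ext i oU Ut) => u Uu.
    by rewrite pl.
  by rewrite /dual_nabla scalerDr addrACA.
- apply: funext => v; rewrite /dual_nabla pp' //; congr (_ + _).
  by apply: (pderiv_ext i oU Ut) => u Uu; rewrite pp'.
- apply: funext => v; rewrite /dual_nabla -[RHS]addrACA; congr (_ + _).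
  have := pderiv_lin 1 i (ph v) (ph' v) Ut; rewrite mul1r => <-.
  by apply: (pderiv_ext i oU Ut) => u _; rewrite mul1r.
apply: funext => v; rewrite /dual_nabla.
transitivity (c t * pderiv i (fun u => p u v) t + p t v * pderiv i c t + c t * p t (- vir i v)).
  by congr (_ + _); apply: pderivM hc (ph v) Ut.
rewrite -[RHS]/(pderiv i c t * p t v + c t * (pderiv i (fun u => p u v) t + p t (- vir i v))).
by rewrite mulrDr addrA [p t v * _]mulrC [_ * pderiv i _ t + _]addrC.
Qed.

Lemma dual_flat : is_flat dsec (fun i => Dd i).
Proof.
move=> U i j p oU Uc [pl ph] t Ut; apply: funext => v.
have E k l : Dd k (Dd l p) t v = pderiv k (pderiv l (fun u => p u v)) t
    + (pderiv k (fun u => p u (- vir l v)) t + pderiv l (fun u => p u (- vir k v)) t)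
    + p t (- vir l (- vir k v)).
  rewrite /dual_nabla addrA [X in _ = X + _]addrA; congr (_ + _ + _).
  have := pderiv_lin 1 k (holo_pderiv l (ph v)) (ph (- vir l v)) Ut; rewrite mul1r => <-.
  by apply: (pderiv_ext k oU Ut) => u _; rewrite mul1r.
apply: etrans (E i j) (etrans _ (esym (E j i))).
have Em := mix i j oU (ph v) Ut.
exact (f_equal2 +%R (f_equal2 +%R Em (addrC _ _)) (f_equal (p t) (mvir_comm j i v))).
Qed.

Lemma vac_sec_nabla U p i : open U -> U `<=` config -> vsec U p -> vsec U (Dd i p).
Proof.
move=> oU Uc [hp vp]; split; first by have [+ _ _ _] := dual_connection i oU Uc; apply.
move=> t Ut f v ft; have [F [hF <-]] := gD_extend (Uc t Ut) ft.
have hFU := hF U oU; have lv := @lsec_cst C n M U v.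
have lFv := lsec_gDact arch saP oU Uc hFU lv.
have dF := gDsec_gDpderiv i oU Uc hFU.
have := dual_nabla_pairing i oU hp lFv Ut.
have -> : pderiv i (fun u => p u (gact_sec F (fun=> v) u)) t = 0.
  rewrite -[RHS](pderiv_cst 0 i t); apply: (pderiv_ext i oU Ut) => u Uu.
  by apply: vp => //; apply: gDsec_gD hFU Uu.
have /eqP := nabla_gDact i oU Uc hFU lv Ut; rewrite subr_eq => /eqP ->.
have -> x y : p t (x + y) = p t x + p t y.
  by have [pl _] := hp; rewrite -!(linear_of_eq (pl t Ut)) linearD.
rewrite /gDact_sec (vp t Ut _ _ (gDsec_gD dF Ut)) (vp t Ut _ _ (gDsec_gD hFU Ut)) !addr0.
by move=> <-.
Qed.

Lemma vac_connection : flat_connection (pmul (V := M -> C^o)) vsec (fun i => Dd i).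
Proof.
split=> [U i oU Uc|U i j p oU Uc [hp _] t Ut]; last exact: dual_flat hp t Ut.
have [_ ext add mul] := dual_connection i oU Uc.
split=> [p|p p' [hp _] [hp' _]|p p' [hp _] [hp' _]|c p hc [hp _]].
- exact: vac_sec_nabla.
- exact: ext.
- exact: add.
- exact: mul.
Qed.

End Covacua.

(** * The complex numbers *)
Lemma cplx_archimedean (R : realType) (e : cplx R) : 0 < e -> exists K : nat, 2^-1 ^+ K < e.
Proof.
move=> /cplx_pos[x x0 ->]; exists (Num.bound x^-1).
have -> : (2^-1 : cplx R) = ((2^-1 : R)%:C)%C by rewrite fmorphV rmorph_nat.
rewrite -rmorphXn ltcR exprVn -[X in _ < X]invrK ltf_pV2 ?posrE ?exprn_gt0 ?invr_gt0 //.
exact: upper_nthrootP.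
Qed.

Lemma cplx_mixed_partials (R : realType) : mixed_partials (cplx R).
Proof. by move=> n U c i j t oU hc Ut; exact: (mixed_pderiv j i oU hc Ut). Qed.

Theorem theorem1p4p3 (R : realType) (g : quad_lie (cplx R))
    (h kappa : cplx R) (hh : is_dual_coxeter g h) (hkappa : kappa != - h)
    (X Y : 'I_(\dim {: g}) -> g) (hXY : dual_bases X Y)
    (n : nat) (r : 'I_n -> nat) (hr : forall i, (0 < r i)%N)
    (psi : 'I_n -> nat -> set (cartan_dual g))
    (hpsi : forall i, parabolic_filtration (r i) (psi i))
    (lam : forall i : 'I_n, 'I_(r i) -> g -> (cplx R)^o)
    (hlam : forall i, formal_type (psi i) (lam i))
    (chi : 'I_n -> affine g -> (cplx R)^o)
    (hchi : forall i, is_singular_char (psi i) (lam i) kappa (chi i)) :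
  let M := Mhat psi chi in
  let varpi (i : 'I_n) (_ : 'rV[cplx R]_n) : M -> M :=
    slot_vir X Y h kappa (-1) i in
  let mvarpi i t v := - varpi i t v in
  let nablah := nabla mvarpi in
  [/\ [/\ strongly_flat varpi, strongly_flat mvarpi,
          flat_connection (pmul (V := M)) lsec (nabla varpi) &
          flat_connection (pmul (V := M)) lsec nablah],
      forall U (f : 'rV[cplx R]_n -> cplx R -> g) (s : 'rV[cplx R]_n -> M),
        open U -> U `<=` config -> gDsec U f -> lsec U s ->
        lsec U (gDact_sec f s) /\
        forall i, gDsec U (gDpderiv i f) /\ forall t, U t ->
          nablah i (gDact_sec f s) t - gDact_sec f (nablah i s) t =
          gDact_sec (gDpderiv i f) s t,
      (forall t, config t -> covac_fibre psi chi t) /\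
      exists D : 'I_n -> (forall t, covac psi chi t) -> forall t, covac psi chi t,
        flat_connection (@covac_mul _ g n psi chi) (@covac_sec _ g n psi chi) D /\
        forall U (s : 'rV[cplx R]_n -> M),
          open U -> U `<=` config -> lsec U s -> forall i t, U t ->
          D i (covac_class s) t = covac_class (nablah i s) t &
      let nablad := dual_nabla (psi := psi) (chi := chi) mvarpi in
      [/\ strongly_flat (dual_form (psi := psi) (chi := chi) mvarpi),
          flat_connection (pmul (V := M -> (cplx R)^o))
            (@dual_sec _ g n psi chi) nablad,
          flat_connection (pmul (V := M -> (cplx R)^o))
            (@vac_sec _ g n psi chi) nablad &
          forall U (p : 'rV[cplx R]_n -> M -> (cplx R)^o)
              (s : 'rV[cplx R]_n -> M),
            open U -> U `<=` config -> dual_sec U p -> lsec U s ->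
            forall i t, U t ->
            pderiv i (fun u => p u (s u)) t =
            nablad i p t (s t) + p t (nablah i s t)]].
Proof.
have kappah : kappa + h != 0 by rewrite addr_eq0.
have arch := @cplx_archimedean R; have mix := @cplx_mixed_partials R.
have Vl := vir_lin hh hXY hpsi hchi.
have ml := mvir_lin hh hXY hpsi hchi; have mc := mvir_comm hh hXY hpsi hchi.
have Vc := slot_vir_comm hh hXY hpsi hchi.
move=> M varpi mvarpi nablah; pose mvir i (v : M) := - slot_vir X Y h kappa (-1) i v; split.
- split; [exact: constant_strongly_flat Vc|exact: (constant_strongly_flat (T := mvir) mc)| |].
    exact: constant_flat_connection Vl Vc mix.
  exact: (constant_flat_connection (T := mvir) ml mc mix).
- move=> U f s oU Uc hf sl; split.
    exact: (lsec_gDact arch (slot_smooth hh kappah hXY hpsi hchi) oU Uc hf sl).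
  move=> i; split=> [|t Ut]; first exact: gDsec_gDpderiv.
  exact: (nabla_gDact arch hh kappah hXY hpsi hchi i oU Uc hf sl Ut).
- split; first exact: (covac_fibre_at arch hh kappah hXY hpsi hchi).
  exact: (covac_descent arch mix hh kappah hXY hpsi hchi).
move=> nablad; split.
- exact: (dual_strongly_flat hh hXY hpsi hchi).
- split; first exact: (dual_connection hh hXY hpsi hchi).
  exact: (dual_flat mix hh hXY hpsi hchi).
- exact: (vac_connection arch mix hh kappah hXY hpsi hchi).
move=> U p s oU Uc hp sl i t Ut.
exact: (dual_nabla_pairing h kappa X Y i oU hp sl Ut).
Qed.
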